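(* Let $V^{[1]},\dots,V^{[P]}\in\mathbb C^2$ with $|V^{[\lambda]}|=1$, let $X=V^{[1]}\otimes\cdots\otimes V^{[P]}$, and let $S(X)=(S^{[1]}(X),\dots,S^{[P]}(X))\in(S_2)^P$ with $S^{[\lambda]}(X)=(\langle\sigma_1V^{[\lambda]},V^{[\lambda]}\rangle,\langle\sigma_2V^{[\lambda]},V^{[\lambda]}\rangle,\langle\sigma_3V^{[\lambda]},V^{[\lambda]}\rangle)$. Then for every $M\in\mathbb R^P$, $$\langle A_MX,X\rangle=-\frac12\int_{\mathbb R^3}\big|\mathbf B^{\rm class}(x,S(X))\big|^2dx-A_{11}(0)\sum_{\lambda=1}^P(M^{[\lambda]})^2,$$ where $A_{11}(0)=(2\pi)^{-3}\int_{\mathbb R^3}|\phi(|k|)|^2\frac{|k|^2-k_1^2}{|k|^2}dk$.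
   Context: Fix an integer $P\ge1$ and points $x^{[1]},\dots,x^{[P]}\in\mathbb R^3$. Let $\phi\in\mathcal S(\mathbb R)$ and for $k\in\mathbb R^3$ write $\phi(|k|)$. Let $\mathfrak H=\{V\in L^2(\mathbb R^3,\mathbb C^3):\ k\cdot V(k)=0\text{ a.e.}\}$, $\mathcal H_{\rm ph}$ the symmetric Fock space over $\mathfrak H$ with vacuum $\Psi_0$, Segal fields $\Phi_S(V)=\frac1{\sqrt2}(a^*(V)+a(V))$, $H_{\rm ph}=d\Gamma(M_\omega)$ with $M_\omega$ multiplication by $|k|$. Let $\mathcal H_{\rm sp}=(\mathbb C^2)^{\otimes P}$, $\sigma_1,\sigma_2,\sigma_3$ the Pauli matrices, $\sigma_m^{[\lambda]}$ acting as $\sigma_m$ on the $\lambda$-th factor and identity elsewhere. $B_{m,x}(k)=\frac{i\phi(|k|)|k|^{1/2}}{(2\pi)^{3/2}}e^{-ik\cdot x}\frac{k\times e_m}{|k|}$ ($e_m$ canonical basis of $\mathbb R^3$). For $M\in\mathbb R^P$, $H_{\rm int}(M)=\sum_{\lambda=1}^P\sum_{m=1}^3M^{[\lambda]}\Phi_S(B_{m,x^{[\lambda]}})\otimes\sigma_m^{[\lambda]}$, $EX=\Psi_0\otimes X$, and $A_MX=-E^*H_{\rm int}(M)(H_{\rm ph}^{-1}\otimes I)H_{\rm int}(M)EX$ (with $H_{\rm ph}^{-1}$ acting as multiplication by $1/|k|$ on the one-photon sector, where $H_{\rm int}(M)EX$ lies). $S_2$ is the unit sphere of $\mathbb R^3$.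 Let $\rho(x)=(2\pi)^{-3}\int_{\mathbb R^3}\phi(|k|)e^{ik\cdot x}dk$. For $S=(S^{[1]},\dots,S^{[P]})\in(S_2)^P$ let $\mathbf j^{\rm class}(x,S)=\sum_{\lambda=1}^PM^{[\lambda]}\nabla\rho(x-x^{[\lambda]})\times S^{[\lambda]}\in\mathbb R^3$ and let $\mathbf B^{\rm class}(\cdot,S)$ be the square-integrable vector field on $\mathbb R^3$ with $\nabla\cdot\mathbf B^{\rm class}=0$, $\nabla\times\mathbf B^{\rm class}=\mathbf j^{\rm class}(\cdot,S)$. *)

(* Defs.v *)
From HB Require Import structures.
From mathcomp Require Import all_boot all_order all_algebra.
From mathcomp Require Import all_classical all_reals all_analysis.
From mathcomp Require Import complex.
Set Implicit Arguments. Unset Strict Implicit. Unset Printing Implicit Defensive.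
Import Order.TTheory GRing.Theory Num.Theory numFieldNormedType.Exports.
Local Open Scope ring_scope.
Local Open Scope complex_scope.

(* ---------- Euclidean 3-space, modelled as (R * R) * R ---------- *)
Notation v3 R := (R * R * R)%type.

Definition coord {R : realType} (v : v3 R) (i : 'I_3) : R :=
  match val i with 0%N => v.1.1 | 1%N => v.1.2 | _ => v.2 end.

(* canonical basis e_1, e_2, e_3 (indexed 0,1,2) *)
Definition e3 {R : realType} (i : 'I_3) : v3 R :=
  (((val i == 0%N)%:R, (val i == 1%N)%:R), (val i == 2%N)%:R).

Definition dot3 {R : realType} (u v : v3 R) : R :=
  u.1.1 * v.1.1 + u.1.2 * v.1.2 + u.2 * v.2.

Definition norm3 {R : realType} (v : v3 R) : R := Num.sqrt (dot3 v v).

Definition cross3 {R : realType} (u v : v3 R) : v3 R :=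
  ((u.1.2 * v.2 - u.2 * v.1.2, u.2 * v.1.1 - u.1.1 * v.2),
    u.1.1 * v.1.2 - u.1.2 * v.1.1).

(* Lebesgue measure on R^3 (product of three copies of Lebesgue measure) *)
Definition leb3 (R : realType) :=
  ((@lebesgue_measure R \x @lebesgue_measure R) \x @lebesgue_measure R)%E.

(* integral over R^3 of a real function *)
Definition int3 {R : realType} (f : v3 R -> R) : R := Rintegral (@leb3 R) setT f.

(* integral over R^3 of a complex function: real part + i * imaginary part *)
Definition cint3 {R : realType} (f : v3 R -> R[i]) : R[i] :=
  (int3 (fun k => complex.Re (f k)))%:C + 'i * (int3 (fun k => complex.Im (f k)))%:C.

(* e^{i t} *)
Definition expi {R : realType} (t : R) : R[i] := (cos t) +i* (sin t).

(* partial derivative d/dx_i *)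
Definition pd {R : realType} (i : 'I_3) (f : v3 R -> R) (x : v3 R) : R :=
  'D_(e3 i) f x.

Definition grad {R : realType} (f : v3 R -> R) (x : v3 R) : v3 R :=
  ((pd 0 f x, pd 1 f x), pd 2 f x).

(* ---------- Schwartz class on R (real-valued) ---------- *)
Definition schwartz {R : realType} (f : R -> R) : Prop :=
  (forall (n : nat) (x : R), derivable (derive1n n f) x 1) /\
  (forall a b : nat, exists Cst : R, forall x : R,
      `|x| ^+ a * `|derive1n b f x| <= Cst).

(* ---------- classical objects ---------- *)
(* rho(x) = (2 pi)^{-3} \int phi(|k|) e^{i k.x} dk *)
Definition rho {R : realType} (phi : R -> R) (x : v3 R) : R[i] :=
  ((2 * pi) ^- 3)%:C * cint3 (fun k => (phi (norm3 k))%:C * expi (dot3 k x)).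

(* j^class(x,S) = sum_l M^l grad rho(x - x^l) x S^l  (rho is real) *)
Definition jclass {R : realType} (P : nat) (M : 'I_P -> R) (xs : 'I_P -> v3 R)
  (phi : R -> R) (S : 'I_P -> v3 R) (x : v3 R) : v3 R :=
  \sum_(l < P) M l *: cross3 (grad (fun y => complex.Re (rho phi y)) (x - xs l)) (S l).

Definition compB {R : realType} (B : v3 R -> v3 R) (i : 'I_3) : v3 R -> R :=
  fun x => coord (B x) i.

Definition div3 {R : realType} (B : v3 R -> v3 R) (x : v3 R) : R :=
  pd 0 (compB B 0) x + pd 1 (compB B 1) x + pd 2 (compB B 2) x.

Definition curl3 {R : realType} (B : v3 R -> v3 R) (x : v3 R) : v3 R :=
  ((pd 1 (compB B 2) x - pd 2 (compB B 1) x,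
    pd 2 (compB B 0) x - pd 0 (compB B 2) x),
    pd 0 (compB B 1) x - pd 1 (compB B 0) x).

(* B is (a C^1 representative of) B^class(., S): square integrable,
   divergence free, with curl equal to j^class(., S). *)
Definition is_Bclass {R : realType} (P : nat) (M : 'I_P -> R) (xs : 'I_P -> v3 R)
  (phi : R -> R) (S : 'I_P -> v3 R) (B : v3 R -> v3 R) : Prop :=
  [/\ (forall i x, differentiable (compB B i) x),
      (forall i j, continuous (fun x : v3 R => pd j (compB B i) x)),
      (@leb3 R).-integrable setT (fun x => (dot3 (B x) (B x))%:E),
      (forall x, div3 B x = 0) &
      (forall x, curl3 B x = jclass M xs phi S x)].

(* ---------- spin space (C^2)^{tensor P} ---------- *)
(* basis of (C^2)^{tensor P} indexed by spin configurations s : 'I_P -> 'I_2 *)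
Definition spinconf (P : nat) := {ffun 'I_P -> 'I_2}.
Definition sstate (R : realType) (P : nat) := spinconf P -> R[i].

Definition pauli {R : realType} (m : 'I_3) : 'M[R[i]]_2 :=
  \matrix_(a < 2, b < 2)
    match val m with
    | 0%N => (a != b)%:R
    | 1%N => if a == b then 0 else if val a == 0%N then - 'i else 'i
    | _ => if a == b then (if val a == 0%N then 1 else -1) else 0
    end.

(* sigma_m^{[l]} : sigma_m on the l-th factor *)
Definition sigma_at {R : realType} (P : nat) (l : 'I_P) (m : 'I_3)
  (X : sstate R P) : sstate R P :=
  fun s => \sum_(t < 2) pauli m (s l) t *
             X [ffun mu => if mu == l then t else s mu].

(* <X, Y> *)
Definition sdot {R : realType} (P : nat) (X Y : sstate R P) : R[i] :=
  \sum_(s : spinconf P) X s * (Y s)^*.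

(* V^{[1]} (x) ... (x) V^{[P]} *)
Definition prodX {R : realType} (P : nat) (V : 'I_P -> 'cV[R[i]]_2) : sstate R P :=
  fun s => \prod_(l < P) V l (s l) 0.

(* S^{[l]}(X)_m = <sigma_m V^{[l]}, V^{[l]}> (a real number) *)
Definition Sof {R : realType} (P : nat) (V : 'I_P -> 'cV[R[i]]_2) : 'I_P -> v3 R :=
  fun l => let c := fun m : 'I_3 =>
             complex.Re (\sum_(a < 2) (pauli m *m V l) a 0 * (V l a 0)^*) in
           ((c 0, c 1), c 2).

(* ---------- photon coupling functions ---------- *)
(* B_{m,x}(k)_j = i phi(|k|) |k|^{1/2} (2pi)^{-3/2} e^{-ik.x} (k x e_m)_j / |k| *)
Definition Bmx {R : realType} (phi : R -> R) (m : 'I_3) (x : v3 R) (k : v3 R)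
  (j : 'I_3) : R[i] :=
  'i * (phi (norm3 k) * Num.sqrt (norm3 k) / Num.sqrt ((2 * pi) ^+ 3))%:C
     * expi (- dot3 k x) * (coord (cross3 k (e3 m)) j / norm3 k)%:C.

(* States of the one-photon sector tensor spin space:
   k |-> (polarisation component j) |-> spin state *)
Definition onephoton (R : realType) (P : nat) := v3 R -> 'I_3 -> sstate R P.

(* H_int(M) E X : Phi_S(B) Psi_0 = a^*(B) Psi_0 / sqrt 2 = B / sqrt 2
   (one-photon sector) *)
Definition Hint_up {R : realType} (P : nat) (M : 'I_P -> R) (xs : 'I_P -> v3 R)
  (phi : R -> R) (X : sstate R P) : onephoton R P :=
  fun k j s => \sum_(l < P) \sum_(m < 3)
    (M l / Num.sqrt 2)%:C * Bmx phi m (xs l) k j * sigma_at l m X s.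

(* H_ph^{-1} (x) I on the one-photon sector: multiplication by 1/|k| *)
Definition Hph_inv {R : realType} (P : nat) (F : onephoton R P) : onephoton R P :=
  fun k j s => (1 / norm3 k)%:C * F k j s.

(* E^* H_int(M) on the one-photon sector: only the annihilation part
   a(B) F = <B, F> Psi_0 contributes to the vacuum component, and
   Phi_S(B) = (a^*(B) + a(B))/sqrt 2. *)
Definition EHint_down {R : realType} (P : nat) (M : 'I_P -> R) (xs : 'I_P -> v3 R)
  (phi : R -> R) (F : onephoton R P) : sstate R P :=
  fun s => \sum_(l < P) \sum_(m < 3)
    (M l / Num.sqrt 2)%:C *
      sigma_at l m (fun s' => cint3 (fun k =>
          \sum_(j < 3) (Bmx phi m (xs l) k j)^* * F k j s')) s.

(* A_M X = - E^* H_int(M) (H_ph^{-1} (x) I) H_int(M) E X *)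
Definition AM {R : realType} (P : nat) (M : 'I_P -> R) (xs : 'I_P -> v3 R)
  (phi : R -> R) (X : sstate R P) : sstate R P :=
  fun s => - EHint_down M xs phi (Hph_inv (Hint_up M xs phi X)) s.

(* A_11(0) = (2 pi)^{-3} \int |phi(|k|)|^2 (|k|^2 - k_1^2)/|k|^2 dk *)
Definition A110 {R : realType} (phi : R -> R) : R :=
  (2 * pi) ^- 3 * int3 (fun k =>
     `|phi (norm3 k)| ^+ 2 * ((norm3 k ^+ 2 - k.1.1 ^+ 2) / norm3 k ^+ 2)).

(* Main.v *)
(** Contracting the photon turns the left-hand side into a double sum over sites of
    -1/2 M_l M_l' G_mm'(x_l - x_l') <sigma_m^l sigma_m'^l' X, X>, where G_mm' is the cosine
    transform of (2 pi)^-3 phi(|k|)^2 (k x e_m).(k x e_m') / |k|^2.  For l <> l' the spin factor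
    is S^l_m S^l'_m'.  For l = l' it equals 1 when m = m', so that the diagonal contributes
    3 A_11(0) where the classical energy has only A_11(0) (as |S^l| = 1, G_mm(0) = A_11(0) by
    symmetry under coordinate swaps and G_mm'(0) = 0 off the diagonal by reflection): the excess
    is the self-energy term.

    The classical energy is computed on an explicit field B0, the Fourier integral of phi(|k|)
    times the transverse part of S^l.  Plancherel is proved with the weight exp(-e|x|_1), whose
    transform is a product of Poisson kernels.  Any other admissible B differs from B0 by a C^1
    square-integrable D with div D = 0 and curl D = 0, and such a D vanishes by a virial identity:
    the divergence of D (x.D) - x |D|^2 / 2 is -|D|^2 / 2, and the boundary term is controlled by
    a cutoff on a growing box. *)
Require Import Defs.
From HB Require Import structures.
From mathcomp Require Import all_boot all_order all_algebra.
From mathcomp Require Import all_classical all_reals all_analysis.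
From mathcomp Require Import measurable_realfun complex ring lra.
Import Order.TTheory GRing.Theory Num.Theory numFieldNormedType.Exports.
Local Open Scope ring_scope.
Local Open Scope classical_set_scope.
Set Implicit Arguments. Unset Strict Implicit. Unset Printing Implicit Defensive.

(** An admissible [B] is only C^1 and square integrable, so neither a Fourier transform nor second
    derivatives of it are at hand. Hence its energy is read off an explicit field, and uniqueness
    uses an identity of first order instead of harmonicity of the components. The multiplier x in
    that identity costs no decay at infinity: the derivatives of a cutoff at scale N bring factors
    x_i / N, bounded by 1 on the box, so every term is at most a constant times |D|^2 and dominated
    convergence applies.

    The two sides meet in one kernel, the transverse projection I - k k^T / |k|^2 times phi(|k|)^2.
    It arises classically because this projection is idempotent, and on the photon side because the
    two factors |k|^(1/2) of the coupling functions cancel the 1/|k| of the inverse Hamiltonian.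

    The projection has no limit at k = 0. Pointwise limits are therefore required only off the
    origin, and the convention 0^-1 = 0 keeps the algebraic identities true there. The Plancherel
    argument stays real: an even coefficient goes with the cosine, an odd one with the sine. *)

Notation T1 R := (measurableTypeR R).
Notation T2 R := (measurableTypeR R * measurableTypeR R)%type.
Notation T3 R := (measurableTypeR R * measurableTypeR R * measurableTypeR R)%type.

(** * Lebesgue measure on R^3 as an iterated sigma-finite product *)

Lemma sigma_finite_prod d1 d2 (X : measurableType d1) (Y : measurableType d2)
    (R : realType) (m1 : {sigma_finite_measure set X -> \bar R})
    (m2 : {sigma_finite_measure set Y -> \bar R}) :
  sigma_finite setT (m1 \x m2)%E.
Proof.
have /sigma_finiteP[F [TF ndF Foo]] := sigma_finiteT m1.
have /sigma_finiteP[G [TG ndG Goo]] := sigma_finiteT m2.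
exists (fun n => F n `*` G n).
  rewrite -setXTT TF TG; apply/seteqP; split=> -[x y].
    move=> [/= [n _ Fnx] [k _ Gky]]; exists (maxn n k) => //; split.
    - by move: x Fnx; exact/subsetPset/ndF/leq_maxl.
    - by move: y Gky; exact/subsetPset/ndG/leq_maxr.
  by move=> [n _ []/= ? ?]; split; exists n.
move=> k; have [? ?] := Foo k; have [? ?] := Goo k.
split; first exact: measurableX.
by rewrite product_measure1E// lte_mul_pinfty// ge0_fin_numE.
Qed.

(** Naming the planar factor lets [leb3] be read as [leb2] times a line, so that Fubini and the
    changes of variables apply twice, once per product. *)
Definition leb2 (R : realType) : set (T2 R) -> \bar R :=
  (@lebesgue_measure R \x @lebesgue_measure R)%E.
HB.instance Definition _ (R : realType) := Measure.on (@leb2 R).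
HB.instance Definition _ (R : realType) :=
  @Measure_isSigmaFinite.Build _ _ R (@leb2 R) (sigma_finite_prod _ _).
HB.instance Definition _ (R : realType) := Measure.on (@leb3 R).
HB.instance Definition _ (R : realType) :=
  @Measure_isSigmaFinite.Build _ _ R (@leb3 R) (sigma_finite_prod (@leb2 R) _).

(** * Borel measurability of continuous functions on R^3 *)

Section Borel.
(** The measurable sets of a product are generated by rectangles, so an open set has to be exhausted
    by countably many of them. The members of the family need not be open, and [ms] is a parameter
    because topology and measurability sit on different aliases of the same space. *)
Definition mbase (T : topologicalType) (ms : set (set T)) :=
  exists B : nat -> set T, (forall n, ms (B n)) /\
    forall U x, open U -> U x -> exists n, B n x /\ B n `<=` U.

Lemma mbaseR (R : realType) : @mbase R (@measurable _ (T1 R)).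
Proof.
(* Codes that decode to nothing give the empty interval ]0, 0[, which is harmless. *)
pose B n := let p := odflt (0, 0)%R (unpickle n : option (rat * rat)) in
  `](ratr p.1 : R), (ratr p.2 : R)[%classic.
exists B; split=> [n|U x]; first exact: measurable_itv.
rewrite openE => oU Ux.
have [e /= e0 eU] := oU _ Ux.
have [p] := @rat_in_itvoo R (x - e) x (ltac:(by rewrite gtrBl)).
have [q] := @rat_in_itvoo R x (x + e) (ltac:(by rewrite ltrDl)).
rewrite !in_itv/= => /andP[q1 q2] /andP[p1 p2].
exists (pickle (p, q)); rewrite /B pickleK/=; split.
  by rewrite in_itv/= p2 q1.
move=> y/=; rewrite in_itv/= => /andP[y1 y2]; apply: eU => /=.
by rewrite ltr_norml; apply/andP; split; lra.
Qed.

Lemma mbaseX (T T' : topologicalType) m m' m2 :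
  @mbase T m -> @mbase T' m' ->
  (forall A A', m A -> m' A' -> m2 (A `*` A')) -> @mbase (T * T')%type m2.
Proof.
move=> [B [mB B1]] [B' [mB' B1']] h.
pose C n := let p := odflt (0, 0)%N (unpickle n : option (nat * nat)) in
  B p.1 `*` B' p.2.
exists C; split=> [n|U [x y]]; first exact: h.
rewrite openE => oU /oU [[V V']] /= [].
rewrite !nbhsE /= => -[A [oA Ax] AV] [A' [oA' Ay] AV'] VU.
have [n [nx nA]] := B1 _ _ oA Ax; have [n' [ny nA']] := B1' _ _ oA' Ay.
exists (pickle (n, n')); rewrite /C pickleK/=; split=> // -[u v] [/= Bu Bv].
by apply: VU; split => /=; [apply/AV/nA|apply/AV'/nA'].
Qed.

Lemma mbase_v3 (R : realType) : @mbase (v3 R) (@measurable _ (T3 R)).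
Proof.
apply: (mbaseX (m := @measurable _ (T2 R))); last 2 first.
- exact: mbaseR.
- by move=> A A' mA mA'; exact: (@measurableX _ _ (T2 R) (T1 R)).
apply: mbaseX; [exact: mbaseR|exact: mbaseR|].
by move=> A A' mA mA'; exact: (@measurableX _ _ (T1 R) (T1 R)).
Qed.

(** An open set is the union of those among the countably many base sets that it contains, hence
    measurable for the product sigma-algebra. *)
Lemma continuous_measurable_v3 (R : realType) (f : v3 R -> R) :
  continuous f -> measurable_fun [set: T3 R] (f : T3 R -> R).
Proof.
move=> /continuousP cf; apply: (measurability _ (RGenOpens.measurableE R)).
move=> _ [_ [a [b ->] <-]]; rewrite setTI.
have oU : open (f @^-1` `]a, b[) by apply: cf; exact: interval_open.
set U := (X in measurable X) in oU *.
have [B [mB hB]] := mbase_v3 R.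
have -> : U = \bigcup_(n in [set n | B n `<=` U]) B n.
  apply/seteqP; split=> [x Ux|x [n /= nU nx]]; last exact: nU.
  by have [n [nx nU]] := hB U x oU Ux; exists n.
by apply: bigcup_measurable => n _.
Qed.
End Borel.

(** * Fubini for real-valued integrals *)

Section RFubini.
Context d1 d2 (X : measurableType d1) (Y : measurableType d2) (R : realType).
Variables (m1 : {sigma_finite_measure set X -> \bar R})
  (m2 : {sigma_finite_measure set Y -> \bar R}).
Variable f : X * Y -> R.
Hypothesis fi : (m1 \x m2)%E.-integrable setT (EFin \o f).

(** On a null set of fibres integrability may fail, and there [fine] may turn an infinite value into
    0. Hence equality only almost everywhere, which is all that the outer integral sees. *)
Lemma ae_eq_EFin_Rintegral1 : ae_eq m1 setT (fun x => \int[m2]_y (f (x, y))%:E)%E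
  (fun x => (\int[m2]_y f (x, y))%:E).
Proof.
apply: filterS (ae_integrable1 fi) => x /= ix _.
by rewrite /Rintegral fineK//; exact: (integrable_fin_num _ ix).
Qed.

Lemma ae_eq_EFin_Rintegral2 : ae_eq m2 setT (fun y => \int[m1]_x (f (x, y))%:E)%E
  (fun y => (\int[m1]_x f (x, y))%:E).
Proof.
apply: filterS (ae_integrable2 fi) => x /= ix _.
by rewrite /Rintegral fineK//; exact: (integrable_fin_num _ ix).
Qed.

Lemma measurable_Rintegral1 :
  measurable_fun setT (fun x => \int[m2]_y f (x, y)).
Proof.
have h := measurable_fubini_F fi.
by apply: (measurableT_comp (fine_measurable _)) h.
Qed.

Lemma measurable_Rintegral2 :
  measurable_fun setT (fun y => \int[m1]_x f (x, y)).
Proof.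
have h := measurable_fubini_G fi.
by apply: (measurableT_comp (fine_measurable _)) h.
Qed.

Lemma Rintegral12_prod :
  \int[m1]_x \int[m2]_y f (x, y) = \int[(m1 \x m2)%E]_z f z.
Proof.
rewrite /Rintegral -(integral12_prod_meas1 fi); congr fine.
apply: ae_eq_integral => //.
- by apply/measurable_EFinP; exact: measurable_Rintegral1.
- exact: (measurable_fubini_F fi).
- by apply: ae_eq_sym; exact: ae_eq_EFin_Rintegral1.
Qed.

Lemma Rintegral21_prod :
  \int[m2]_y \int[m1]_x f (x, y) = \int[(m1 \x m2)%E]_z f z.
Proof.
rewrite /Rintegral -(integral21_prod_meas1 fi); congr fine.
apply: ae_eq_integral => //.
- by apply/measurable_EFinP; exact: measurable_Rintegral2.
- exact: (measurable_fubini_G fi).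
- by apply: ae_eq_sym; exact: ae_eq_EFin_Rintegral2.
Qed.

Lemma RFubini :
  \int[m1]_x \int[m2]_y f (x, y) = \int[m2]_y \int[m1]_x f (x, y).
Proof. by rewrite Rintegral12_prod Rintegral21_prod. Qed.
End RFubini.

Lemma integrable_prodM d1 d2 (X : measurableType d1) (Y : measurableType d2)
    (R : realType) (m1 : {sigma_finite_measure set X -> \bar R})
    (m2 : {sigma_finite_measure set Y -> \bar R}) (f : X -> R) (g : Y -> R) :
  m1.-integrable setT (EFin \o f) -> m2.-integrable setT (EFin \o g) ->
  (m1 \x m2)%E.-integrable setT (EFin \o (fun z => f z.1 * g z.2)).
Proof.
move=> /integrableP[mf fi] /integrableP[mg gi].
have mf' : measurable_fun setT f by apply/measurable_EFinP.
have mg' : measurable_fun setT g by apply/measurable_EFinP.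
apply/integrable12ltyP.
  apply/measurable_EFinP; apply: measurable_funM.
    exact: measurableT_comp.
  exact: measurableT_comp.
rewrite /=.
have -> : (fun x => \int[m2]_y `|(f x * g y)%:E|)%E =
   (fun x => (`|f x|%:E * \int[m2]_y `|(g y)%:E|)%E).
  apply/funext => x; rewrite -ge0_integralZl//.
  - by apply: eq_integral => y _; rewrite /= normrM.
  - exact: measurableT_comp.
rewrite ge0_integralZr//; last 2 first.
- by apply/measurable_EFinP; exact: measurableT_comp.
- by apply: integral_ge0.
by apply: lte_mul_pinfty => //; [exact: integral_ge0|rewrite ge0_fin_numE//; exact: integral_ge0].
Qed.

(** * Affine changes of variables and exchanges of coordinates *)

Section scaling.
(** The constant [c] is the inverse Jacobian. Stating the property for nonnegative extended
    functions makes it stable under products by Tonelli, without integrability side conditions;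
    integrable functions follow through their positive and negative parts. *)
Definition scales d (X : measurableType d) (R : realType)
    (m : {measure set X -> \bar R}) (tau : X -> X) (c : R) :=
  [/\ measurable_fun setT tau, 0 <= c &
   forall g : X -> \bar R, measurable_fun setT g -> (forall x, 0 <= g x)%E ->
     (\int[m]_x g (tau x) = c%:E * \int[m]_x g x)%E].

Lemma scales_integrable d (X : measurableType d) (R : realType)
    (m : {measure set X -> \bar R}) tau (c : R) (f : X -> R) :
  scales m tau c -> m.-integrable setT (EFin \o f) ->
  m.-integrable setT (EFin \o (f \o tau)).
Proof.
move=> [mt c0 h] /integrableP[mf fi]; apply/integrableP; split.
  by apply: (measurableT_comp mf).
rewrite (h (fun x => `|(EFin \o f) x|)%E)//; last exact: measurableT_comp.
by apply: lte_mul_pinfty.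
Qed.

Lemma scales_Rintegral d (X : measurableType d) (R : realType)
    (m : {measure set X -> \bar R}) tau (c : R) (f : X -> R) :
  scales m tau c -> m.-integrable setT (EFin \o f) ->
  \int[m]_x f (tau x) = c * \int[m]_x f x.
Proof.
move=> [mt c0 h] fi.
have mf := measurable_int _ fi.
rewrite /Rintegral.
have -> : (\int[m]_x (f (tau x))%:E = c%:E * \int[m]_x (f x)%:E)%E.
  rewrite integralE [in RHS]integralE.
  have hp := integrable_pos_fin_num measurableT fi.
  have hn := integrable_neg_fin_num measurableT fi.
  rewrite muleBr//; last by rewrite fin_num_adde_defl// fin_numN.
  congr (_ - _)%E.
    etransitivity; last first.
      exact: (h _ (measurable_funepos mf) (funepos_ge0 _)).
    by apply: eq_integral => x _; rewrite (funepos_comp (EFin \o f) tau).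
  etransitivity; last first.
      exact: (h _ (measurable_funeneg mf) (funeneg_ge0 _)).
    by apply: eq_integral => x _; rewrite (funeneg_comp (EFin \o f) tau).
by rewrite fineM//; exact: (integrable_fin_num measurableT fi).
Qed.

Lemma scales_prod d1 d2 (X : measurableType d1) (Y : measurableType d2)
    (R : realType) (m1 : {sigma_finite_measure set X -> \bar R})
    (m2 : {sigma_finite_measure set Y -> \bar R}) t1 t2 (c1 c2 : R) :
  scales m1 t1 c1 -> scales m2 t2 c2 ->
  scales (m1 \x m2)%E (fun z => (t1 z.1, t2 z.2)) (c1 * c2).
Proof.
move=> [mt1 c10 h1] [mt2 c20 h2].
have mt : measurable_fun setT (fun z : X * Y => (t1 z.1, t2 z.2)).
  by apply/measurable_fun_pair; exact: measurableT_comp.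
split=> [//||g mg g0]; first exact: mulr_ge0.
rewrite fubini_tonelli1//; last exact: (measurableT_comp mg mt).
rewrite [in RHS]fubini_tonelli1// /fubini_F/=.
have mG := measurable_fun_fubini_tonelli_F (m2 := m2) g mg g0.
under eq_integral => x _.
  rewrite (h2 (fun y => g (t1 x, y)))//; first over.
  by apply: (measurableT_comp mg); exact: measurable_pair1.
rewrite ge0_integralZl//; last 2 first.
- by apply: (measurableT_comp mG mt1).
- by move=> x _; exact: integral_ge0.
rewrite (h1 (fubini_F m2 g))//; last by move=> x; exact: integral_ge0.
by rewrite EFinM muleA [(c2%:E * _)%E]muleC.
Qed.

Lemma scales_swap d (X : measurableType d) (R : realType)
    (m : {sigma_finite_measure set X -> \bar R}) :
  scales (m \x m)%E (fun z => (z.2, z.1)) 1.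
Proof.
have mt : measurable_fun setT (fun z : X * X => (z.2, z.1)).
  exact/measurable_fun_pair.
split=> [//|//|g mg g0].
rewrite fubini_tonelli1//; last exact: (measurableT_comp mg mt).
by rewrite [in RHS]fubini_tonelli2// mul1e.
Qed.

Lemma scales_id d (X : measurableType d) (R : realType)
  (m : {measure set X -> \bar R}) : scales m id 1.
Proof. by split=> // g _ _; rewrite mul1e. Qed.

(** [|s|] times the image of Lebesgue measure under the map agrees with Lebesgue measure on
    half-open intervals, so uniqueness identifies the two. *)
Lemma scales_affine (R : realType) (c s : R) : s != 0 ->
  scales (@lebesgue_measure R) (fun x : T1 R => c + s * x : T1 R) `|s|^-1.
Proof.
move=> s0.
have mt : measurable_fun [set: T1 R] (fun x : T1 R => c + s * x : T1 R).
  apply: measurable_funD; first exact: measurable_cst.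
  by apply: measurable_funM; [exact: measurable_cst|exact: measurable_id].
have ns : 0 < `|s| by rewrite normr_gt0.
split=> [//||g mg g0]; first by rewrite invr_ge0.
pose t_mix := isMeasurableFun.Build _ _ _ _ _ mt.
pose t := MeasurableFun.Pack (MeasurableFun.Class t_mix).
pose nu0 : {measure set (T1 R) -> \bar R} :=
  mscale (NngNum (normr_ge0 s)) (pushforward (@lebesgue_measure R) t).
pose nu := nu0 mt.
have nuE (A : set (T1 R)) : measurable A -> lebesgue_measure A = nu A.
  apply: lebesgue_measure_unique => _ [[a b] _ <-].
  have -> : nu `]a, b]%classic = (`|s|%:E *
      lebesgue_measure ((fun x : R => (c + s * x)%R) @^-1` `]a, b]))%E by [].
  rewrite lebesgue_measure_itv/= lte_fin.
  have [ps|ps] := ltrP 0 s.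
    have -> : (fun x : R => c + s * x) @^-1` `]a, b] =
        `] (a - c) / s, (b - c) / s]%classic.
      by apply/seteqP; split=> x /=; rewrite !in_itv/= ltr_pdivrMr// ler_pdivlMr//
        => /andP[h1 h2]; apply/andP; split; lra.
    rewrite lebesgue_measure_itv/= lte_fin ltr_pM2r ?invr_gt0// ltrD2r.
    case: ifP => ab; last by rewrite mule0.
    rewrite -!EFinB -EFinM gtr0_norm//; congr EFin.
    by rewrite -mulrBl mulrC divfK//; lra.
  (* A negative slope reverses the interval: the preimage of ]a, b] is closed on the left and open
     on the right, which leaves its length (b - a) / |s| unchanged. *)
  have {ps}ns' : s < 0 by rewrite lt_neqAle s0.
  have -> : (fun x : R => c + s * x) @^-1` `]a, b] =
      `[ (b - c) / s, (a - c) / s[%classic.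
    by apply/seteqP; split=> x /=; rewrite !in_itv/= ltr_ndivlMr// ler_ndivrMr//
        => /andP[h1 h2]; apply/andP; split; lra.
  rewrite lebesgue_measure_itv/= lte_fin ltr_nM2r ?invr_lt0// ltrD2r.
  case: ifP => ab; last by rewrite mule0.
  rewrite -!EFinB -EFinM ltr0_norm//; congr EFin.
  by rewrite -mulrBl mulNr mulrC divfK//; lra.
have -> : (\int[@lebesgue_measure R]_x g x = \int[nu]_x g x)%E.
  by apply: (eq_measure_integral nu) => A mA _; exact: nuE.
rewrite ge0_integral_mscale//= ge0_integral_pushforward//= preimage_setT.
by rewrite muleA -EFinM mulVf ?gt_eqF// mul1e.
Qed.

Variable R : realType.

Definition aff3 (c s x : v3 R) : v3 R :=
  ((c.1.1 + s.1.1 * x.1.1, c.1.2 + s.1.2 * x.1.2), c.2 + s.2 * x.2).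

Lemma scales_aff3 (c s : v3 R) : s.1.1 != 0 -> s.1.2 != 0 -> s.2 != 0 ->
  scales (@leb3 R) (aff3 c s) (`|s.1.1|^-1 * `|s.1.2|^-1 * `|s.2|^-1).
Proof.
move=> s1 s2 s3.
have h := scales_prod (scales_affine c.1.1 s1) (scales_affine c.1.2 s2).
exact: (@scales_prod _ _ _ _ R (@leb2 R) _ _ _ _ _ h (scales_affine c.2 s3)).
Qed.

Lemma scales_swap01 : scales (@leb3 R) (fun x : T3 R => ((x.1.2, x.1.1), x.2)) 1.
Proof.
have h := scales_swap (@lebesgue_measure R).
have := @scales_prod _ _ _ _ R (@leb2 R) _ _ _ _ _ h (scales_id (@lebesgue_measure R)).
by rewrite mulr1.
Qed.

(** In the nesting (R x R) x R the last two coordinates do not form a factor, so the integral is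
    unfolded into three iterated ones and Tonelli is applied to the inner two. *)
Lemma scales_swap12 : scales (@leb3 R) (fun x : T3 R => ((x.1.1, x.2), x.1.2)) 1.
Proof.
have mt : measurable_fun [set: T3 R] (fun x : T3 R => ((x.1.1, x.2), x.1.2)).
  apply/measurable_fun_pair; first apply/measurable_fun_pair => //.
  - by apply: measurableT_comp.
  - by apply: measurableT_comp.
have E (g : T3 R -> \bar R) : measurable_fun setT g -> (forall x, 0 <= g x)%E ->
   (\int[@leb3 R]_x g x = \int[lebesgue_measure]_x \int[lebesgue_measure]_y \int[lebesgue_measure]_z g ((x, y), z))%E.
  move=> mg g0.
  rewrite (@fubini_tonelli1 _ _ _ _ R (@leb2 R) lebesgue_measure g mg g0).
  rewrite fubini_tonelli1//.
    exact: (measurable_fun_fubini_tonelli_F (m2 := @lebesgue_measure R) g mg g0).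
  by move=> x; exact: integral_ge0.
split=> // g mg g0; rewrite mul1e E//; last exact: (measurableT_comp mg mt).
rewrite (E g mg g0); apply: eq_integral => x _ /=.
rewrite (fubini_tonelli (fun yz : T2 R => g ((x, yz.1), yz.2)))//.
apply: (measurableT_comp mg); apply/measurable_fun_pair => //.
by apply/measurable_fun_pair.
Qed.

End scaling.

(** * Calculus of integrals over R^3 *)

Section int3_basics.
Variable R : realType.
Implicit Types f g : v3 R -> R.

Definition i3 f := (@leb3 R).-integrable setT (EFin \o f).
Definition m3 f := measurable_fun [set: T3 R] (f : T3 R -> R).

Lemma i3_m3 f : i3 f -> m3 f.
Proof. by move=> fi; apply/measurable_EFinP; exact: measurable_int fi. Qed.

Lemma i3_le f g : m3 f -> i3 g -> (forall x, `|f x| <= g x) -> i3 f.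
Proof.
move=> mf gi fg; apply: (le_integrable measurableT _ _ gi).
  exact/measurable_EFinP.
move=> x _ /=; rewrite lee_fin (le_trans (fg x))//; exact: ler_norm.
Qed.

Lemma i3_eq f g : f =1 g -> i3 f -> i3 g.
Proof. by move=> /funext ->. Qed.

Lemma i3D f g : i3 f -> i3 g -> i3 (fun x => f x + g x).
Proof. by move=> fi gi; apply: (integrableD measurableT fi gi). Qed.

Lemma i3B f g : i3 f -> i3 g -> i3 (fun x => f x - g x).
Proof. by move=> fi gi; apply: (integrableB measurableT fi gi). Qed.

Lemma i3Z (c : R) f : i3 f -> i3 (fun x => c * f x).
Proof. by move=> fi; apply: (integrableZl measurableT c fi). Qed.

Lemma i3_norm f : i3 f -> i3 (fun x => `|f x|).
Proof. by move=> fi; apply: (integrable_norm fi). Qed.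

Lemma i3_0 : i3 (fun=> 0).
Proof. exact: integrable0. Qed.

Lemma i3_sum I (s : seq I) (P : pred I) (F : I -> v3 R -> R) :
  (forall i, i3 (F i)) -> i3 (fun x => \sum_(i <- s | P i) F i x).
Proof.
move=> Fi; elim: s => [|i s IH].
  by apply: i3_eq i3_0 => x; rewrite big_nil.
case Pi : (P i).
  by apply: i3_eq (i3D (Fi i) IH) => x; rewrite big_cons Pi.
by apply: i3_eq IH => x; rewrite big_cons Pi.
Qed.

Lemma i3M_bounded f g (C : R) : i3 f -> m3 g -> (forall x, `|g x| <= C) ->
  i3 (fun x => f x * g x).
Proof.
move=> fi mg gC; apply: (i3_le (g := fun x => C * `|f x|)).
- by apply: measurable_funM => //; exact: i3_m3.
- exact/i3Z/i3_norm.
- by move=> x; rewrite normrM mulrC ler_wpM2r.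
Qed.

Lemma int3D f g : i3 f -> i3 g ->
  int3 (fun x => f x + g x) = int3 f + int3 g.
Proof. by move=> fi gi; exact: RintegralD. Qed.

Lemma int3B f g : i3 f -> i3 g ->
  int3 (fun x => f x - g x) = int3 f - int3 g.
Proof. by move=> fi gi; exact: RintegralB. Qed.

Lemma int3Z (c : R) f : i3 f -> int3 (fun x => c * f x) = c * int3 f.
Proof. by move=> fi; exact: RintegralZl. Qed.

Lemma int3_0 : int3 (fun=> 0 : R) = 0.
Proof. by rewrite /int3 Rintegral_cst// mul0r. Qed.

Lemma int3_eq f g : f =1 g -> int3 f = int3 g.
Proof. by move=> /funext ->. Qed.

Lemma int3_sum I (s : seq I) (P : pred I) (F : I -> v3 R -> R) :
  (forall i, i3 (F i)) ->
  int3 (fun x => \sum_(i <- s | P i) F i x) = \sum_(i <- s | P i) int3 (F i).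
Proof.
move=> Fi; elim: s => [|i s IH].
  by rewrite big_nil -[RHS]int3_0; apply: int3_eq => x; rewrite big_nil.
rewrite big_cons -IH; case Pi : (P i).
  rewrite -int3D//; last exact: i3_sum.
  by apply: int3_eq => x; rewrite big_cons Pi.
by apply: int3_eq => x; rewrite big_cons Pi.
Qed.

Lemma le_int3 f g : i3 f -> i3 g -> (forall x, f x <= g x) -> int3 f <= int3 g.
Proof. by move=> fi gi fg; exact: le_Rintegral. Qed.

Lemma norm_int3_le f g : i3 f -> i3 g -> (forall x, `|f x| <= g x) ->
  `|int3 f| <= int3 g.
Proof.
move=> fi gi fg; apply: (le_trans (le_normr_Rintegral _ fi)) => //.
by apply: le_int3 => //; exact: i3_norm.
Qed.

Lemma EFin_int3 f : i3 f -> (\int[@leb3 R]_x (f x)%:E)%E = (int3 f)%:E.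
Proof.
by move=> fi; rewrite /int3 /Rintegral fineK//; exact: (integrable_fin_num _ fi).
Qed.

Lemma m3_1 : m3 (fun x => x.1.1).
Proof. by apply: (measurableT_comp measurable_fst); exact: measurable_fst. Qed.
Lemma m3_2 : m3 (fun x => x.1.2).
Proof. by apply: (measurableT_comp measurable_snd); exact: measurable_fst. Qed.
Lemma m3_3 : m3 (fun x => x.2).
Proof. exact: measurable_snd. Qed.

Lemma m3_dot3 q : m3 (fun x => dot3 q x).
Proof.
apply: measurable_funD; first apply: measurable_funD.
- by apply: measurable_funM => //; exact: m3_1.
- by apply: measurable_funM => //; exact: m3_2.
- by apply: measurable_funM => //; exact: m3_3.
Qed.
Lemma dot3C (x y : v3 R) : dot3 x y = dot3 y x.
Proof. by rewrite /dot3 (mulrC x.1.1) (mulrC x.1.2) (mulrC x.2). Qed.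

Lemma m3_cos f : m3 f -> m3 (fun x => cos (f x)).
Proof.
by move=> mf; apply: (measurableT_comp (continuous_measurable_fun _)) mf; exact: continuous_cos.
Qed.
Lemma m3_sin f : m3 f -> m3 (fun x => sin (f x)).
Proof.
by move=> mf; apply: (measurableT_comp (continuous_measurable_fun _)) mf; exact: continuous_sin.
Qed.

Lemma i3_prod (f1 f2 f3 : T1 R -> R) :
  (@lebesgue_measure R).-integrable setT (EFin \o f1) ->
  (@lebesgue_measure R).-integrable setT (EFin \o f2) ->
  (@lebesgue_measure R).-integrable setT (EFin \o f3) ->
  i3 (fun x => f1 x.1.1 * f2 x.1.2 * f3 x.2).
Proof.
move=> i1 i2 i3; have h := integrable_prodM i1 i2.
exact: (@integrable_prodM _ _ _ _ R (@leb2 R) _ _ _ h i3).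
Qed.

Lemma int3_iter f : i3 f -> int3 f =
  \int[@leb2 R]_u \int[@lebesgue_measure R]_z f (u, z).
Proof.
by move=> fi; rewrite (@Rintegral12_prod _ _ _ _ R (@leb2 R) (@lebesgue_measure R) f fi).
Qed.
End int3_basics.

(** * Integrals on the line: the cosine against exp(-e|x|), and the Cauchy density *)

Section Laplace.
Variable R : realType.
Notation lam := (@lebesgue_measure R).

(** Adding 1 to the cosine makes the integrand nonnegative, so that the fundamental theorem for
    nonnegative functions on a half-line applies. The cosine alone is recovered by subtraction in
    [Rint_expabs_cos]. *)
Lemma half_exp_cos (e q c : R) : 0 < e ->
  (\int[lam]_(x in `[0%R, +oo[) (expR (- e * x) * (1 + cos (q * x + c)))%:E =
   (e^-1 - (q * sin c - e * cos c) / (e ^+ 2 + q ^+ 2))%:E)%E.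
Proof.
move=> e0.
have d0 : 0 < e ^+ 2 + q ^+ 2 by rewrite ltr_pwDl ?exprn_gt0// sqr_ge0.
(* The term [- e^-1] integrates the constant 1; the fraction comes from integrating exp(-e x) cos(q
   x + c) by parts twice. *)
pose F (x : R) : R := expR (- e * x) * (- e^-1 + (q * sin (q * x + c) - e * cos (q * x + c)) / (e ^+ 2 + q ^+ 2)).
have dF (x : R) : is_derive x 1 F (expR (- e * x) * (1 + cos (q * x + c))).
  rewrite /F; apply: is_derive_eq.
  rewrite /GRing.scale/= !mulr1 !addr0 ?mul0r ?mulr0 ?add0r ?addr0.
  field; rewrite gt_eqF//= gt_eqF//.
have cF : continuous F.
  by move=> x; apply/differentiable_continuous/derivable1_diffP; case: (dF x).
have cf : continuous (fun x : R => expR (- e * x) * (1 + cos (q * x + c))).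
  by move=> x; apply/differentiable_continuous/derivable1_diffP; exact: ex_derive.
rewrite (@ge0_continuous_FTC2y _ _ F _ 0)//.
- transitivity ((0 - F 0)%R%:E) => //; congr EFin.
  by rewrite /F !mulr0 expR0 mul1r !add0r; lra.
- exact: (continuous_subspaceT cf).
(* [K] bounds the oscillating factor of [F], which is thus squeezed to 0 at infinity. *)
- pose K := e^-1 + (`|q| + e) / (e ^+ 2 + q ^+ 2).
  have FK x : `|F x| <= K * expR (- (x * e)).
    rewrite /F normrM (ger0_norm (expR_ge0 _)) mulNr (mulrC x e) (mulrC K).
    apply: ler_wpM2l; first exact: expR_ge0.
    apply: (le_trans (ler_normD _ _)); rewrite normrN gtr0_norm ?invr_gt0//.
    rewrite lerD2l normrM (gtr0_norm (x := _^-1)) ?invr_gt0//.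
    apply: ler_wpM2r; first by rewrite invr_ge0 ltW.
    apply: (le_trans (ler_normB _ _)); rewrite !normrM; apply: lerD.
      by rewrite ler_piMr// sin_max.
    by rewrite (gtr0_norm e0) ler_piMr ?cos_max// ltW.
  have E0 : K * expR (- (x * e)) @[x --> +oo] --> 0.
    rewrite -[X in _ --> X](mulr0 K); apply: cvgMr.
    have : x * e @[x --> +oo] --> +oo by apply: gt0_cvgMly.
    by move=> h; exact: (cvg_comp _ _ h (@cvgr_expR R)).
  apply: (squeeze_cvgr (f := fun x => - (K * expR (- (x * e)))) _ _ E0).
    by apply: nearW => x; rewrite -ler_norml.
  by rewrite -[X in _ --> X]oppr0; exact: cvgN.
- by apply: cvg_at_right_filter; exact: cF.
- by move=> x _; rewrite derive1E; exact: derive_val.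
Qed.

Definition expcos (e q c x : R) : R := expR (- e * `|x|) * (1 + cos (q * x + c)).

Lemma measurable_expabs (e : R) :
  measurable_fun [set: T1 R] (fun x : T1 R => expR (- e * `|x|) : T1 R).
Proof.
apply: (measurableT_comp (continuous_measurable_fun _)).
  exact: continuous_expR.
by apply: measurable_funM => //; exact: measurableT_comp.
Qed.

Lemma measurable_expcos (e q c : R) :
  measurable_fun [set: T1 R] (expcos e q c : T1 R -> T1 R).
Proof.
apply: measurable_funM; first exact: measurable_expabs.
apply: measurable_funD => //.
apply: (measurableT_comp (continuous_measurable_fun _)).
  exact: continuous_cos.
by apply: measurable_funD => //; exact: measurable_funM.
Qed.

Lemma expcos_ge0 e q c x : 0 <= expcos e q c x.
Proof.
apply: mulr_ge0; first exact: expR_ge0.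
by rewrite -lerBlDl sub0r; exact: cos_geN1.
Qed.

(** The negative half-line is the positive one with [q] replaced by [- q]: the two terms in
    [q * sin c] cancel and those in [e * cos c] add up. *)
Lemma full_expcos (e q c : R) : 0 < e ->
  (\int[lam]_x (expcos e q c x)%:E =
   (2 * e^-1 + cos c * (2 * e / (e ^+ 2 + q ^+ 2)))%:E)%E.
Proof.
move=> e0.
have d0 : 0 < e ^+ 2 + q ^+ 2 by rewrite ltr_pwDl ?exprn_gt0// sqr_ge0.
have m (A : set R) : measurable (A : set (T1 R)) ->
    measurable_fun (A : set (T1 R)) (fun x => (expcos e q c x)%:E).
  move=> mA; apply/measurable_EFinP; apply: measurable_funTS.
  exact: measurable_expcos.
have -> : [set: R] = `]-oo, 0%R] `|` `]0%R, +oo[.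
  by rewrite -itv_bndbnd_setU// set_itvNyy.
rewrite ge0_integral_setU//=; last 3 first.
- by apply: m; apply: measurableU; exact: measurable_itv.
- by move=> x _; rewrite lee_fin expcos_ge0.
- apply/disj_setPS => x []/=; rewrite !in_itv/= andbT => h1 h2.
  by move: (le_lt_trans h1 h2); rewrite ltxx.
have -> : (\int[lam]_(x in `]-oo, 0%R]) (expcos e q c x)%:E =
    \int[lam]_(x in `[0%R, +oo[) (expcos e q c (- x))%:E)%E.
  rewrite (ge0_integration_by_substitution0 (f := fun x => (expcos e q c (- x))%:E)).
  - by apply: eq_integral => x _; rewrite opprK.
  - apply/measurable_EFinP; apply: (measurableT_comp (measurable_expcos _ _ _)).
    exact: oppr_measurable.
  - by move=> x; rewrite lee_fin expcos_ge0.
rewrite integral_itv_obnd_cbnd; last exact: m.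
have -> : (\int[lam]_(x in `[0%R, +oo[) (expcos e q c x)%:E =
    (e^-1 - (q * sin c - e * cos c) / (e ^+ 2 + q ^+ 2))%:E)%E.
  rewrite -half_exp_cos//; apply: eq_integral => x; rewrite inE/= in_itv/= andbT => x0.
  by rewrite /expcos ger0_norm.
have -> : (\int[lam]_(x in `[0%R, +oo[) (expcos e q c (- x))%:E =
    (e^-1 - (- q * sin c - e * cos c) / (e ^+ 2 + (- q) ^+ 2))%:E)%E.
  have E (x : R) : 0 <= x ->
      expcos e q c (- x) = expR (- e * x) * (1 + cos (- q * x + c)).
    by move=> x0; rewrite /expcos normrN ger0_norm//; congr (_ * (1 + cos _)); ring.
  rewrite -half_exp_cos//; apply: eq_integral => x; rewrite inE/= in_itv/= andbT => x0.
  exact: (congr1 EFin (E x x0)).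
rewrite -EFinD sqrrN; congr EFin; field.
by rewrite !gt_eqF.
Qed.

Lemma integrable_expcos e q c : 0 < e ->
  lam.-integrable setT (EFin \o expcos e q c).
Proof.
move=> e0; apply/integrableP; split.
  by apply/measurable_EFinP; exact: measurable_expcos.
under eq_integral => x _ do
  rewrite /= ger0_norm ?expcos_ge0//.
by rewrite full_expcos// ltry.
Qed.

Lemma integrable_expabs e : 0 < e ->
  lam.-integrable setT (EFin \o (fun x => expR (- e * `|x|))).
Proof.
move=> e0; apply: le_integrable (integrable_expcos 0 0 e0) => //.
  by apply/measurable_EFinP; exact: measurable_expabs.
move=> x _; rewrite /= lee_fin /expcos mul0r addr0 cos0.
by rewrite normrM ler_peMr// ger0_norm//; lra.
Qed.

Lemma integrable_expabs_cos e q c : 0 < e ->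
  lam.-integrable setT (EFin \o (fun x => expR (- e * `|x|) * cos (q * x + c))).
Proof.
move=> e0.
have := integrableB measurableT (integrable_expcos q c e0) (integrable_expabs e0).
apply: eq_integrable => // x _ /=.
by rewrite -EFinB /expcos mulrDr mulr1 addrC addKr.
Qed.

Lemma Rint_expabs_cos e q c : 0 < e ->
  \int[lam]_x (expR (- e * `|x|) * cos (q * x + c)) =
  cos c * (2 * e / (e ^+ 2 + q ^+ 2)).
Proof.
move=> e0.
have d0 : 0 < e ^+ 2 + q ^+ 2 by rewrite ltr_pwDl ?exprn_gt0// sqr_ge0.
have h q' c' : \int[lam]_x expcos e q' c' x =
   2 * e^-1 + cos c' * (2 * e / (e ^+ 2 + q' ^+ 2)).
  by rewrite /Rintegral full_expcos.
have E q' c' : \int[lam]_x expcos e q' c' x = \int[lam]_x expR (- e * `|x|) +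
    \int[lam]_x (expR (- e * `|x|) * cos (q' * x + c')).
  rewrite -RintegralD//; [|exact: integrable_expabs|exact: integrable_expabs_cos].
  by apply: eq_Rintegral => x _; rewrite /expcos mulrDr mulr1.
(* At [q = c = 0] the cosine is 1 and the identity reads 2 I = 4 / e, where I is the integral of
   exp(-e|x|). This I is then subtracted from the general case. *)
have E0 := E 0 0; have := E q c.
rewrite h => Eq; rewrite h in E0.
have E1 : \int[lam]_x (expR (- e * `|x|) * cos (0 * x + 0)) =
   \int[lam]_x expR (- e * `|x|).
  by apply: eq_Rintegral => x _; rewrite mul0r addr0 cos0 mulr1.
rewrite E1 cos0 in E0.
have : \int[lam]_x expR (- e * `|x|) = 2 * e^-1.
  have : 2 * \int[lam]_x expR (- e * `|x|) = 4 * e^-1.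
    by rewrite mulr_natl mulr2n -E0; field; rewrite gt_eqF.
  lra.
by move=> h0; rewrite h0 in Eq; apply: (addrI (2 / e)); rewrite -Eq.
Qed.

Lemma integral_oneDsqr : (\int[lam]_x ((1 + x ^+ 2)^-1)%:E = pi%:E)%E.
Proof.
have m (A : set R) : measurable (A : set (T1 R)) ->
    measurable_fun (A : set (T1 R)) (fun x : R => ((1 + x ^+ 2)^-1)%:E).
  move=> mA; apply/measurable_EFinP; apply: measurable_funTS.
  by apply: continuous_measurable_fun; exact: continuous_oneDsqrV.
have g0 (x : R) : 0 <= (1 + x ^+ 2)^-1 by rewrite invr_ge0 addr_ge0// sqr_ge0.
have -> : [set: R] = `]-oo, 0%R] `|` `]0%R, +oo[.
  by rewrite -itv_bndbnd_setU// set_itvNyy.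
rewrite ge0_integral_setU//=; last 3 first.
- by apply: m; apply: measurableU; exact: measurable_itv.
- by move=> x _; rewrite lee_fin.
- apply/disj_setPS => x []/=; rewrite !in_itv/= andbT => h1 h2.
  by move: (le_lt_trans h1 h2); rewrite ltxx.
have -> : (\int[lam]_(x in `]-oo, 0%R]) ((1 + x ^+ 2)^-1)%:E =
    \int[lam]_(x in `[0%R, +oo[) ((1 + x ^+ 2)^-1)%:E)%E.
  rewrite (ge0_integration_by_substitution0 (f := fun x : R => ((1 + x ^+ 2)^-1)%:E)).
  - by apply: eq_integral => x _; rewrite sqrrN.
  - by apply: m.
  - by move=> x; rewrite lee_fin.
rewrite integral_itv_obnd_cbnd; last exact: m.
by rewrite integral0y_oneDsqr -EFinD; congr EFin; lra.
Qed.

Lemma integrable_oneDsqr :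
  lam.-integrable setT (EFin \o (fun x : R => (1 + x ^+ 2)^-1)).
Proof.
apply/integrableP; split.
  by apply/measurable_EFinP; apply: continuous_measurable_fun; exact: continuous_oneDsqrV.
under eq_integral => x _ do
  rewrite /= ger0_norm ?invr_ge0 ?addr_ge0 ?sqr_ge0//.
by rewrite integral_oneDsqr ltry.
Qed.
End Laplace.

(** * The weight exp(-e|x|_1) and its product Poisson kernel *)

Section weight.
Variable R : realType.
Notation lam := (@lebesgue_measure R).

Definition w3 (e : R) (x : v3 R) : R :=
  expR (- e * `|x.1.1|) * expR (- e * `|x.1.2|) * expR (- e * `|x.2|).
(** This is 2 pi times the Poisson kernel of height [e], so for [e > 0] its mass 2 pi does not
    depend on [e]. *)
Definition lz (e q : R) : R := 2 * e / (e ^+ 2 + q ^+ 2).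
Definition gam (e : R) (q : v3 R) : R := lz e q.1.1 * lz e q.1.2 * lz e q.2.

Lemma i3_w3 e : 0 < e -> i3 (w3 e).
Proof. by move=> e0; exact: (i3_prod (integrable_expabs e0) (integrable_expabs e0) (integrable_expabs e0)). Qed.

Lemma w3_ge0 e x : 0 <= w3 e x.
Proof. by rewrite !mulr_ge0 ?expR_ge0. Qed.

(** The free phase [c] absorbs the coordinates not yet integrated; each integration returns the
    cosine of the remaining phase, so only the one-dimensional cosine integral is ever called. *)
Lemma int2_w_cos e (q1 q2 c : R) : 0 < e ->
  \int[@leb2 R]_u (expR (- e * `|u.1|) * expR (- e * `|u.2|) *
     cos (q1 * u.1 + q2 * u.2 + c)) = cos c * (lz e q1 * lz e q2).
Proof.
move=> e0.
pose f (u : T2 R) : R := expR (- e * `|u.1|) * expR (- e * `|u.2|) *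
     cos (q1 * u.1 + q2 * u.2 + c).
have fi : (@leb2 R).-integrable setT (EFin \o f).
  have := integrable_prodM (integrable_expabs e0) (integrable_expabs e0).
  apply: le_integrable => //.
    apply/measurable_EFinP; apply: measurable_funM.
      apply: measurable_funM.
        exact: (measurableT_comp (measurable_expabs e) measurable_fst).
      exact: (measurableT_comp (measurable_expabs e) measurable_snd).
    apply: (measurableT_comp (continuous_measurable_fun _)).
      exact: continuous_cos.
    apply: measurable_funD => //; apply: measurable_funD.
      by apply: measurable_funM => //; exact: measurable_fst.
    by apply: measurable_funM => //; exact: measurable_snd.
  by move=> u _ /=; rewrite lee_fin normrM ler_piMr// ler_norml cos_geN1 cos_le1.
rewrite -(Rintegral12_prod (m1 := lam) (m2 := lam) fi).
transitivity (\int[lam]_x (lz e q2 * (expR (- e * `|x|) * cos (q1 * x + c)))).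
  apply: eq_Rintegral => x _; rewrite /f/=.
  transitivity (\int[lam]_y (expR (- e * `|x|) * (expR (- e * `|y|) * cos (q2 * y + (q1 * x + c))))).
    by apply: eq_Rintegral => y _; rewrite mulrA; congr (_ * cos _); ring.
  rewrite RintegralZl//; last exact: integrable_expabs_cos.
  by rewrite Rint_expabs_cos// /lz; ring.
rewrite RintegralZl//; last exact: integrable_expabs_cos.
by rewrite Rint_expabs_cos// /lz; ring.
Qed.

Lemma i3_w_cos e (q : v3 R) c : 0 < e -> i3 (fun x => w3 e x * cos (dot3 q x + c)).
Proof.
move=> e0; apply: (i3M_bounded (C := 1)); first exact: i3_w3.
  by apply: m3_cos; apply: measurable_funD => //; exact: m3_dot3.
by move=> x; rewrite ler_norml cos_geN1 cos_le1.
Qed.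

Lemma int3_w_cos e (q : v3 R) c : 0 < e ->
  int3 (fun x => w3 e x * cos (dot3 q x + c)) = cos c * gam e q.
Proof.
move=> e0; rewrite int3_iter; last exact: i3_w_cos.
transitivity (\int[@leb2 R]_u (lz e q.2 * (expR (- e * `|u.1|) * expR (- e * `|u.2|) *
     cos (q.1.1 * u.1 + q.1.2 * u.2 + c)))).
  apply: eq_Rintegral => u _.
  transitivity (\int[lam]_y (expR (- e * `|u.1|) * expR (- e * `|u.2|) *
    (expR (- e * `|y|) * cos (q.2 * y + (q.1.1 * u.1 + q.1.2 * u.2 + c))))).
    by apply: eq_Rintegral => y _; rewrite /w3 /dot3/= mulrA; congr (_ * cos _); ring.
  rewrite RintegralZl//; last exact: integrable_expabs_cos.
  by rewrite Rint_expabs_cos// /lz; ring.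
have fi : (@leb2 R).-integrable setT (EFin \o (fun u => expR (- e * `|u.1|) * expR (- e * `|u.2|) *
     cos (q.1.1 * u.1 + q.1.2 * u.2 + c))).
  have := integrable_prodM (integrable_expabs e0) (integrable_expabs e0).
  apply: le_integrable => //.
    apply/measurable_EFinP; apply: measurable_funM.
      apply: measurable_funM.
        exact: (measurableT_comp (measurable_expabs e) measurable_fst).
      exact: (measurableT_comp (measurable_expabs e) measurable_snd).
    apply: (measurableT_comp (continuous_measurable_fun _)).
      exact: continuous_cos.
    apply: measurable_funD => //; apply: measurable_funD.
      by apply: measurable_funM => //; exact: measurable_fst.
    by apply: measurable_funM => //; exact: measurable_snd.
  by move=> u _ /=; rewrite lee_fin normrM ler_piMr// ler_norml cos_geN1 cos_le1.
by rewrite RintegralZl// int2_w_cos// /gam; ring.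
Qed.

Lemma int3_w_sin e (q : v3 R) : 0 < e ->
  int3 (fun x => w3 e x * sin (dot3 q x)) = 0.
Proof.
(* A shift by 3 pi / 2 turns the sine into a cosine, and the cosine of this phase is 0. *)
move=> e0; rewrite -[RHS](mul0r (gam e q)) -[X in X * _]oppr0 -(cos_pihalf R).
have -> : - cos (pi / 2) = cos (pi + pi / 2) :> R by rewrite addrC cosDpi.
rewrite -int3_w_cos//; apply: int3_eq => x; congr (_ * _).
by rewrite addrA cosDpihalf sinDpi opprK.
Qed.

(** The kernel [gam] at height 1, of mass (2 pi)^3. It serves a second time as the integrable
    majorant of the Fourier coefficients. *)
Definition Gam (u : v3 R) : R :=
  (2 * (1 + u.1.1 ^+ 2)^-1) * (2 * (1 + u.1.2 ^+ 2)^-1) * (2 * (1 + u.2 ^+ 2)^-1).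

Lemma oneDsqrV_gt0 (x : R) : 0 < (1 + x ^+ 2)^-1.
Proof. by rewrite invr_gt0 ltr_pwDl ?sqr_ge0. Qed.

Lemma Gam_ge0 u : 0 <= Gam u.
Proof. by rewrite /Gam !mulr_ge0// ltW// oneDsqrV_gt0. Qed.

Let i1 : lam.-integrable setT (EFin \o (fun x : R => 2 * (1 + x ^+ 2)^-1)).
Proof. exact: (integrableZl measurableT (2 : R) (@integrable_oneDsqr R)). Qed.

Lemma i3_Gam : i3 Gam.
Proof. exact: (i3_prod i1 i1 i1). Qed.

Lemma int3_Gam : int3 Gam = (2 * pi) ^+ 3.
Proof.
have E1 : \int[lam]_x (2 * (1 + x ^+ 2)^-1) = 2 * pi.
  rewrite RintegralZl//; last exact: integrable_oneDsqr.
  by rewrite /Rintegral integral_oneDsqr.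
rewrite int3_iter; last exact: i3_Gam.
transitivity (\int[@leb2 R]_u (2 * pi * ((2 * (1 + u.1 ^+ 2)^-1) * (2 * (1 + u.2 ^+ 2)^-1)))).
  apply: eq_Rintegral => u _; rewrite -[in RHS]E1 mulrC -RintegralZl//.
have i2 := integrable_prodM i1 i1.
rewrite RintegralZl// -(Rintegral12_prod (m1 := lam) (m2 := lam) i2)/=.
transitivity (2 * pi * \int[lam]_x (2 * pi * (2 * (1 + x ^+ 2)^-1))).
  congr (_ * _); apply: eq_Rintegral => x _; by rewrite RintegralZl// E1 mulrC.
by rewrite RintegralZl// E1; ring.
Qed.

Lemma gamN e q : gam e (- q) = gam e q.
Proof. by rewrite /gam /lz/= !sqrrN. Qed.

Definition dil (k : v3 R) (e : R) (u : v3 R) : v3 R := aff3 k ((e, e), e) u.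

Lemma lz_scale e u : 0 < e -> e * lz e (e * u) = 2 * (1 + u ^+ 2)^-1.
Proof.
move=> e0; rewrite /lz exprMn -[X in (X + _ * _)]mulr1 -mulrDr.
field; rewrite !gt_eqF// ?ltr_pwDl ?sqr_ge0//.
Qed.

Lemma m3_dil (f : v3 R -> R) k e : 0 < e -> m3 f -> m3 (fun u => f (dil k e u)).
Proof.
move=> e0 mf; have [|||mt _ _] := @scales_aff3 R k ((e, e), e); rewrite ?gt_eqF//.
exact: (measurableT_comp mf mt).
Qed.

Lemma lz_bound e q : 0 < e -> 0 <= lz e q <= 2 / e.
Proof.
move=> e0; have d0 : 0 < e ^+ 2 + q ^+ 2 by rewrite ltr_pwDl ?exprn_gt0// sqr_ge0.
apply/andP; split; first by rewrite /lz !mulr_ge0 ?invr_ge0 ?(ltW d0)// ltW.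
rewrite /lz ler_pdivrMr// mulrDr -[leLHS]addr0 lerD//.
  by rewrite expr2 mulrA divfK// gt_eqF.
by rewrite mulr_ge0 ?sqr_ge0// divr_ge0// ltW.
Qed.

Lemma i3_gam (a : v3 R -> R) (k : v3 R) (e : R) : 0 < e -> i3 a ->
  i3 (fun k' => a k' * gam e (k - k')).
Proof.
move=> e0 ai.
have mlz : measurable_fun [set: T1 R] (lz e : T1 R -> T1 R).
  apply: continuous_measurable_fun => x; apply/differentiable_continuous/derivable1_diffP.
  rewrite /lz; apply: ex_derive; apply: is_deriveM; apply: is_deriveV => //.
  by rewrite gt_eqF// ltr_pwDl ?exprn_gt0// sqr_ge0.
apply: (i3M_bounded (C := (2 / e) ^+ 3)) => //.
  apply: measurable_funM; first apply: measurable_funM.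
  - apply: (measurableT_comp mlz); apply: measurable_funB => //; exact: m3_1.
  - apply: (measurableT_comp mlz); apply: measurable_funB => //; exact: m3_2.
  - apply: (measurableT_comp mlz); apply: measurable_funB => //; exact: m3_3.
move=> x; set q := k - x; have /andP[h1 h1'] := lz_bound q.1.1 e0.
have /andP[h2 h2'] := lz_bound q.1.2 e0; have /andP[h3 h3'] := lz_bound q.2 e0.
have g0 : 0 <= gam e q by apply: mulr_ge0 => //; exact: mulr_ge0.
rewrite (ger0_norm g0) /gam.
have -> : (2 / e) ^+ 3 = 2 / e * (2 / e) * (2 / e) by ring.
apply: ler_pM => //; first exact: mulr_ge0.
exact: ler_pM.
Qed.

(* Rescales the convolution with the product Poisson kernel to unit width. *)
Lemma int3_gam (a : v3 R -> R) (k : v3 R) (e : R) : 0 < e -> i3 a ->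
  int3 (fun k' => a k' * gam e (k - k')) = int3 (fun u => a (dil k e u) * Gam u).
Proof.
move=> e0 ai; have fi := i3_gam k e0 ai.
have sc := @scales_aff3 R k ((e, e), e) (ltac:(by rewrite /= gt_eqF)) (ltac:(by rewrite /= gt_eqF)) (ltac:(by rewrite /= gt_eqF)).
have := scales_Rintegral sc fi; rewrite gtr0_norm// => E.
have {}E : int3 (fun x => a (dil k e x) * gam e (k - dil k e x)) =
  e^-1 * e^-1 * e^-1 * int3 (fun k' => a k' * gam e (k - k')) := E.
have -> : int3 (fun k' => a k' * gam e (k - k')) = e ^+ 3 *
   int3 (fun x => a (dil k e x) * gam e (k - dil k e x)).
  by rewrite E; field; rewrite gt_eqF.
have sfi := scales_integrable sc fi.
rewrite -int3Z//; apply: int3_eq => u.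
rewrite mulrCA; congr (_ * _).
have -> : k - dil k e u = - ((e * u.1.1, e * u.1.2), e * u.2).
  by case: k {E fi sc sfi} => [[k1 k2] k3]; congr ((_, _), _); rewrite /=; ring.
by rewrite gamN /gam /Gam/= -!(lz_scale _ e0); ring.
Qed.
End weight.

(** * Plancherel for real trigonometric integrals *)

Section Plancherel.
Variable R : realType.
Notation lam := (@lebesgue_measure R).

Lemma leb3_0 : @leb3 R [set (0 : v3 R)] = 0%E.
Proof.
have -> : [set (0 : v3 R)] = [set (0 : T2 R)] `*` [set (0 : T1 R)].
  by apply/seteqP; split=> -[x y]/= [-> ->].
have m1 : measurable [set (0 : T1 R)] by exact: measurable_set1.
have -> : [set (0 : T2 R)] = [set (0 : T1 R)] `*` [set (0 : T1 R)].
  by apply/seteqP; split=> -[x y]/= [-> ->].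
have m2 : measurable ([set (0 : T1 R)] `*` [set (0 : T1 R)]) by exact: measurableX.
have := @product_measure1E _ _ _ _ R (@leb2 R) lam _ _ m2 m1.
have l0 : lam [set (0 : R)] = 0%E := lebesgue_measure_set1 0.
move=> E; exact: (etrans E (etrans (congr1 (fun z => (_ * z)%E) l0) (mule0 _))).
Qed.

Lemma ae_neq0 (P : v3 R -> Prop) : (forall x, x != 0 -> P x) ->
  {ae @leb3 R, forall x, P x}.
Proof.
move=> h; exists [set (0 : v3 R)]; split.
- have m1 : measurable [set (0 : T1 R)] by exact: measurable_set1.
  have -> : [set (0 : v3 R)] = [set (0 : T1 R)] `*` [set (0 : T1 R)] `*` [set (0 : T1 R)].
    by apply/seteqP; split=> -[[x y] z]/= [[]] => [-> -> ->|-> -> ->].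
  by apply: (@measurableX _ _ (T2 R) (T1 R)) => //; exact: measurableX.
- exact: leb3_0.
- move=> x /= nP; apply: contrapT => /eqP x0; apply: nP; exact: h.
Qed.

(** Convergence is demanded only off the origin, which is a null set, because the transverse
    coefficients may jump there. *)
Lemma int3_dct (f_ : nat -> v3 R -> R) (f g : v3 R -> R) :
  (forall n, m3 (f_ n)) -> m3 f -> i3 g ->
  (forall x, x != 0 -> f_ n x @[n --> \oo] --> f x) ->
  (forall n x, `|f_ n x| <= g x) ->
  int3 (f_ n) @[n --> \oo] --> int3 f.
Proof.
move=> mf_ mf gi ff fg.
have ff' x : x != 0 -> setT x -> (f_ n x)%:E @[n --> \oo] --> (f x)%:E.
  by move=> x0 _; apply: cvg_EFin; [exact: nearW|exact: ff].
have [fi _ h] := @dominated_convergence _ _ R (@leb3 R) setT measurableT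
  (fun n x => (f_ n x)%:E) (EFin \o f) (EFin \o g)
  (fun n => (proj2 (measurable_EFinP _ _) (mf_ n)))
  (proj2 (measurable_EFinP _ _) mf)
  (ae_neq0 ff') gi
  (ae_neq0 (fun x _ n _ => fg n x)).
have {}h : (\int[@leb3 R]_x (f_ n x)%:E)%E @[n --> \oo] --> (int3 f)%:E.
  by rewrite -(EFin_int3 fi).
exact: (fine_cvg h).
Qed.

Variables (a b h : v3 R -> R) (K : R).
Hypotheses (ma : m3 a) (mb : m3 b) (hi : i3 h).
Hypotheses (ah : forall k, `|a k| <= h k) (bh : forall k, `|b k| <= h k).
Hypothesis hK : forall k, h k <= K.
Hypotheses (aE : forall k, a (- k) = a k) (bO : forall k, b (- k) = - b k).
Hypotheses (ca : forall k, k != 0 -> {for k, continuous a})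
  (cb : forall k, k != 0 -> {for k, continuous b}).

Let ai : i3 a. Proof. exact: (i3_le ma hi ah). Qed.
Let bi : i3 b. Proof. exact: (i3_le mb hi bh). Qed.

(** With [a] even and [b] odd, [F] below is the Fourier integral of the Hermitian coefficient a - i
    b, hence real. The majorant [h] is integrable as well as bounded: integrability bounds [F], and
    the bound [K] dominates the averages of the coefficients. *)
Definition trig (x k : v3 R) : R := a k * cos (dot3 k x) + b k * sin (dot3 k x).
Notation F := (fun x => int3 (trig x)).

Let h0 k : 0 <= h k. Proof. exact: le_trans (ah k). Qed.

Let trig_le x k : `|trig x k| <= 2 * h k.
Proof.
apply: (le_trans (ler_normD _ _)); rewrite mulr_natl mulr2n lerD// normrM.
  by rewrite -[leRHS]mulr1 ler_pM// ?cos_max//.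
by rewrite -[leRHS]mulr1 ler_pM// ?sin_max//.
Qed.

Let m_dot : measurable_fun [set: (T3 R * T3 R)%type]
  (fun z : T3 R * T3 R => dot3 z.1 z.2 : T1 R).
Proof.
have m1 (f : v3 R -> R) : m3 f -> measurable_fun [set: (T3 R * T3 R)%type] (fun z : T3 R * T3 R => f z.1 : T1 R).
  by move=> mf; exact: (measurableT_comp mf measurable_fst).
have m2 (f : v3 R -> R) : m3 f -> measurable_fun [set: (T3 R * T3 R)%type] (fun z : T3 R * T3 R => f z.2 : T1 R).
  by move=> mf; exact: (measurableT_comp mf measurable_snd).
apply: measurable_funD; first apply: measurable_funD.
- by apply: measurable_funM; [exact: (m1 _ (@m3_1 R))|exact: (m2 _ (@m3_1 R))].
- by apply: measurable_funM; [exact: (m1 _ (@m3_2 R))|exact: (m2 _ (@m3_2 R))].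
- by apply: measurable_funM; [exact: (m1 _ (@m3_3 R))|exact: (m2 _ (@m3_3 R))].
Qed.

Let m_trig2 : measurable_fun [set: (T3 R * T3 R)%type]
  (fun z : T3 R * T3 R => trig z.2 z.1 : T1 R).
Proof.
apply: measurable_funD; apply: measurable_funM.
- exact: (measurableT_comp ma measurable_fst).
- by apply: (measurableT_comp (continuous_measurable_fun _)) m_dot; exact: continuous_cos.
- exact: (measurableT_comp mb measurable_fst).
- by apply: (measurableT_comp (continuous_measurable_fun _)) m_dot; exact: continuous_sin.
Qed.

Let m_trig_x k : m3 (fun x => trig x k).
Proof.
apply: measurable_funD; apply: measurable_funM => //.
- by apply: m3_cos; exact: m3_dot3.
- by apply: m3_sin; exact: m3_dot3.
Qed.

Let m_trig_k x : m3 (trig x).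
Proof.
have md : m3 (fun k => dot3 k x).
  by under eq_fun do rewrite dot3C; exact: m3_dot3.
by apply: measurable_funD; apply: measurable_funM => //; [exact: m3_cos|exact: m3_sin].
Qed.

Let trig_i x : i3 (trig x).
Proof. exact: (i3_le (m_trig_k x) (i3Z 2 hi) (trig_le x)). Qed.

Let gtrig_i (g : v3 R -> R) : i3 g ->
  (@leb3 R \x @leb3 R)%E.-integrable setT (EFin \o (fun z => g z.2 * trig z.2 z.1)).
Proof.
move=> gi.
apply: le_integrable (integrable_prodM (i3Z 2 hi) gi) => //.
  apply/measurable_EFinP; apply: measurable_funM m_trig2.
  exact: (measurableT_comp (i3_m3 gi) measurable_snd).
move=> z _ /=; rewrite lee_fin !normrM mulrC ler_wpM2r//.
by rewrite (le_trans (trig_le _ _))// -normrM ler_norm.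
Qed.

(** Integrability of the factor [g] is what justifies the exchange; [F] itself is only bounded. *)
Lemma swapF (g : v3 R -> R) : i3 g ->
  int3 (fun x => g x * F x) = int3 (fun k => int3 (fun x => g x * trig x k)).
Proof.
move=> gi.
have := RFubini (m1 := @leb3 R) (m2 := @leb3 R) (gtrig_i gi).
move=> /= E; rewrite [RHS]E; apply: int3_eq => x; symmetry.
exact: (int3Z (g x) (trig_i x)).
Qed.

Lemma swapF_m (g : v3 R -> R) : i3 g ->
  m3 (fun k => int3 (fun x => g x * trig x k)).
Proof. by move=> gi; exact: (measurable_Rintegral1 (m1 := @leb3 R) (m2 := @leb3 R) (gtrig_i gi)). Qed.

(** Fubini yields measurability for the integrand damped by [w3 1], which is integrable on the
    product; dividing by this positive weight recovers [F]. *)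
Lemma m3_F : m3 F.
Proof.
have := measurable_Rintegral2 (m1 := @leb3 R) (m2 := @leb3 R) (gtrig_i (i3_w3 (ltr01 : (0 < 1 :> R)))).
move=> /= m.
pose v := fun x : v3 R => (w3 1 x)^-1.
have -> : F = fun x => v x * int3 (fun k => w3 1 x * trig x k).
  apply/funext => x; rewrite int3Z// /v mulKf// gt_eqF//.
  by rewrite /w3 !mulr_gt0 ?expR_gt0.
apply: measurable_funM m.
have mv1 : measurable_fun [set: T1 R] (fun x : T1 R => expR `|x| : T1 R).
  apply: (measurableT_comp (continuous_measurable_fun _)) => //.
  exact: continuous_expR.
have -> : v = fun x => expR `|x.1.1| * expR `|x.1.2| * expR `|x.2|.
  by apply/funext => x; rewrite /v /w3 !mulN1r !expRN !invfM !invrK.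
apply: measurable_funM; first apply: measurable_funM.
- exact: (measurableT_comp mv1 (@m3_1 R)).
- exact: (measurableT_comp mv1 (@m3_2 R)).
- exact: (measurableT_comp mv1 (@m3_3 R)).
Qed.

Lemma F_le x : `|F x| <= int3 (fun k => 2 * h k).
Proof. by apply: norm_int3_le; [exact: trig_i|exact: i3Z|exact: trig_le]. Qed.

(** Product-to-sum formulas leave cosines and sines of [k - k'] and [k + k']; the sines integrate to
    0 against the even weight. *)
Lemma int3_trig2 e k k' : 0 < e ->
  int3 (fun x => w3 e x * trig x k * trig x k') =
  2^-1 * ((a k * a k' + b k * b k') * gam e (k - k') +
          (a k * a k' - b k * b k') * gam e (k + k')).
Proof.
move=> e0.
pose c (q : v3 R) x := w3 e x * cos (dot3 q x).
pose s (q : v3 R) x := w3 e x * sin (dot3 q x).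
have ci q : i3 (c q).
  by apply: i3_eq (i3_w_cos q 0 e0) => x; rewrite addr0.
have si q : i3 (s q).
  apply: (i3M_bounded (C := 1)); first exact: i3_w3.
    by apply: m3_sin; exact: m3_dot3.
  by move=> x; rewrite sin_max.
have cE q : int3 (c q) = gam e q.
  rewrite -[RHS]mul1r -[X in X * _]cos0 -int3_w_cos//.
  by apply: int3_eq => x; rewrite addr0.
have sE q : int3 (s q) = 0 by exact: int3_w_sin.
transitivity (int3 (fun x =>
   2^-1 * (a k * a k' + b k * b k') * c (k - k') x +
   2^-1 * (a k * a k' - b k * b k') * c (k + k') x +
   (2^-1 * (b k * a k' + a k * b k') * s (k + k') x +
   2^-1 * (b k * a k' - a k * b k') * s (k - k') x))).
  apply: int3_eq => x; rewrite /c /s /trig.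
  have D : dot3 (k + k') x = dot3 k x + dot3 k' x by rewrite /dot3/=; ring.
  have D' : dot3 (k - k') x = dot3 k x - dot3 k' x by rewrite /dot3/=; ring.
  by rewrite D D' cosB sinB cosD sinD; field.
rewrite !int3D ?int3Z//; try by do ?[apply: i3D|apply: i3Z].
by rewrite !cE !sE; ring.
Qed.

Let aver (f : v3 R -> R) e k := int3 (fun u => f (dil k e u) * Gam u).

(** After the rescaling the kernel is fixed and only the sample point moves, towards [k]; the
    majorant is [K] times the kernel. *)
Lemma aver_cvg (f : v3 R -> R) k : m3 f -> (forall k, `|f k| <= h k) ->
  {for k, continuous f} ->
  aver f n.+1%:R^-1 k @[n --> \oo] --> (2 * pi) ^+ 3 * f k.
Proof.
move=> mf fh cf.
have -> : (2 * pi) ^+ 3 * f k = int3 (fun u => f k * Gam u).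
  by rewrite int3Z; [rewrite int3_Gam mulrC|exact: i3_Gam].
apply: (@int3_dct _ _ (fun u => K * Gam u)).
- move=> n; apply: measurable_funM; first by apply: m3_dil.
  exact: (i3_m3 (@i3_Gam R)).
- by apply: measurable_funM => //; exact: (i3_m3 (@i3_Gam R)).
- by apply: i3Z; exact: i3_Gam.
- move=> u _; apply: cvgMl.
  apply: (cvg_comp (fun n => dil k n.+1%:R^-1 u) f _ cf).
  have hn (x y : R) : x + n.+1%:R^-1 * y @[n --> \oo] --> x.
    rewrite -[X in _ --> X]addr0; apply: cvgD; first exact: cvg_cst.
    rewrite -[X in _ --> X](mul0r y); apply: cvgMl; exact: cvg_harmonic.
  case: (k) => [[k1 k2] k3]; apply: (@cvg_pair _ _ _ _ (nbhs (k1, k2)) (nbhs k3)).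
    exact: (@cvg_pair _ _ _ _ (nbhs k1) (nbhs k2)).
  exact: hn.
- move=> n u; rewrite normrM (ger0_norm (Gam_ge0 _)) ler_wpM2r ?Gam_ge0//.
  exact: le_trans (fh _) (hK _).
Qed.

Lemma aver_le (f : v3 R -> R) e k : 0 < e -> m3 f -> (forall k, `|f k| <= h k) ->
  `|aver f e k| <= K * (2 * pi) ^+ 3.
Proof.
move=> e0 mf fh.
have fK x : `|f x| <= K by exact: le_trans (fh _) (hK _).
rewrite -int3_Gam -int3Z; last exact: i3_Gam.
have b1 u : `|f (dil k e u) * Gam u| <= K * Gam u.
  by rewrite normrM (ger0_norm (Gam_ge0 _)) ler_wpM2r ?Gam_ge0.
have Gi := i3Z K (@i3_Gam R).
apply: norm_int3_le => //; apply: (i3_le _ Gi) => //.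
apply: measurable_funM; first by apply: m3_dil.
exact: (i3_m3 (@i3_Gam R)).
Qed.

Lemma weighted_trig e k : 0 < e ->
  int3 (fun x => w3 e x * F x * trig x k) =
  2^-1 * (a k * (aver a e k + aver a e (- k)) + b k * (aver b e k - aver b e (- k))).
Proof.
move=> e0.
have gi : i3 (fun x => w3 e x * trig x k).
  apply: (i3M_bounded (C := 2 * h k)) => //; exact: i3_w3.
transitivity (int3 (fun x => w3 e x * trig x k * F x)).
  by apply: int3_eq => x; rewrite mulrAC.
rewrite swapF//.
transitivity (int3 (fun k' => 2^-1 * a k * (a k' * gam e (k - k')) +
    2^-1 * b k * (b k' * gam e (k - k')) +
   (2^-1 * a k * (a k' * gam e (- k - k')) - 2^-1 * b k * (b k' * gam e (- k - k'))))).
  apply: int3_eq => k'; rewrite int3_trig2//.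
  (* Since [gam] is even, the second term is an average as well, centred at [- k]. *)
  have -> : gam e (k + k') = gam e (- k - k') by rewrite -gamN opprD.
  by ring.
have ag q := i3_gam q e0 ai; have bg q := i3_gam q e0 bi.
rewrite int3D; last 2 first.
- by apply: i3D; exact: i3Z.
- by apply: i3B; exact: i3Z.
rewrite int3D ?int3B ?int3Z//; try exact: i3Z.
by rewrite !int3_gam// /aver; ring.
Qed.

Lemma i3_coef_sq : i3 (fun k => a k ^+ 2 + b k ^+ 2).
Proof.
have sqi (f : v3 R -> R) : m3 f -> (forall k, `|f k| <= h k) -> i3 (fun k => f k ^+ 2).
  move=> mf fh; apply: (i3_le (g := fun k => K * h k)).
  - by under eq_fun do rewrite expr2; exact: measurable_funM.
  - exact: i3Z.
  - move=> k; rewrite normrX expr2; apply: ler_pM => //.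
    exact: le_trans (fh k) (hK k).
by apply: i3D; exact: sqi.
Qed.

(** One factor [F] is expanded and the integrals are exchanged, which tests the other factor against
    [trig] at [k]; there the Poisson kernels act as an approximate identity. A multiple of [h]
    dominates the outer limit. *)
Lemma weighted_energy_cvg :
  int3 (fun x => w3 n.+1%:R^-1 x * F x ^+ 2) @[n --> \oo] -->
  (2 * pi) ^+ 3 * int3 (fun k => a k ^+ 2 + b k ^+ 2).
Proof.
have e0 n : 0 < n.+1%:R^-1 :> R by rewrite invr_gt0.
set C := int3 (fun k => 2 * h k).
have wFi e : 0 < e -> i3 (fun x => w3 e x * F x).
  move=> ep; apply: (i3M_bounded (C := C)); [exact: i3_w3|exact: m3_F|exact: F_le].
have -> : (fun n => int3 (fun x => w3 n.+1%:R^-1 x * F x ^+ 2)) =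
   fun n => int3 (fun k => int3 (fun x => w3 n.+1%:R^-1 x * F x * trig x k)).
  by apply/funext => n; rewrite -swapF ?wFi//; apply: int3_eq => x; rewrite expr2 mulrA.
have abi := i3_coef_sq.
rewrite -int3Z//.
apply: (@int3_dct _ _ (fun k => 2 * (K * (2 * pi) ^+ 3) * h k)).
- by move=> n; apply: swapF_m; exact: wFi.
- by apply: i3_m3; exact: i3Z.
- exact: i3Z.
- move=> k k0.
  have nk0 : - k != 0 by rewrite oppr_eq0.
  under eq_fun do rewrite weighted_trig//.
  (* By parity the averages at [- k] reinforce those at [k], which compensates the factor 1/2 of the
     product-to-sum formulas. *)
  have -> : (2 * pi) ^+ 3 * (a k ^+ 2 + b k ^+ 2) =
    2^-1 * (a k * ((2 * pi) ^+ 3 * a k + (2 * pi) ^+ 3 * a (- k)) +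
            b k * ((2 * pi) ^+ 3 * b k - (2 * pi) ^+ 3 * b (- k))).
    by rewrite aE bO; field.
  apply: cvgMr; apply: cvgD; apply: cvgMr.
    by apply: cvgD; apply: aver_cvg => //; exact: ca.
  by apply: cvgB; apply: aver_cvg => //; exact: cb.
- move=> n k; rewrite weighted_trig// normrM ger0_norm ?invr_ge0//.
  set D := K * _.
  have hA f q : m3 f -> (forall k, `|f k| <= h k) -> `|aver f n.+1%:R^-1 q| <= D.
    by move=> mf fh; exact: aver_le.
  have D0 : 0 <= D by exact: le_trans (normr_ge0 _) (hA a k ma ah).
  have -> : 2 * D * h k = 2^-1 * (h k * (D + D) + h k * (D + D)) by field.
  apply: ler_wpM2l; first by rewrite invr_ge0.
  apply: (le_trans (ler_normD _ _)); rewrite !normrM; apply: lerD.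
    apply: ler_pM => //; apply: (le_trans (ler_normD _ _)); apply: lerD; exact: hA.
  apply: ler_pM => //; apply: (le_trans (ler_normB _ _)); apply: lerD; exact: hA.
Qed.

(** As the height tends to 0 the weights increase to 1, so monotone convergence removes them and
    gives square integrability together with the value of the integral. *)
Theorem plancherel_trig : [/\ i3 (fun k => a k ^+ 2 + b k ^+ 2),
  i3 (fun x => F x ^+ 2) &
  int3 (fun x => F x ^+ 2) = (2 * pi) ^+ 3 * int3 (fun k => a k ^+ 2 + b k ^+ 2)].
Proof.
have e0 n : 0 < n.+1%:R^-1 :> R by rewrite invr_gt0.
have mF2 : m3 (fun x => F x ^+ 2).
  by under eq_fun do rewrite expr2; apply: measurable_funM; exact: m3_F.
set C := int3 (fun k => 2 * h k).
have gi n : i3 (fun x => w3 n.+1%:R^-1 x * F x ^+ 2).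
  apply: (i3M_bounded (C := C ^+ 2)) => //; first exact: i3_w3.
  move=> x; rewrite normrX !expr2; have := F_le x => Fx.
  exact: ler_pM.
pose g n x := (w3 n.+1%:R^-1 x * F x ^+ 2)%:E.
have mg n : measurable_fun [set: T3 R] (g n : T3 R -> \bar R).
  by apply/measurable_EFinP; exact: i3_m3.
have g0 n x : (0 <= g n x)%E by rewrite lee_fin mulr_ge0 ?w3_ge0// sqr_ge0.
have wnd (y : R) m n : (m <= n)%N ->
    expR (- m.+1%:R^-1 * `|y|) <= expR (- n.+1%:R^-1 * `|y|).
  by move=> mn; rewrite ler_expR ler_wpM2r// lerN2 lef_pV2 ?posrE// ler_nat.
have gnd (x : v3 R) : setT x -> nondecreasing_seq (g ^~ x).
  move=> _ m n mn; rewrite lee_fin; apply: ler_wpM2r; first exact: sqr_ge0.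
  rewrite /w3; apply: ler_pM; rewrite ?mulr_ge0 ?expR_ge0//; last exact: wnd.
  by apply: ler_pM; rewrite ?expR_ge0//; exact: wnd.
have glim (x : v3 R) : g n x @[n --> \oo] --> (F x ^+ 2)%:E.
  apply: cvg_EFin; first exact: nearW.
  rewrite -[X in _ --> X]mul1r; apply: cvgMl.
  have h1 (y : R) : expR (- n.+1%:R^-1 * y) @[n --> \oo] --> (1 : R).
    have h2 : - n.+1%:R^-1 * y @[n --> \oo] --> (0 : R).
      rewrite -[X in _ --> X](mul0r y) -oppr0; apply: cvgMl; apply: cvgN.
      exact: cvg_harmonic.
    by have := cvg_comp _ _ h2 (@continuous_expR R 0); rewrite expR0.
  have : w3 n.+1%:R^-1 x @[n --> \oo] --> (1 * 1 * 1 : R).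
    by apply: cvgM; [apply: cvgM|]; exact: h1.
  by rewrite !mulr1.
have /= mct := @cvg_monotone_convergence _ _ R (@leb3 R) setT measurableT g mg
  (fun n x _ => g0 n x) gnd.
have limE : (\int[@leb3 R]_x limn (g ^~ x) = \int[@leb3 R]_x (F x ^+ 2)%:E)%E.
  by apply: eq_integral => x _; exact: (cvg_lim _ (glim x)).
rewrite limE in mct.
have E : (\int[@leb3 R]_x (F x ^+ 2)%:E =
   ((2 * pi) ^+ 3 * int3 (fun k => a k ^+ 2 + b k ^+ 2))%:E)%E.
  rewrite -(cvg_lim _ mct)//; apply: cvg_lim => //.
  have -> : (fun n => \int[@leb3 R]_x g n x)%E =
      (fun n => (int3 (fun x => w3 n.+1%:R^-1 x * F x ^+ 2))%:E).
    by apply/funext => n; rewrite -EFin_int3.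
  by apply: cvg_EFin; [exact: nearW|exact: weighted_energy_cvg].
split; [exact: i3_coef_sq| |by rewrite [LHS](congr1 fine E)].
apply/integrableP; split; first exact/measurable_EFinP.
under eq_integral do rewrite /= ger0_norm ?sqr_ge0//.
by rewrite E ltry.
Qed.

End Plancherel.

(** * Cosine and sine transforms: continuity and derivatives *)

Section cosine_transform.
Variable R : realType.
Implicit Types (b g : v3 R -> R) (x y k : v3 R).

Definition N1 k : R := `|k.1.1| + `|k.1.2| + `|k.2|.
(** The integrable [g] dominates [b] with all its moments up to order [n]. A derivative of the
    transform multiplies the coefficient by a coordinate and uses up one moment. *)
Definition decay (n : nat) b g := [/\ m3 b, i3 g &
  forall k, `|b k| * (1 + N1 k) ^+ n <= g k].
Definition ct b x := int3 (fun k => b k * cos (dot3 k x)).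
Definition st b x := int3 (fun k => b k * sin (dot3 k x)).

Lemma N1_ge0 k : 0 <= N1 k. Proof. by rewrite !addr_ge0. Qed.

Lemma decay_le n b g k : decay n b g -> `|b k| <= g k.
Proof.
move=> [_ _ h]; apply: le_trans (h k); rewrite ler_peMr// exprn_ege1//.
by rewrite lerDl N1_ge0.
Qed.

Lemma decay_i3 n b g : decay n b g -> i3 b.
Proof. by move=> h; case: (h) => mb gi _; apply: (i3_le mb gi) => k; exact: decay_le h. Qed.

Lemma decay_weak n b g : decay n.+1 b g -> decay n b g.
Proof.
move=> [mb gi h]; split=> // k; apply: le_trans (h k); apply: ler_wpM2l => //.
by rewrite exprS ler_peMl// ?exprn_ge0 ?addr_ge0 ?N1_ge0// lerDl N1_ge0.
Qed.

Lemma m3_coord j : m3 (fun k => Defs.coord k j).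
Proof.
by case: j => [[|[|[|//]]] ?]; [exact: m3_1|exact: m3_2|exact: m3_3].
Qed.

Lemma coord_le j k : `|Defs.coord k j| <= N1 k.
Proof.
rewrite /N1; case: j => [[|[|[|//]]] ?]; rewrite /Defs.coord/=.
- by rewrite -addrA lerDl addr_ge0.
- by rewrite [leRHS]addrAC addrC lerDl addr_ge0 ?addr_ge0.
- by rewrite lerDr addr_ge0.
Qed.

Lemma decay_coord n b g j : decay n.+1 b g -> decay n (fun k => Defs.coord k j * b k) g.
Proof.
move=> [mb gi h]; split=> //.
  by apply: measurable_funM => //; exact: m3_coord.
move=> k; apply: le_trans (h k); rewrite normrM mulrAC mulrC exprS.
apply: ler_wpM2l => //; apply: ler_wpM2r; first by rewrite exprn_ge0// addr_ge0// N1_ge0.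
by rewrite (le_trans (coord_le j k))// lerDr.
Qed.

Lemma m3_dot3r x : m3 (fun k => dot3 k x).
Proof. by under eq_fun do rewrite dot3C; exact: m3_dot3. Qed.

Lemma decay_ct n b g x : decay n b g -> i3 (fun k => b k * cos (dot3 k x)).
Proof.
move=> h; apply: (i3M_bounded (C := 1)); first exact: decay_i3 h.
  by apply: m3_cos; exact: m3_dot3r.
by move=> k; exact: cos_max.
Qed.

Lemma decay_st n b g x : decay n b g -> i3 (fun k => b k * sin (dot3 k x)).
Proof.
move=> h; apply: (i3M_bounded (C := 1)); first exact: decay_i3 h.
  by apply: m3_sin; exact: m3_dot3r.
by move=> k; exact: sin_max.
Qed.

Lemma cos_lip (s t : R) : `|cos s - cos t| <= `|s - t|.
Proof.
wlog st : s t / s <= t => [H|].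
  by have [st|/ltW ts] := leP s t; [exact: H|rewrite distrC (distrC s); exact: H].
have cc : {within `[s, t], continuous (@cos R)}.
  by apply: continuous_subspaceT => z; exact: continuous_cos.
have [c _ E] := MVT_segment st (fun z _ => is_derive_cos z) cc.
rewrite distrC E (distrC s) normrM ler_piMl// normrN; exact: sin_max.
Qed.

Lemma sin_lip (s t : R) : `|sin s - sin t| <= `|s - t|.
Proof.
have sE (z : R) : sin z = cos (z - pi / 2).
  by rewrite cosB cos_pihalf sin_pihalf mulr0 mulr1 add0r.
have -> : s - t = (s - pi / 2) - (t - pi / 2) by ring.
by rewrite !sE; exact: cos_lip.
Qed.

Lemma dot3_lip k x y : `|dot3 k x - dot3 k y| <= N1 k * `|x - y|.
Proof.
have -> : dot3 k x - dot3 k y = k.1.1 * (x - y).1.1 + k.1.2 * (x - y).1.2 + k.2 * (x - y).2.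
  by rewrite /dot3/=; ring.
have n1 (z : v3 R) : `|z.1.1| <= `|z|.
  by rewrite /Num.norm/= le_max; apply/orP; left; rewrite /Num.norm/= le_max lexx.
have n2 (z : v3 R) : `|z.1.2| <= `|z|.
  by rewrite /Num.norm/= le_max; apply/orP; left; rewrite /Num.norm/= le_max lexx orbT.
have n3 (z : v3 R) : `|z.2| <= `|z| by rewrite /Num.norm/= le_max lexx orbT.
rewrite /N1 !mulrDl (le_trans (ler_normD _ _))// lerD//.
  by rewrite (le_trans (ler_normD _ _))// lerD// normrM ler_wpM2l.
by rewrite normrM ler_wpM2l.
Qed.

Lemma lipschitz_continuous_v3 (F : v3 R -> R) (C : R) :
  (forall x y, `|F x - F y| <= C * `|x - y|) -> continuous F.
Proof.
move=> FC x; apply/cvgrPdist_lt => e e0.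
have C0 : 0 < `|C| + 1 by rewrite ltr_wpDl.
have d0 : 0 < e / (`|C| + 1) by rewrite divr_gt0.
near=> y.
have xy : `|x - y| < e / (`|C| + 1).
  by near: y; apply: cvgr_dist_lt => //; exact: cvg_id.
apply: (le_lt_trans (FC x y)); rewrite ltr_pdivlMr// mulrC in xy.
apply: le_lt_trans xy; apply: ler_wpM2r => //.
by rewrite (le_trans (ler_norm _))// lerDl.
Unshelve. all: by end_near. Qed.

(** The transform is Lipschitz with the integral of [g] as constant: the first moment pays for the
    Lipschitz bound of the phase k.x. *)
Lemma ct_continuous b g : decay 1 b g -> continuous (ct b).
Proof.
move=> h; case: (h) => mb gi hg; apply: (lipschitz_continuous_v3 (C := int3 g)) => x y.
rewrite /ct -int3B; try exact: decay_ct h.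
rewrite mulrC -int3Z//; apply: norm_int3_le => //.
- by apply: i3B; exact: decay_ct h.
- exact: i3Z.
move=> k; rewrite -mulrBr normrM.
apply: (le_trans (ler_wpM2l _ (le_trans (cos_lip _ _) (dot3_lip _ _ _)))) => //.
rewrite mulrA mulrC; apply: ler_wpM2l => //; apply: le_trans (hg k).
by rewrite expr1 ler_wpM2l// lerDr.
Qed.

Lemma st_continuous b g : decay 1 b g -> continuous (st b).
Proof.
move=> h; case: (h) => mb gi hg; apply: (lipschitz_continuous_v3 (C := int3 g)) => x y.
rewrite /st -int3B; try exact: decay_st h.
rewrite mulrC -int3Z//; apply: norm_int3_le => //.
- by apply: i3B; exact: decay_st h.
- exact: i3Z.
move=> k; rewrite -mulrBr normrM.
apply: (le_trans (ler_wpM2l _ (le_trans (sin_lip _ _) (dot3_lip _ _ _)))) => //.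
rewrite mulrA mulrC; apply: ler_wpM2l => //; apply: le_trans (hg k).
by rewrite expr1 ler_wpM2l// lerDr.
Qed.

Lemma dot3_e3 k j : dot3 k (e3 j) = Defs.coord k j.
Proof.
by case: j => [[|[|[|//]]] ?]; rewrite /dot3 /Defs.coord /e3/= ?mulr0 ?mulr1 ?addr0 ?add0r.
Qed.

(** Differentiation under the integral sign along the line x + t e_j. The derivative in t is bounded
    by [g] for every t, so any interval around 0 serves. *)
Lemma is_derive_ct b g j x : decay 1 b g ->
  is_derive x (e3 j) (ct b) (- st (fun k => Defs.coord k j * b k) x).
Proof.
move=> h; case: (h) => mb gi hg.
pose f (t : R) (k : T3 R) : R := b k * cos (dot3 k (t *: e3 j + x)).
have fE t k : f t k = b k * cos (t * Defs.coord k j + dot3 k x).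
  by rewrite /f -dot3_e3 /dot3/=; congr (_ * cos _); rewrite /GRing.scale/=; ring.
have df (t : R) k : is_derive t 1 (f ^~ k) (- (Defs.coord k j * b k * sin (t * Defs.coord k j + dot3 k x))).
  have -> : f ^~ k = fun t => b k * cos (t * Defs.coord k j + dot3 k x).
    by apply/funext => s; exact: fE.
  apply: is_derive_eq; rewrite /GRing.scale/= ?mulr1 ?mulr0 ?addr0 ?add0r; ring.
have d1 (t : R) k : partial1of2 f t k = - (Defs.coord k j * b k * sin (t * Defs.coord k j + dot3 k x)).
  by rewrite partial1of2E; exact: derive_val.
have G_ub (t : R) (k : T3 R) : `] - 1, 1[%classic t -> setT k -> `|partial1of2 f t k| <= g k.
  move=> _ _; rewrite d1 normrN normrM normrM.
  apply: (le_trans (ler_wpM2l _ (sin_max _))); first by rewrite mulr_ge0.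
  rewrite mulr1; apply: le_trans (hg k); rewrite mulrC ler_wpM2l//.
  by rewrite expr1 (le_trans (coord_le _ _))// lerDr.
have := @cvg_differentiation_under_integral R _ (T3 R) (@leb3 R) f setT measurableT
   0 (- 1) 1 (ltac:(by rewrite /= in_itv/= ltrN10 ltr01))
   (fun t _ => decay_ct _ h) (fun t k _ _ => @ex_derive _ _ _ _ _ _ _ (df t k)) g
   (fun k => le_trans (normr_ge0 _) (decay_le k h)) gi G_ub.
have -> : \int[@leb3 R]_y partial1of2 f 0 y = - st (fun k => Defs.coord k j * b k) x.
  rewrite /st -mulN1r -int3Z; last exact: (decay_st _ (decay_coord j h)).
  by apply: eq_Rintegral => k _; rewrite d1 mul0r add0r mulN1r.
move=> H.
have {}H : h^-1 *: (ct b (h *: e3 j + x) - ct b x) @[h --> 0^'] --> - st (fun k => Defs.coord k j * b k) x.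
  move: H; apply: cvg_trans; apply: near_eq_cvg; near=> t.
  rewrite /ct /int3 addr0; congr (_ *: (_ - _)); apply: eq_Rintegral => k _.
  by rewrite fE mul0r add0r.
apply: DeriveDef; first by apply/cvg_ex; eexists; exact: H.
exact: (cvg_lim _ H).
Unshelve. all: by end_near. Qed.

Lemma is_derive_shift (F : v3 R -> R) (c v x : v3 R) (l : R) :
  is_derive (x - c) v F l -> is_derive x v (fun y => F (y - c)) l.
Proof.
move=> [dF lF].
have E : (fun h : R => h^-1 *: (((fun y => F (y - c)) \o shift x) (h *: v) - F (x - c))) =
  (fun h => h^-1 *: ((F \o shift (x - c)) (h *: v) - F (x - c))).
  by apply/funext => h /=; rewrite addrA.
by apply: DeriveDef; rewrite /derivable /derive E.
Qed.
End cosine_transform.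

(** * The divergence theorem on a box *)

Section box.
Variable R : realType.
Notation lam := (@lebesgue_measure R).
Implicit Types (F G : v3 R -> R).

Definition ind1 (N x : R) : R := ((`|x| <= N)%R : bool)%:R.
Definition ind3 (N : R) (x : v3 R) : R := ind1 N x.1.1 * ind1 N x.1.2 * ind1 N x.2.

Lemma ind1E N : ind1 N = \1_`[- N, N] :> (R -> R).
Proof. apply/funext => x; rewrite indicE /ind1 ler_norml.
by congr (nat_of_bool _)%:R; apply/idP/idP; rewrite inE/= in_itv/=. Qed.

Lemma integrable_ind1 N : lam.-integrable setT (EFin \o ind1 N).
Proof. by rewrite ind1E; exact: integrable_indic_itv. Qed.

Lemma i3_ind3 N : i3 (ind3 N).
Proof. exact: (i3_prod (integrable_ind1 N) (integrable_ind1 N) (integrable_ind1 N)). Qed.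

Lemma ind3_ge0 N x : 0 <= ind3 N x. Proof. by rewrite !mulr_ge0 ?ler0n. Qed.

Lemma ind3_P N x : ind3 N x = 0 \/
  [/\ ind3 N x = 1, `|x.1.1| <= N, `|x.1.2| <= N & `|x.2| <= N].
Proof.
rewrite /ind3 /ind1; case: (`|x.1.1| <= N); last by left; rewrite !mul0r.
case: (`|x.1.2| <= N); last by left; rewrite mulr0 mul0r.
case: (`|x.2| <= N); last by left; rewrite mulr0.
by right; rewrite !mulr1.
Qed.

Lemma i3_box N G : 0 < N -> continuous G -> i3 (fun x => ind3 N x * G x).
Proof.
move=> N0 cG.
pose Q : set (v3 R) := `[- N, N] `*` `[- N, N] `*` `[- N, N].
have cQ : compact Q.
  by apply: compact_setX; [apply: compact_setX|]; exact: segment_compact.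
have Q0 : Q !=set0.
  by exists 0; split=> /=; [split=> /=|]; rewrite in_itv/= lerNl oppr0 ltW.
have cnG : {within Q, continuous (fun x => `|G x|)}.
  by apply: continuous_subspaceT => x; apply: cvg_norm; exact: cG.
have [c _ cmax] := compact_EVT_max Q0 cQ cnG.
apply: (i3_le (g := fun x => `|G c| * ind3 N x)).
- by apply: measurable_funM; [exact: i3_m3 (i3_ind3 N)|exact: continuous_measurable_v3].
- by apply: i3Z; exact: i3_ind3.
- move=> x; rewrite normrM (ger0_norm (ind3_ge0 _ _)) mulrC.
  have [->|[-> h1 h2 h3]] := ind3_P N x; first by rewrite !mulr0.
  rewrite !mulr1; apply: cmax; rewrite inE.
  by split=> /=; [split=> /=|]; rewrite in_itv/= -ler_norml.
Qed.

(** The last coordinate is the inner one in [int3_iter], so the fundamental theorem applies on each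
    line in that direction and only the two faces orthogonal to it matter. The other two directions
    are reduced to this one by exchanging coordinates. *)
Lemma box_divergence3 (N : R) F G : 0 < N -> continuous G ->
  (forall x y z : R, is_derive z 1 (fun t : R => F ((x, y), t)) (G ((x, y), z))) ->
  (forall x y, F ((x, y), N) = 0) -> (forall x y, F ((x, y), - N) = 0) ->
  int3 (fun x => ind3 N x * G x) = 0.
Proof.
move=> N0 cG dF FN FnN; rewrite int3_iter; last exact: i3_box.
rewrite -[RHS](mul0r (fine (@leb2 R setT))) -Rintegral_cst//.
apply: eq_Rintegral => -[x y] _.
have cg : continuous (fun z : R => G ((x, y), z)).
  move=> z; apply: (cvg_comp (fun z : R => ((x, y), z)) G _ (cG _)).
  by apply: (@cvg_pair _ _ _ _ (nbhs (x, y)) (nbhs z)); [exact: cvg_cst|exact: cvg_id].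
have Ei : (\int[lam]_(z in `[(- N)%R, N]) (G ((x, y), z))%:E = 0)%E.
  rewrite (@continuous_FTC2 _ _ (fun t => F ((x, y), t)))//.
  - by rewrite FN FnN -EFinB subrr.
  - by rewrite gtrN.
  - exact: (continuous_subspaceT cg).
  - have cF : continuous (fun t : R => F ((x, y), t)).
      by move=> z; apply/differentiable_continuous/derivable1_diffP; case: (dF x y z).
    split.
    + by move=> z _; case: (dF x y z).
    + by apply: cvg_at_right_filter; exact: cF.
    + by apply: cvg_at_left_filter; exact: cF.
  - by move=> z _; rewrite derive1E; case: (dF x y z).
pose g : T1 R -> R := (fun z : R => G ((x, y), z)) \_ `[- N, N].
transitivity (\int[lam]_z (ind1 N x * ind1 N y * g z)).
  apply: eq_Rintegral => z _; rewrite /ind3/= -mulrA; congr (_ * _).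
  rewrite /g patchE ind1E indicE.
  by case: ifP => _; rewrite ?mul1r ?mul0r.
have Ez : \int[lam]_z g z = 0 by rewrite /g -Rintegral_mkcond /Rintegral Ei.
have gi : lam.-integrable setT (EFin \o g).
  have h := @continuous_compact_integrable R (fun z => G ((x, y), z)) `[- N, N]%classic
    (@segment_compact _ _ _) (continuous_subspaceT cg).
  have := proj1 (integrable_mkcond (mu := lam) _ (measurable_itv _)) h.
  by apply: eq_integrable => // z _; rewrite /g restrict_EFin.
by rewrite RintegralZl// Ez mulr0.
Qed.

Lemma int3_swap01 (f : v3 R -> R) : i3 f ->
  int3 (fun x => f ((x.1.2, x.1.1), x.2)) = int3 f.
Proof. by move=> fi; rewrite -[RHS]mul1r; exact: (scales_Rintegral (scales_swap01 R) fi). Qed.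

Lemma int3_swap12 (f : v3 R -> R) : i3 f ->
  int3 (fun x => f ((x.1.1, x.2), x.1.2)) = int3 f.
Proof. by move=> fi; rewrite -[RHS]mul1r; exact: (scales_Rintegral (scales_swap12 R) fi). Qed.

Lemma continuous_swap12 : continuous (fun x : v3 R => ((x.1.1, x.2), x.1.2)).
Proof.
move=> -[[x y] z]; apply: (@cvg_pair _ _ _ _ (nbhs (x, z)) (nbhs y)).
  apply: (@cvg_pair _ _ _ _ (nbhs x) (nbhs z)); last exact: cvg_snd.
  by apply: cvg_comp; [exact: cvg_fst|exact: cvg_fst].
by apply: cvg_comp; [exact: cvg_fst|exact: cvg_snd].
Qed.

Lemma continuous_swap01 : continuous (fun x : v3 R => ((x.1.2, x.1.1), x.2)).
Proof.
move=> -[[x y] z]; apply: (@cvg_pair _ _ _ _ (nbhs (y, x)) (nbhs z)); last exact: cvg_snd.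
apply: (@cvg_pair _ _ _ _ (nbhs y) (nbhs x)).
  by apply: cvg_comp; [exact: cvg_fst|exact: cvg_snd].
by apply: cvg_comp; [exact: cvg_fst|exact: cvg_fst].
Qed.

Lemma box_divergence2 (N : R) F G : 0 < N -> continuous G ->
  (forall x y z : R, is_derive y 1 (fun t : R => F ((x, t), z)) (G ((x, y), z))) ->
  (forall x z, F ((x, N), z) = 0) -> (forall x z, F ((x, - N), z) = 0) ->
  int3 (fun x => ind3 N x * G x) = 0.
Proof.
move=> N0 cG dF FN FnN; rewrite -int3_swap12; last exact: i3_box.
pose s (x : v3 R) : v3 R := ((x.1.1, x.2), x.1.2).
transitivity (int3 (fun x => ind3 N x * (G \o s) x)).
  by apply: int3_eq => x; congr (_ * _); rewrite /ind3/= mulrAC.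
apply: (@box_divergence3 N (F \o s) (G \o s) N0) => //; last by move=> x y z; exact: dF.
by move=> x; apply: cvg_comp; [exact: continuous_swap12|exact: cG].
Qed.

Lemma box_divergence1 (N : R) F G : 0 < N -> continuous G ->
  (forall x y z : R, is_derive x 1 (fun t : R => F ((t, y), z)) (G ((x, y), z))) ->
  (forall y z, F ((N, y), z) = 0) -> (forall y z, F ((- N, y), z) = 0) ->
  int3 (fun x => ind3 N x * G x) = 0.
Proof.
move=> N0 cG dF FN FnN; rewrite -int3_swap01; last exact: i3_box.
pose s (x : v3 R) : v3 R := ((x.1.2, x.1.1), x.2).
transitivity (int3 (fun x => ind3 N x * (G \o s) x)).
  by apply: int3_eq => x; congr (_ * _); rewrite /ind3/= (mulrC (ind1 N x.1.2)).
apply: (@box_divergence2 N (F \o s) (G \o s) N0) => //; last by move=> x y z; exact: dF.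
by move=> x; apply: cvg_comp; [exact: continuous_swap01|exact: cG].
Qed.
End box.

(** * The virial identity for square-integrable fields without divergence and curl *)

Section virial.
Variable R : realType.
Implicit Types x : v3 R.

Lemma is_derive_slice0 (F : v3 R -> R) (p q r l : R) :
  is_derive (((p, q), r) : v3 R) (e3 0) F l -> is_derive p 1 (fun t : R => F ((t, q), r)) l.
Proof.
move=> [dF lF].
have E : (fun h : R => h^-1 *: (((fun t : R => F ((t, q), r)) \o shift p) (h *: 1) - F ((p, q), r))) =
  (fun h => h^-1 *: ((F \o shift ((p, q), r)) (h *: e3 0) - F ((p, q), r))).
  apply/funext => h /=; congr (_ *: (F _ - _)).
  transitivity (((h * 1 + p, h * 0 + q), h * 0 + r) : v3 R) => //.
  by rewrite [h%:A]mulr1 !mulr0 !mulr1 !add0r.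
by apply: DeriveDef; rewrite /derivable /derive E.
Qed.

Lemma is_derive_slice1 (F : v3 R -> R) (p q r l : R) :
  is_derive (((p, q), r) : v3 R) (e3 1) F l -> is_derive q 1 (fun t : R => F ((p, t), r)) l.
Proof.
move=> [dF lF].
have E : (fun h : R => h^-1 *: (((fun t : R => F ((p, t), r)) \o shift q) (h *: 1) - F ((p, q), r))) =
  (fun h => h^-1 *: ((F \o shift ((p, q), r)) (h *: e3 1) - F ((p, q), r))).
  apply/funext => h /=; congr (_ *: (F _ - _)).
  transitivity (((h * 0 + p, h * 1 + q), h * 0 + r) : v3 R) => //.
  by rewrite [h%:A]mulr1 !mulr0 !mulr1 !add0r.
by apply: DeriveDef; rewrite /derivable /derive E.
Qed.

Lemma is_derive_slice2 (F : v3 R -> R) (p q r l : R) :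
  is_derive (((p, q), r) : v3 R) (e3 2) F l -> is_derive r 1 (fun t : R => F ((p, q), t)) l.
Proof.
move=> [dF lF].
have E : (fun h : R => h^-1 *: (((fun t : R => F ((p, q), t)) \o shift r) (h *: 1) - F ((p, q), r))) =
  (fun h => h^-1 *: ((F \o shift ((p, q), r)) (h *: e3 2) - F ((p, q), r))).
  apply/funext => h /=; congr (_ *: (F _ - _)).
  transitivity (((h * 0 + p, h * 0 + q), h * 1 + r) : v3 R) => //.
  by rewrite [h%:A]mulr1 !mulr0 !mulr1 !add0r.
by apply: DeriveDef; rewrite /derivable /derive E.
Qed.

(** Put Q = U^2 + V^2 + W^2. By 2|z y| <= z^2 + y^2 and z^2 <= Q the bracket is at most (3 z^2 + Q)
    / 2 + Q / 2 <= 5 Q / 2, and the factor in front is at most 2. *)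
Lemma cut_term (a b c al U V W z s t : R) :
  `|a| <= 1 -> `|b| <= 1 -> `|c| <= 1 -> `|al| <= 1 ->
  z ^+ 2 <= U ^+ 2 + V ^+ 2 + W ^+ 2 -> 0 <= s <= 1 -> 0 <= t <= 1 ->
  `|2 * al * (s * t) * (z * (a * U + b * V + c * W)
     - 2^-1 * al * (U ^+ 2 + V ^+ 2 + W ^+ 2))| <= 5 * (U ^+ 2 + V ^+ 2 + W ^+ 2).
Proof.
move=> a1 b1 c1 l1 zQ /andP[s0 s1] /andP[t0 t1].
set Q := U ^+ 2 + V ^+ 2 + W ^+ 2 in zQ *.
have Q0 : 0 <= Q by rewrite !addr_ge0 ?sqr_ge0.
have h2 (y d : R) : `|d| <= 1 -> `|z * (d * y)| <= 2^-1 * (z ^+ 2 + y ^+ 2).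
  move=> d1; rewrite !normrM -(real_normK (num_real z)) -(real_normK (num_real y)).
  have h : `|z| * (`|d| * `|y|) <= `|z| * `|y|.
    by rewrite ler_wpM2l// ler_piMl.
  apply: (le_trans h); have := sqr_ge0 (`|z| - `|y|); rewrite sqrrB; lra.
have hI : `|z * (a * U + b * V + c * W) - 2^-1 * al * Q| <= 2^-1 * 5 * Q.
  have -> : z * (a * U + b * V + c * W) = z * (a * U) + z * (b * V) + z * (c * W) by ring.
  apply: (le_trans (ler_normB _ _)).
  apply: (le_trans (lerD (ler_normD _ _) (lexx _))).
  apply: (le_trans (lerD (lerD (ler_normD _ _) (lexx _)) (lexx _))).
  have hq : `|2^-1 * al * Q| <= 2^-1 * Q.
    rewrite !normrM (ger0_norm Q0) (ger0_norm (x := 2^-1)) ?invr_ge0//.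
    by rewrite ler_wpM2r// -[leRHS]mulr1 ler_wpM2l// invr_ge0.
  apply: (le_trans (lerD (lerD (lerD (h2 U a a1) (h2 V b b1)) (h2 W c c1)) hq)).
  rewrite /Q in zQ *; lra.
rewrite normrM; apply: (le_trans (ler_wpM2l (normr_ge0 _) hI)).
have hs : `|2 * al * (s * t)| <= 2.
  rewrite !normrM (ger0_norm s0) (ger0_norm t0) (ger0_norm (x := 2))// -[leRHS]mulr1.
  rewrite ler_pM ?mulr_ge0//; first by rewrite -[leRHS]mulr1 ler_wpM2l.
  by rewrite -[leRHS]mulr1 ler_pM.
apply: (le_trans (ler_wpM2r _ hs)); first by rewrite mulr_ge0// mulr_ge0// invr_ge0.
by lra.
Qed.

Variables (u v w : v3 R -> R) (du dv dw : 'I_3 -> v3 R -> R).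
Hypotheses (cu : continuous u) (cv : continuous v) (cw : continuous w).
Hypotheses (cdu : forall j, continuous (du j)) (cdv : forall j, continuous (dv j))
  (cdw : forall j, continuous (dw j)).
Hypotheses (Du : forall j x, is_derive x (e3 j) u (du j x))
  (Dv : forall j x, is_derive x (e3 j) v (dv j x))
  (Dw : forall j x, is_derive x (e3 j) w (dw j x)).
Hypotheses (curl0 : forall x, [/\ dv 0 x = du 1 x, dw 0 x = du 2 x & dw 1 x = dv 2 x])
  (div0 : forall x, du 0 x + dv 1 x + dw 2 x = 0).
Let q x := u x ^+ 2 + v x ^+ 2 + w x ^+ 2.
Hypothesis qi : i3 q.

Let A x := x.1.1 * u x + x.1.2 * v x + x.2 * w x.
(** With [r = N^-1] this vanishes on all faces of the box |x_i| <= N. Being a polynomial in the x_i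
    r, it has derivatives carrying x_i r^2, so each coordinate of size N meets a factor 1/N. *)
Let cut (r : R) x := (1 - (x.1.1 * r) ^+ 2) * (1 - (x.1.2 * r) ^+ 2) * (1 - (x.2 * r) ^+ 2).
(** The part of the derivative of [A] in which the field is differentiated; the full derivative has
    the j-th component of the field in addition. Likewise [q_ j] is half the derivative of [q]. *)
Let A_ j x := x.1.1 * du j x + x.1.2 * dv j x + x.2 * dw j x.
Let q_ j x := u x * du j x + v x * dv j x + w x * dw j x.

Let F1 r x := cut r x * (u x * A x - 2^-1 * x.1.1 * q x).
Let F2 r x := cut r x * (v x * A x - 2^-1 * x.1.2 * q x).
Let F3 r x := cut r x * (w x * A x - 2^-1 * x.2 * q x).

Let G1 r x := - (2 * r ^+ 2) * x.1.1 * ((1 - (x.1.2 * r) ^+ 2) * (1 - (x.2 * r) ^+ 2)) *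
    (u x * A x - 2^-1 * x.1.1 * q x) +
  cut r x * (du 0 x * A x + u x * (u x + A_ 0 x) - 2^-1 * q x - x.1.1 * q_ 0 x).
Let G2 r x := - (2 * r ^+ 2) * x.1.2 * ((1 - (x.1.1 * r) ^+ 2) * (1 - (x.2 * r) ^+ 2)) *
    (v x * A x - 2^-1 * x.1.2 * q x) +
  cut r x * (dv 1 x * A x + v x * (v x + A_ 1 x) - 2^-1 * q x - x.1.2 * q_ 1 x).
Let G3 r x := - (2 * r ^+ 2) * x.2 * ((1 - (x.1.1 * r) ^+ 2) * (1 - (x.1.2 * r) ^+ 2)) *
    (w x * A x - 2^-1 * x.2 * q x) +
  cut r x * (dw 2 x * A x + w x * (w x + A_ 2 x) - 2^-1 * q x - x.2 * q_ 2 x).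

Let D1 (r x y z : R) : is_derive x 1 (fun t : R => F1 r ((t, y), z)) (G1 r ((x, y), z)).
Proof.
have hu := is_derive_slice0 (Du 0 ((x, y), z)).
have hv := is_derive_slice0 (Dv 0 ((x, y), z)).
have hw := is_derive_slice0 (Dw 0 ((x, y), z)).
rewrite /F1 /cut /A /q /=; apply: is_derive_eq.
by rewrite /G1 /cut /A_ /q_ /A /q /GRing.scale/=; field.
Qed.

Let D2 (r x y z : R) : is_derive y 1 (fun t : R => F2 r ((x, t), z)) (G2 r ((x, y), z)).
Proof.
have hu := is_derive_slice1 (Du 1 ((x, y), z)).
have hv := is_derive_slice1 (Dv 1 ((x, y), z)).
have hw := is_derive_slice1 (Dw 1 ((x, y), z)).
rewrite /F2 /cut /A /q /=; apply: is_derive_eq.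
by rewrite /G2 /cut /A_ /q_ /A /q /GRing.scale/=; field.
Qed.

Let D3 (r x y z : R) : is_derive z 1 (fun t : R => F3 r ((x, y), t)) (G3 r ((x, y), z)).
Proof.
have hu := is_derive_slice2 (Du 2 ((x, y), z)).
have hv := is_derive_slice2 (Dv 2 ((x, y), z)).
have hw := is_derive_slice2 (Dw 2 ((x, y), z)).
rewrite /F3 /cut /A /q /=; apply: is_derive_eq.
by rewrite /G3 /cut /A_ /q_ /A /q /GRing.scale/=; field.
Qed.

Let c1 : continuous (fun x : v3 R => x.1.1).
Proof. by move=> x; apply: cvg_comp; [exact: cvg_fst|exact: cvg_fst]. Qed.
Let c2 : continuous (fun x : v3 R => x.1.2).
Proof. by move=> x; apply: cvg_comp; [exact: cvg_fst|exact: cvg_snd]. Qed.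
Let c3 : continuous (fun x : v3 R => x.2).
Proof. by move=> x; exact: cvg_snd. Qed.

Let contM (f g : v3 R -> R) : continuous f -> continuous g -> continuous (fun x => f x * g x).
Proof. by move=> cf cg x; apply: cvgM; [exact: cf|exact: cg]. Qed.
Let contD (f g : v3 R -> R) : continuous f -> continuous g -> continuous (fun x => f x + g x).
Proof. by move=> cf cg x; apply: cvgD; [exact: cf|exact: cg]. Qed.
Let contN (f : v3 R -> R) : continuous f -> continuous (fun x => - f x).
Proof. by move=> cf x; apply: cvgN; exact: cf. Qed.
Let contX (f : v3 R -> R) : continuous f -> continuous (fun x => f x ^+ 2).
Proof. by move=> cf; under eq_fun do rewrite expr2; exact: contM. Qed.
Let contC (k : R) : continuous (fun _ : v3 R => k).
Proof. by move=> x; exact: cvg_cst. Qed.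

Let contB (f g : v3 R -> R) : continuous f -> continuous g -> continuous (fun x => f x - g x).
Proof. by move=> cf cg; exact: (contD cf (contN cg)). Qed.
Let cs (f : v3 R -> R) r : continuous f -> continuous (fun x => 1 - (f x * r) ^+ 2).
Proof. by move=> cf; exact: (contB (@contC _) (contX (contM cf (@contC r)))). Qed.

Let cA : continuous A.
Proof. exact: (contD (contD (contM c1 cu) (contM c2 cv)) (contM c3 cw)). Qed.
Let cA_ j : continuous (A_ j).
Proof. exact: (contD (contD (contM c1 (@cdu j)) (contM c2 (@cdv j))) (contM c3 (@cdw j))). Qed.
Let cq_ j : continuous (q_ j).
Proof. exact: (contD (contD (contM cu (@cdu j)) (contM cv (@cdv j))) (contM cw (@cdw j))). Qed.
Let cq : continuous q.
Proof. exact: (contD (contD (contX cu) (contX cv)) (contX cw)). Qed.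
Let ccut r : continuous (cut r).
Proof. exact: (contM (contM (@cs _ r c1) (@cs _ r c2)) (@cs _ r c3)). Qed.
Let cG1 r : continuous (G1 r).
Proof.
exact: (contD (contM (contM (contM (@contC _) c1) (contM (@cs _ r c2) (@cs _ r c3)))
    (contB (contM cu cA) (contM (contM (@contC _) c1) cq)))
  (contM (@ccut r) (contB (contB (contD (contM (@cdu 0) cA)
    (contM cu (contD cu (@cA_ 0)))) (contM (@contC _) cq)) (contM c1 (@cq_ 0))))).
Qed.
Let cG2 r : continuous (G2 r).
Proof.
exact: (contD (contM (contM (contM (@contC _) c2) (contM (@cs _ r c1) (@cs _ r c3)))
    (contB (contM cv cA) (contM (contM (@contC _) c2) cq)))
  (contM (@ccut r) (contB (contB (contD (contM (@cdv 1) cA)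
    (contM cv (contD cv (@cA_ 1)))) (contM (@contC _) cq)) (contM c2 (@cq_ 1))))).
Qed.
Let cG3 r : continuous (G3 r).
Proof.
exact: (contD (contM (contM (contM (@contC _) c3) (contM (@cs _ r c1) (@cs _ r c2)))
    (contB (contM cw cA) (contM (contM (@contC _) c3) cq)))
  (contM (@ccut r) (contB (contB (contD (contM (@cdw 2) cA)
    (contM cw (contD cw (@cA_ 2)))) (contM (@contC _) cq)) (contM c3 (@cq_ 2))))).
Qed.

(** The divergence of the cut-off field after all derivatives of the field have been eliminated;
    [a], [b], [c] stand for the coordinates divided by N. *)
Let P (a b c : R) x :=
  - (2^-1 * ((1 - a ^+ 2) * (1 - b ^+ 2) * (1 - c ^+ 2)) * q x) -
  2 * a * ((1 - b ^+ 2) * (1 - c ^+ 2)) * (u x * (a * u x + b * v x + c * w x) - 2^-1 * a * q x) -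
  2 * b * ((1 - a ^+ 2) * (1 - c ^+ 2)) * (v x * (a * u x + b * v x + c * w x) - 2^-1 * b * q x) -
  2 * c * ((1 - a ^+ 2) * (1 - b ^+ 2)) * (w x * (a * u x + b * v x + c * w x) - 2^-1 * c * q x).

(** Vanishing curl makes the Jacobian of D symmetric, so D . grad (x . D) = |D|^2 + x . grad |D|^2 /
    2. The last term cancels against the divergence of x |D|^2 / 2, which leaves -3 |D|^2 / 2; the
    term (div D) (x . D) is 0. *)
Let G_sum r x : G1 r x + G2 r x + G3 r x = P (x.1.1 * r) (x.1.2 * r) (x.2 * r) x.
Proof.
have [e1 e2 e3] := curl0 x.
have e4 : dw 2 x = - du 0 x - dv 1 x by have := div0 x => h; lra.
by rewrite /G1 /G2 /G3 /P /A_ /q_ /cut /A /q e1 e2 e3 e4; field.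
Qed.

Let int_P (N : R) : 0 < N ->
  int3 (fun x => ind3 N x * P (x.1.1 * N^-1) (x.1.2 * N^-1) (x.2 * N^-1) x) = 0.
Proof.
move=> N0; have NN : N * N^-1 = 1 by rewrite mulfV// gt_eqF.
transitivity (int3 (fun x => ind3 N x * G1 N^-1 x + ind3 N x * G2 N^-1 x + ind3 N x * G3 N^-1 x)).
  by apply: int3_eq => x; rewrite -G_sum !mulrDr.
rewrite !int3D; try by do ?[apply: i3D|apply: i3_box].
have z0 : 1 - (N * N^-1) ^+ 2 = 0 by rewrite NN expr1n subrr.
have z1 : 1 - (- N * N^-1) ^+ 2 = 0 by rewrite mulNr NN sqrrN expr1n subrr.
have E1 : int3 (fun x => ind3 N x * G1 N^-1 x) = 0.
  apply: (@box_divergence1 R N (F1 N^-1) (G1 N^-1) N0 (@cG1 _) (D1 N^-1)) => y z;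
  by rewrite /F1 /cut/= ?z0 ?z1 !mul0r.
have E2 : int3 (fun x => ind3 N x * G2 N^-1 x) = 0.
  apply: (@box_divergence2 R N (F2 N^-1) (G2 N^-1) N0 (@cG2 _) (D2 N^-1)) => y z;
  by rewrite /F2 /cut/= ?z0 ?z1 mulr0 !mul0r.
have E3 : int3 (fun x => ind3 N x * G3 N^-1 x) = 0.
  apply: (@box_divergence3 R N (F3 N^-1) (G3 N^-1) N0 (@cG3 _) (D3 N^-1)) => y z;
  by rewrite /F3 /cut/= ?z0 ?z1 mulr0 !mul0r.
by rewrite E1 E2 E3 !addr0.
Qed.

(** The constant 16 majorizes 1/2 for the main term plus 3 times 5 for the cutoff terms of
    [cut_term]. *)
Let P_le (a b c : R) x : `|a| <= 1 -> `|b| <= 1 -> `|c| <= 1 ->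
  `|P a b c x| <= 16 * q x.
Proof.
move=> a1 b1 c1'.
have sq (t : R) : `|t| <= 1 -> 0 <= 1 - t ^+ 2 <= 1.
  move=> t1; rewrite subr_ge0 lerBlDr lerDl sqr_ge0 andbT.
  by rewrite -[t ^+ 2]ger0_norm ?sqr_ge0// normrX expr_le1.
have qE : u x ^+ 2 + v x ^+ 2 + w x ^+ 2 = q x by [].
have hu : u x ^+ 2 <= q x by rewrite /q -addrA lerDl addr_ge0 ?sqr_ge0.
have hv : v x ^+ 2 <= q x by rewrite /q addrAC lerDr addr_ge0 ?sqr_ge0.
have hw : w x ^+ 2 <= q x by rewrite /q lerDr addr_ge0 ?sqr_ge0.
have T1 := cut_term a1 b1 c1' a1 hu (sq _ b1) (sq _ c1').
have T2 := cut_term a1 b1 c1' b1 hv (sq _ a1) (sq _ c1').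
have T3 := cut_term a1 b1 c1' c1' hw (sq _ a1) (sq _ b1).
have T0 : `|- (2^-1 * ((1 - a ^+ 2) * (1 - b ^+ 2) * (1 - c ^+ 2)) * q x)| <= 2^-1 * q x.
  have /andP[ha ha'] := sq _ a1; have /andP[hb hb'] := sq _ b1; have /andP[hc hc'] := sq _ c1'.
  have q0 : 0 <= q x by rewrite (le_trans (sqr_ge0 (u x))).
  have hab : 0 <= (1 - a ^+ 2) * (1 - b ^+ 2) * (1 - c ^+ 2) <= 1.
    rewrite !mulr_ge0//= -[leRHS]mulr1 ler_pM ?mulr_ge0//.
    by rewrite -[leRHS]mulr1 ler_pM.
  have /andP[h0 h1] := hab.
  rewrite normrN ger0_norm; last by rewrite mulr_ge0// mulr_ge0.
  by rewrite ler_wpM2r// -[leRHS]mulr1 ler_wpM2l.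
rewrite /P qE in T1 T2 T3 *.
apply: (le_trans (ler_normB _ _)); apply: (le_trans (lerD (ler_normB _ _) (lexx _))).
apply: (le_trans (lerD (lerD (ler_normB _ _) (lexx _)) (lexx _))).
have q0 : 0 <= q x by rewrite (le_trans (sqr_ge0 (u x))).
by apply: (le_trans (lerD (lerD (lerD T0 T1) T2) T3)); lra.
Qed.

Lemma div_curl_free_L2 : int3 q = 0.
Proof.
have q0 x : 0 <= q x by rewrite /q !addr_ge0// sqr_ge0.
pose N n : R := n.+1%:R.
have N0 n : 0 < N n by [].
pose h n x := ind3 (N n) x * P (x.1.1 * (N n)^-1) (x.1.2 * (N n)^-1) (x.2 * (N n)^-1) x.
have hle n x : `|h n x| <= 16 * q x.
  rewrite /h; have [->|[-> h1 h2 h3]] := ind3_P (N n) x.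
    by rewrite mul0r normr0 mulr_ge0.
  rewrite mul1r; apply: P_le; rewrite normrM (gtr0_norm (x := _^-1)) ?invr_gt0//;
    by rewrite ler_pdivrMr// mul1r.
have hcvg x : h n x @[n --> \oo] --> - 2^-1 * q x.
  have H : P (x.1.1 * (N n)^-1) (x.1.2 * (N n)^-1) (x.2 * (N n)^-1) x @[n --> \oo] --> - 2^-1 * q x.
    (* At t = 1/N the expression is the value of a polynomial in t, whose value at 0 is the
       divergence without cutoff. *)
    pose p (t : R) := P (x.1.1 * t) (x.1.2 * t) (x.2 * t) x.
    have p0 : p 0 = - 2^-1 * q x by rewrite /p /P !mulr0; ring.
    rewrite -p0; apply: (cvg_comp (fun n => (N n)^-1) p (cvg_harmonic (R := R))).
    apply/differentiable_continuous/derivable1_diffP.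
    by rewrite /p /P; exact: ex_derive.
  move: H; apply: cvg_trans; apply: near_eq_cvg; near=> n.
  rewrite /h; suff -> : ind3 (N n) x = 1 by rewrite mul1r.
  have hn : N1 x <= N n.
    rewrite (le_trans (y := n%:R))//; last by rewrite ler_nat.
    by near: n; exact: nbhs_infty_ger.
  have cl (z : R) : `|z| <= N1 x -> ind1 (N n) z = 1.
    by move=> zl; rewrite /ind1 (le_trans zl hn).
  rewrite /ind3 !cl ?mulr1//.
  - exact: (coord_le 2).
  - exact: (coord_le 1).
  - exact: (coord_le 0).
have mh n : m3 (h n).
  apply: measurable_funM; first exact: (i3_m3 (@i3_ind3 R _)).
  have -> : (fun x => P (x.1.1 / N n) (x.1.2 / N n) (x.2 / N n) x) =
    fun x => G1 (N n)^-1 x + G2 (N n)^-1 x + G3 (N n)^-1 x.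
    by apply/funext => x; rewrite G_sum.
  apply: continuous_measurable_v3.
  by apply: contD; [apply: contD|]; [exact: cG1|exact: cG2|exact: cG3].
have := @int3_dct _ h (fun x => - 2^-1 * q x) (fun x => 16 * q x) mh
  (i3_m3 (i3Z _ qi)) (i3Z 16 qi) (fun x _ => hcvg x) hle.
(* Every integral of the sequence is 0, while the limit is -1/2 times the integral of [q]. *)
have -> : (fun n => int3 (h n)) = fun=> 0 by apply/funext => n; rewrite int_P.
rewrite int3Z// => H.
have /esym/eqP : 0 = - 2^-1 * int3 q by rewrite -(cvg_lim (@Rhausdorff R) H) lim_cst.
rewrite mulf_eq0 => /orP[|/eqP//].
by rewrite oppr_eq0 invr_eq0 pnatr_eq0.
Unshelve. all: by end_near. Qed.
End virial.

(** * The transverse projection and the decay of the form factor *)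

Section magnetic.
Variable R : realType.
Implicit Types (k x S : v3 R).

Lemma ord3_ind (P : 'I_3 -> Prop) : P 0 -> P 1 -> P 2 -> forall j, P j.
Proof.
move=> P0 P1 P2 [[|[|[|n]]] jn].
- by rewrite (_ : Ordinal jn = 0)//; apply: val_inj.
- by rewrite (_ : Ordinal jn = 1)//; apply: val_inj.
- by rewrite (_ : Ordinal jn = 2)//; apply: val_inj.
- by [].
Qed.

(** As 0^-1 = 0, this vanishes at the origin, and so does the projection built from it. *)
Definition kap k : R := (dot3 k k)^-1.

Lemma dot3_ge0 k : 0 <= dot3 k k.
Proof. by rewrite /dot3 -!expr2 !addr_ge0 ?sqr_ge0. Qed.

Lemma dot3_eq0 k : dot3 k k = 0 -> k = 0.
Proof.
case: k => [[x y] z]; rewrite /dot3/= -!expr2 => /eqP.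
rewrite paddr_eq0 ?addr_ge0 ?sqr_ge0// paddr_eq0 ?sqr_ge0// !sqrf_eq0.
by move=> /andP[/andP[/eqP-> /eqP->] /eqP->].
Qed.

Lemma norm3_sqr k : norm3 k ^+ 2 = dot3 k k.
Proof. by rewrite sqr_sqrtr// dot3_ge0. Qed.

(* On all of R^3: both sides vanish at the origin, where [kap 0 = 0]. *)
Lemma kap_dot3 k j : kap k * dot3 k k * Defs.coord k j = Defs.coord k j.
Proof.
have [/dot3_eq0 ->|k0] := eqVneq (dot3 k k) 0; last by rewrite mulVf// mul1r.
by rewrite [Defs.coord 0 j](_ : _ = 0) ?mulr0//; case: j => [[|[|[|//]]] ?].
Qed.

Lemma kap_kap k : kap k * kap k * dot3 k k = kap k.
Proof.
rewrite /kap; have [->|k0] := eqVneq (dot3 k k) 0; first by rewrite mulr0 invr0.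
by rewrite mulfVK.
Qed.

Lemma measurable_inv : measurable_fun [set: T1 R] (GRing.inv : T1 R -> T1 R).
Proof.
have m0 : measurable ([set (0 : R)] : set (T1 R)) by exact: measurable_set1.
have -> : [set: T1 R] = [set (0 : R)] `|` ~` [set (0 : R)] by rewrite setUv.
apply/measurable_funU => //; first exact: measurableC.
split; first exact: measurable_fun_set1.
apply: open_continuous_measurable_fun.
  by rewrite openC; apply: accessible_closed_set1; apply: hausdorff_accessible; exact: Rhausdorff.
by move=> x; rewrite inE/= => /eqP x0; exact: inv_continuous.
Qed.

Lemma m3_dot_self : m3 (fun k => dot3 k k).
Proof.
apply: measurable_funD; first apply: measurable_funD.
- by apply: measurable_funM => //; exact: m3_1.
- by apply: measurable_funM => //; exact: m3_2.
- by apply: measurable_funM => //; exact: m3_3.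
Qed.

Lemma m3_kap : m3 kap.
Proof. exact: (measurableT_comp measurable_inv m3_dot_self). Qed.

Lemma continuous_v3_1 : continuous (fun k : v3 R => k.1.1).
Proof. by move=> x; apply: cvg_comp; [exact: cvg_fst|exact: cvg_fst]. Qed.
Lemma continuous_v3_2 : continuous (fun k : v3 R => k.1.2).
Proof. by move=> x; apply: cvg_comp; [exact: cvg_fst|exact: cvg_snd]. Qed.
Lemma continuous_v3_3 : continuous (fun k : v3 R => k.2).
Proof. by move=> x; exact: cvg_snd. Qed.

Lemma continuous_dot_self : continuous (fun k => dot3 k k).
Proof.
move=> k; apply: cvgD; first apply: cvgD; apply: cvgM;
  by [exact: continuous_v3_1|exact: continuous_v3_2|exact: continuous_v3_3].
Qed.

Lemma continuous_dot3 x : continuous (fun k => dot3 k x).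
Proof.
move=> k; apply: cvgD; first apply: cvgD; apply: cvgM; try exact: cvg_cst;
  by [exact: continuous_v3_1|exact: continuous_v3_2|exact: continuous_v3_3].
Qed.

Lemma continuous_norm3 : continuous (@norm3 R).
Proof.
move=> k; apply: (cvg_comp (fun k => dot3 k k) Num.sqrt).
  exact: continuous_dot_self.
exact: sqrt_continuous.
Qed.

(* Fourier side of the transverse projection [S - k (k.S) / |k|^2] of [S]. *)
Definition transv S k : v3 R :=
  let t := cross3 (cross3 k S) k in ((kap k * t.1.1, kap k * t.1.2), kap k * t.2).

Lemma m3_transv S j : m3 (fun k => Defs.coord (transv S k) j).
Proof.
have mC (f : v3 R -> R) c : m3 f -> m3 (fun k => f k * c).
  by move=> mf; apply: measurable_funM.
have m1 := @m3_1 R; have m2 := @m3_2 R; have m4 := @m3_3 R.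
have mc j' : m3 (fun k => Defs.coord (cross3 k S) j').
  case: j' => [[|[|[|//]]] ?]; apply: measurable_funB; exact: mC.
have mc0 := mc 0; have mc1 := mc 1; have mc2 := mc 2.
by case: j => [[|[|[|//]]] ?]; apply: measurable_funM; [exact: m3_kap|
  apply: measurable_funB; apply: measurable_funM => //|exact: m3_kap|
  apply: measurable_funB; apply: measurable_funM => //|exact: m3_kap|
  apply: measurable_funB; apply: measurable_funM => //].
Qed.

Lemma transv_continuous S j k : k != 0 ->
  {for k, continuous (fun k => Defs.coord (transv S k) j)}.
Proof.
move=> k0.
have d0 : dot3 k k != 0 by apply: contra_neq k0; exact: dot3_eq0.
have ck : {for k, continuous kap} by apply: cvgV => //; exact: continuous_dot_self.
have c1 := @continuous_v3_1; have c2 := @continuous_v3_2; have c3 := @continuous_v3_3.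
have cM (f g : v3 R -> R) : continuous f -> continuous g -> continuous (fun x => f x * g x).
  by move=> cf cg x; apply: cvgM; [exact: cf|exact: cg].
have cB (f g : v3 R -> R) : continuous f -> continuous g -> continuous (fun x => f x - g x).
  by move=> cf cg x; apply: cvgB; [exact: cf|exact: cg].
have cC (c : R) : continuous (fun _ : v3 R => c) by move=> x; exact: cvg_cst.
have C0 := cB _ _ (cM _ _ c2 (cC S.2)) (cM _ _ c3 (cC S.1.2)).
have C1 := cB _ _ (cM _ _ c3 (cC S.1.1)) (cM _ _ c1 (cC S.2)).
have C2 := cB _ _ (cM _ _ c1 (cC S.1.2)) (cM _ _ c2 (cC S.1.1)).
have E (f : v3 R -> R) : continuous f -> {for k, continuous (fun x => kap x * f x)}.
  by move=> cf; apply: cvgM; [exact: ck|exact: cf].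
apply: (@ord3_ind (fun j => {for k, continuous (fun k => Defs.coord (transv S k) j)})).
- exact: (E _ (cB _ _ (cM _ _ C1 c3) (cM _ _ C2 c2))).
- exact: (E _ (cB _ _ (cM _ _ C2 c1) (cM _ _ C0 c3))).
- exact: (E _ (cB _ _ (cM _ _ C0 c2) (cM _ _ C1 c1))).
Qed.

Lemma transvN S j k : Defs.coord (transv S (- k)) j = Defs.coord (transv S k) j.
Proof.
have kN : kap (- k) = kap k by rewrite /kap /dot3/=; congr (_^-1); ring.
case: k kN => [[k1 k2] k3] kN.
by case: j => [[|[|[|//]]] ?]; rewrite /Defs.coord /transv/= kN /=; ring.
Qed.

Lemma transv_le S j k : `|Defs.coord (transv S k) j| <= 2 * N1 S.
Proof.
have [/dot3_eq0 k0|d0] := eqVneq (dot3 k k) 0.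
  have -> : Defs.coord (transv S k) j = 0.
    have kap0 : kap k = 0 by rewrite /kap k0 /dot3/= !mulr0 !addr0 invr0.
    by case: j => [[|[|[|//]]] ?]; rewrite /Defs.coord /transv/= kap0 mul0r.
  by rewrite normr0 mulr_ge0// N1_ge0.
have dp : 0 < dot3 k k by rewrite lt_neqAle eq_sym d0 dot3_ge0.
(* One component, up to a cyclic relabelling of the axes. It equals (k2^2 + k3^2) s1 - k1 k2 s2 - k1
   k3 s3, with each coefficient at most |k|^2 in absolute value; the factor 2 is slack. *)
have aux (k1 k2 k3 s1 s2 s3 : R) : (k1, k2, k3) = k \/ (k2, k3, k1) = k \/ (k3, k1, k2) = k ->
    `|(k3 * s1 - k1 * s3) * k3 - (k1 * s2 - k2 * s1) * k2| <= dot3 k k * (2 * (`|s1| + `|s2| + `|s3|)).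
  move=> kE.
  have -> : dot3 k k = k1 ^+ 2 + k2 ^+ 2 + k3 ^+ 2.
    by case: kE => [<-|[<-|<-]]; rewrite /dot3/=; ring.
  set Q := _ + _ + _.
  have sq (y z : R) : y ^+ 2 + z ^+ 2 <= Q -> `|y * z| <= Q.
    move=> h; apply: le_trans h; rewrite normrM.
    have := sqr_ge0 (`|y| - `|z|); rewrite sqrrB !real_normK ?num_real//.
    have := mulr_ge0 (normr_ge0 y) (normr_ge0 z).
    lra.
  have -> : (k3 * s1 - k1 * s3) * k3 - (k1 * s2 - k2 * s1) * k2 =
    (k2 ^+ 2 + k3 ^+ 2) * s1 - (k1 * k2) * s2 - (k1 * k3) * s3 by ring.
  have h1 := sqr_ge0 k1; have h2 := sqr_ge0 k2; have h3 := sqr_ge0 k3.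
  have H1 : `|(k2 ^+ 2 + k3 ^+ 2) * s1| <= Q * `|s1|.
    rewrite normrM ler_wpM2r// ger0_norm ?addr_ge0//; rewrite /Q; lra.
  have H2 : `|k1 * k2 * s2| <= Q * `|s2|.
    by rewrite normrM ler_wpM2r// sq// /Q; lra.
  have H3 : `|k1 * k3 * s3| <= Q * `|s3|.
    by rewrite normrM ler_wpM2r// sq// /Q; lra.
  have Q0 : 0 <= Q by rewrite /Q !addr_ge0.
  have n0 : 0 <= Q * (`|s1| + `|s2| + `|s3|) by rewrite mulr_ge0// !addr_ge0.
  apply: (le_trans (ler_normB _ _)); apply: (le_trans (lerD (ler_normB _ _) (lexx _))).
  apply: (le_trans (lerD (lerD H1 H2) H3)); rewrite mulrCA -!mulrDr; lra.
have fin (t : R) : `|t| <= dot3 k k * (2 * N1 S) -> `|kap k * t| <= 2 * N1 S.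
  move=> h; rewrite normrM gtr0_norm ?invr_gt0//.
  by rewrite mulrC ler_pdivrMr// mulrC.
case: k d0 dp aux fin => [[k1 k2] k3] d0 dp aux fin.
case: j => [[|[|[|//]]] ?]; apply: fin.
- by apply: (le_trans (aux k1 k2 k3 S.1.1 S.1.2 S.2 _)); [left|].
- apply: (le_trans (aux k2 k3 k1 S.1.2 S.2 S.1.1 _)); first by right; right.
  by rewrite (_ : `|_| + _ + _ = N1 S)// /N1; ring.
- apply: (le_trans (aux k3 k1 k2 S.2 S.1.1 S.1.2 _)); first by right; left.
  by rewrite (_ : `|_| + _ + _ = N1 S)// /N1; ring.
Qed.

(** The product of the 1 + k_i^2 in the denominator of [Gam] is at most (1 + |k|^2)^3, and the
    squared moment factor is at most 8 (1 + |k|^2). So a bound on |phi(r)| (1 + r^2)^4 suffices,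
    whence the Schwartz bounds with powers 0 and 8. *)
Lemma schwartz_decay (phi : R -> R) : schwartz phi ->
  exists C : R, 0 <= C /\ decay 2 (fun k => phi (norm3 k)) (fun k => C * Gam k).
Proof.
move=> [dphi hphi].
have cphi : continuous phi.
  move=> x; apply/differentiable_continuous/derivable1_diffP; exact: (dphi 0%N x).
have [A0 hA0] := hphi 0%N 0%N; have [A8 hA8] := hphi 8%N 0%N.
(* From (1 + s)^4 <= 16 (1 + s^4) with s = r^2: the left side is at most 2^4 if s <= 1 and at most
   (2 s)^4 otherwise. *)
pose B := 16 * (A0 + A8).
have hB (r : R) : `|phi r| * (1 + r ^+ 2) ^+ 4 <= B.
  have /= h0 := hA0 r; rewrite mul1r in h0; have /= h8 := hA8 r.
  have p0 : 0 <= `|phi r| by [].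
  have r8 : `|r| ^+ 8 = (r ^+ 2) ^+ 4.
    by rewrite -(real_normK (num_real r)) -exprM.
  rewrite r8 in h8.
  have s0 := sqr_ge0 r; set s := r ^+ 2 in h8 s0 *.
  have h4 : (1 + s) ^+ 4 <= 16 * (1 + s ^+ 4).
    have [s1|s1] := leP s 1.
      apply: (@le_trans _ _ (2 ^+ 4)); first by apply: lerXn2r; rewrite ?nnegrE; lra.
      by have := exprn_ge0 4 s0; lra.
    apply: (@le_trans _ _ ((2 * s) ^+ 4)); first by apply: lerXn2r; rewrite ?nnegrE; lra.
    by rewrite exprMn; lra.
  apply: (le_trans (ler_wpM2l p0 h4)).
  rewrite mulrCA mulrDr mulr1 /B ler_wpM2l// lerD// mulrC; exact: h8.
have B0 : 0 <= B by apply: le_trans (hB 0); rewrite mulr_ge0// exprn_ge0// addr_ge0// sqr_ge0.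
exists B; split=> //; split.
- by apply: (measurableT_comp (continuous_measurable_fun cphi)); apply: continuous_measurable_v3; exact: continuous_norm3.
- by apply: i3Z; exact: i3_Gam.
- move=> k.
  set a := k.1.1 ^+ 2; set b := k.1.2 ^+ 2; set c := k.2 ^+ 2.
  have a0 : 0 <= a by exact: sqr_ge0. have b0 : 0 <= b by exact: sqr_ge0.
  have c0 : 0 <= c by exact: sqr_ge0.
  have s : norm3 k ^+ 2 = a + b + c by rewrite norm3_sqr /dot3 -!expr2.
  have hb := hB (norm3 k); rewrite s in hb.
  have n1 : (1 + N1 k) ^+ 2 <= 8 * (1 + (a + b + c)).
    rewrite /N1 /a /b /c -(real_normK (num_real k.1.1)) -(real_normK (num_real k.1.2)) -(real_normK (num_real k.2)).
    set x := `|k.1.1|; set y := `|k.1.2|; set z := `|k.2|.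
    have := sqr_ge0 (x - y); have := sqr_ge0 (x - z); have := sqr_ge0 (y - z).
    have := sqr_ge0 (1 - x); have := sqr_ge0 (1 - y); have := sqr_ge0 (1 - z).
    have := sqr_ge0 x; have := sqr_ge0 y; have := sqr_ge0 z.
    by rewrite !expr2; lra.
  have pr : (1 + a) * (1 + b) * (1 + c) <= (1 + (a + b + c)) ^+ 3.
    rewrite !exprS expr0 mulr1 mulrA ler_pM ?mulr_ge0 ?addr_ge0//; last lra.
    by rewrite ler_pM ?addr_ge0//; lra.
  have P0 : 0 < (1 + a) * (1 + b) * (1 + c) by rewrite !mulr_gt0// ltr_pwDl.
  have -> : Gam k = 8 / ((1 + a) * (1 + b) * (1 + c)).
    by rewrite /Gam -/a -/b -/c !invfM; ring.
  rewrite [leRHS]mulrA ler_pdivlMr//.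
  have T1 : 0 <= 1 + (a + b + c) by rewrite !addr_ge0.
  apply: (@le_trans _ _ (`|phi (norm3 k)| * (8 * (1 + (a + b + c))) * (1 + (a + b + c)) ^+ 3)).
    apply: ler_pM => //; last exact: ler_wpM2l.
      by rewrite mulr_ge0// exprn_ge0// addr_ge0// N1_ge0.
    exact: ltW.
  rewrite (_ : _ * _ * _ = 8 * (`|phi (norm3 k)| * (1 + (a + b + c)) ^+ 4)); last by ring.
  by rewrite mulrC ler_wpM2r.
Qed.
End magnetic.

(** * The explicit magnetic field and its energy *)

Section energy.
Variables (R : realType) (P : nat) (M : 'I_P -> R) (xs S : 'I_P -> v3 R).
Variables (phi : R -> R).
Hypothesis hphi : schwartz phi.
Implicit Types (k x y : v3 R).

Definition pic : R := (2 * pi) ^- 3.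
Definition phik k : R := phi (norm3 k).
Definition beta l i k : R := phik k * Defs.coord (transv (S l) k) i.
(** With div B = 0 the equation curl B = j becomes -Laplacian B = curl j. The current of site l has
    Fourier coefficient phi(|k|) i k x S, so that of B is phi(|k|) (k x S) x k / |k|^2. It is even
    in k, hence a cosine transform is enough. *)
Definition B0 i x : R := \sum_(l < P) M l * pic * ct (beta l i) (x - xs l).
Definition dB0 i j x : R :=
  \sum_(l < P) M l * pic * - st (fun k => Defs.coord k j * beta l i k) (x - xs l).

Lemma sum_ord3 (V : nmodType) (F : 'I_3 -> V) : \sum_(i < 3) F i = F 0 + F 1 + F 2.
Proof.
rewrite !big_ord_recl big_ord0 addr0 addrA.
by congr (_ + F _ + F _); exact: val_inj.
Qed.

Lemma Gam_le k : Gam k <= 8 :> R.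
Proof.
have h (t : R) : 0 <= 2 * (1 + t ^+ 2)^-1 <= 2.
  rewrite mulr_ge0 ?(ltW (oneDsqrV_gt0 _))//= ler_piMr// invf_le1 ?ltr_pwDl ?sqr_ge0//.
  by rewrite lerDl sqr_ge0.
have -> : 8 = 2 * 2 * 2 :> R by ring.
have /andP[a1 a2] := h k.1.1; have /andP[b1 b2] := h k.1.2; have /andP[c1 c2] := h k.2.
by apply: ler_pM => //; [exact: mulr_ge0|exact: ler_pM].
Qed.

Lemma decay_beta : exists C : R, 0 <= C /\
  (decay 2 phik (fun k => C * Gam k) /\
   forall l i, decay 2 (beta l i) (fun k => 2 * N1 (S l) * (C * Gam k))).
Proof.
have [C [C0 hd]] := schwartz_decay hphi; exists C; split=> //; split=> // l i.
case: (hd) => mf gi h; split.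
- by apply: measurable_funM => //; exact: m3_transv.
- exact: i3Z.
- move=> k; rewrite /beta normrM mulrAC mulrC.
  apply: ler_pM => //; last exact: h.
    by rewrite mulr_ge0// exprn_ge0// addr_ge0// N1_ge0.
  exact: transv_le.
Qed.

Lemma is_derive_B0 i j x : is_derive x (e3 j) (B0 i) (dB0 i j x).
Proof.
have [C [_ [_ hb]]] := decay_beta.
have -> : B0 i = \sum_(l < P) (fun x => M l * pic * ct (beta l i) (x - xs l)).
  by apply/funext => y; rewrite fct_sumE.
apply: is_derive_sum => l.
apply: is_deriveZ; apply: is_derive_shift.
apply: (is_derive_ct (g := fun k => 2 * N1 (S l) * (C * Gam k))).
by apply: decay_weak; exact: hb.
Qed.

Lemma continuous_for_sum (F : 'I_P -> v3 R -> R) k :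
  (forall l, {for k, continuous (F l)}) ->
  {for k, continuous (fun x => \sum_(l < P) F l x)}.
Proof.
move=> cF; elim: (index_enum _) => [|l s IH].
  rewrite (_ : (fun x => _) = fun=> 0); first exact: cvg_cst.
  by apply/funext => x; rewrite big_nil.
rewrite (_ : (fun x => _) = fun x => F l x + \sum_(l <- s) F l x).
  by apply: cvgD; [exact: cF|exact: IH].
by apply/funext => x; rewrite big_cons.
Qed.

Lemma continuous_sum_v3 (F : 'I_P -> v3 R -> R) : (forall l, continuous (F l)) ->
  continuous (fun x => \sum_(l < P) F l x).
Proof. by move=> cF x; apply: continuous_for_sum => l; exact: cF. Qed.

Lemma continuous_shift_v3 (F : v3 R -> R) c y : continuous F ->
  continuous (fun x => c * F (x - y)).
Proof.
move=> cF x; apply: cvgMr; apply: (cvg_comp (fun x => x - y) F); last exact: cF.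
by apply: cvgB; [exact: cvg_id|exact: cvg_cst].
Qed.

Lemma continuous_B0 i : continuous (B0 i).
Proof.
have [C [_ [_ hb]]] := decay_beta.
apply: continuous_sum_v3 => l; apply: continuous_shift_v3.
by apply: ct_continuous; apply: decay_weak; exact: hb.
Qed.

Lemma continuous_dB0 i j : continuous (dB0 i j).
Proof.
have [C [_ [_ hb]]] := decay_beta.
apply: continuous_sum_v3 => l.
apply: (@continuous_shift_v3 (fun y => - st _ y)) => y; apply: cvgN.
by apply: st_continuous; apply: decay_coord; exact: hb.
Qed.

(** Expanding cos(k . (x - x_l)) moves the positions into the coefficients: the even one here and
    the odd one in [coefS], as [plancherel_trig] wants them. *)
Definition coefC i k : R := \sum_(l < P) M l * pic * (beta l i k * cos (dot3 k (xs l))).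
Definition coefS i k : R := \sum_(l < P) M l * pic * (beta l i k * sin (dot3 k (xs l))).

Lemma B0_trig i x : B0 i x = int3 (trig (coefC i) (coefS i) x).
Proof.
have [C [_ [_ hb]]] := decay_beta.
transitivity (int3 (fun k => \sum_(l < P) M l * pic * (beta l i k * cos (dot3 k (x - xs l))))).
  rewrite int3_sum; last by move=> l; apply: i3Z; exact: (decay_ct _ (hb l i)).
  apply: eq_bigr => l _; rewrite int3Z//; exact: (decay_ct _ (hb l i)).
apply: int3_eq => k; rewrite /trig /coefC /coefS !mulr_suml -big_split/=.
apply: eq_bigr => l _.
have -> : dot3 k (x - xs l) = dot3 k x - dot3 k (xs l) by rewrite /dot3/=; ring.
by rewrite cosB; ring.
Qed.

Lemma phikN k : phik (- k) = phik k.
Proof. by rewrite /phik /norm3 /dot3/= !mulrNN. Qed.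

Lemma dot3N k y : dot3 (- k) y = - dot3 k y.
Proof. by rewrite /dot3/= !mulNr !opprD. Qed.

Lemma coefCN i k : coefC i (- k) = coefC i k.
Proof.
by apply: eq_bigr => l _; rewrite /beta phikN transvN dot3N cosN.
Qed.

Lemma coefSN i k : coefS i (- k) = - coefS i k.
Proof.
rewrite -sumrN; apply: eq_bigr => l _.
by rewrite /beta phikN transvN dot3N sinN !mulrN.
Qed.

Lemma continuous_phik : continuous phik.
Proof.
have cphi : continuous phi.
  by move=> x; apply/differentiable_continuous/derivable1_diffP; exact: (hphi.1 0%N x).
move=> k; apply: (cvg_comp (@norm3 R) phi); first exact: continuous_norm3.
exact: cphi.
Qed.

Lemma B0_energy i : [/\ i3 (fun k => coefC i k ^+ 2 + coefS i k ^+ 2),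
  i3 (fun x => B0 i x ^+ 2) &
  int3 (fun x => B0 i x ^+ 2) = (2 * pi) ^+ 3 * int3 (fun k => coefC i k ^+ 2 + coefS i k ^+ 2)].
Proof.
have [C [C0 [_ hb]]] := decay_beta.
have -> : B0 i = fun x => int3 (trig (coefC i) (coefS i) x).
  by apply/funext => x; exact: B0_trig.
(* The decay of each [beta] gives the integrable majorant [h]; the bound [Gam_le] by 8 turns it into
   the constant [K]. *)
pose h k := \sum_(l < P) `|M l * pic| * (2 * N1 (S l) * (C * Gam k)).
pose K := \sum_(l < P) `|M l * pic| * (2 * N1 (S l) * (C * 8)).
have mb l : m3 (beta l i) by case: (hb l i).
have tle (t : 'I_P -> v3 R -> R) k : (forall l, `|t l k| <= 1) ->
    `|\sum_(l < P) M l * pic * (beta l i k * t l k)| <= h k.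
  move=> t1; apply: (le_trans (ler_norm_sum _ _ _)); apply: ler_sum => l _.
  rewrite normrM ler_wpM2l// normrM -[leRHS]mulr1 ler_pM//.
  exact: (decay_le k (hb l i)).
have msum (t : 'I_P -> v3 R -> R) : (forall l, m3 (t l)) ->
    m3 (fun k => \sum_(l < P) M l * pic * (beta l i k * t l k)).
  move=> mt; apply: measurable_sum => l; apply: measurable_funM => //.
  exact: (measurable_funM (mb l) (mt l)).
have csum (t : 'I_P -> v3 R -> R) k : k != 0 -> (forall l, continuous (t l)) ->
    {for k, continuous (fun k => \sum_(l < P) M l * pic * (beta l i k * t l k))}.
  move=> k0 ct; apply: continuous_for_sum => l; apply: cvgMr; apply: cvgM; last exact: ct.
  by apply: cvgM; [exact: continuous_phik|exact: transv_continuous].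
have cc l : continuous (fun k => cos (dot3 k (xs l))).
  move=> k; apply: (cvg_comp (fun k => dot3 k (xs l)) (@cos R)); last exact: continuous_cos.
  exact: continuous_dot3.
have csn l : continuous (fun k => sin (dot3 k (xs l))).
  move=> k; apply: (cvg_comp (fun k => dot3 k (xs l)) (@sin R)); last exact: continuous_sin.
  exact: continuous_dot3.
apply: (@plancherel_trig R (coefC i) (coefS i) h K).
- by apply: msum => l; apply: m3_cos; exact: m3_dot3r.
- by apply: msum => l; apply: m3_sin; exact: m3_dot3r.
- apply: i3_sum => l; apply: i3Z; apply: i3Z; apply: i3Z; exact: i3_Gam.
- by move=> k; apply: (tle (fun l k => cos (dot3 k (xs l)))) => l; exact: cos_max.
- by move=> k; apply: (tle (fun l k => sin (dot3 k (xs l)))) => l; exact: sin_max.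
- move=> k; apply: ler_sum => l _; rewrite ler_wpM2l// ler_wpM2l ?mulr_ge0 ?N1_ge0//.
  by rewrite ler_wpM2l// Gam_le.
- exact: coefCN.
- exact: coefSN.
- by move=> k k0; exact: (csum (fun l k => cos (dot3 k (xs l)))).
- by move=> k k0; exact: (csum (fun l k => sin (dot3 k (xs l)))).
Qed.

(** As (k x e_m).(k x e_m') = |k|^2 delta_mm' - k_m k_m', this is phi^2 times an entry of the
    transverse projection. *)
Definition gker m m' k : R :=
  phik k ^+ 2 * kap k * dot3 (cross3 k (e3 m)) (cross3 k (e3 m')).
Definition Gcos m m' y : R := int3 (fun k => pic * gker m m' k * cos (dot3 k y)).

Lemma m3_cross m j : m3 (fun k => Defs.coord (cross3 k (e3 m)) j).
Proof.
have mC (f : v3 R -> R) (c : R) : m3 f -> m3 (fun k => f k * c).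
  by move=> mf; apply: measurable_funM.
have m1 := @m3_1 R; have m2 := @m3_2 R; have m4 := @m3_3 R.
by move: j; apply: ord3_ind; apply: measurable_funB; exact: mC.
Qed.

Lemma cross_le k m : dot3 (cross3 k (e3 m)) (cross3 k (e3 m)) <= dot3 k k.
Proof.
have h1 := sqr_ge0 k.1.1; have h2 := sqr_ge0 k.1.2; have h3 := sqr_ge0 k.2.
by move: m; apply: ord3_ind; rewrite /dot3 /cross3 /e3/= ?mulr0 ?mulr1 -!expr2; lra.
Qed.

Lemma i3_gker m m' : i3 (gker m m').
Proof.
have [C [C0 hf]] := schwartz_decay hphi; case: (hf) => mf gi _.
have fle k : `|phik k| <= C * Gam k := decay_le k hf.
apply: (i3_le (g := fun k => C * 8 * (C * Gam k))).
- apply: measurable_funM; first apply: measurable_funM.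
  + by under eq_fun do rewrite expr2; exact: measurable_funM.
  + exact: m3_kap.
  + have mc := m3_cross.
    apply: measurable_funD; first apply: measurable_funD; apply: measurable_funM.
    * exact: (mc m 0).
    * exact: (mc m' 0).
    * exact: (mc m 1).
    * exact: (mc m' 1).
    * exact: (mc m 2).
    * exact: (mc m' 2).
- exact: i3Z.
- move=> k; rewrite /gker -mulrA normrM normrX expr2.
  (* Both cross products have norm at most |k|, so their scalar product is at most |k|^2. *)
  have h : `|kap k * dot3 (cross3 k (e3 m)) (cross3 k (e3 m'))| <= 1.
    set u := cross3 _ _; set v := cross3 _ _.
    have uv : `|dot3 u v| <= dot3 k k.
      have := cross_le k m; have := cross_le k m'; rewrite -/u -/v /dot3 ler_norml.
      have := sqr_ge0 (u.1.1 - v.1.1); have := sqr_ge0 (u.1.2 - v.1.2); have := sqr_ge0 (u.2 - v.2).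
      have := sqr_ge0 (u.1.1 + v.1.1); have := sqr_ge0 (u.1.2 + v.1.2); have := sqr_ge0 (u.2 + v.2).
      by rewrite !expr2; lra.
    rewrite normrM /kap; have [z|z] := eqVneq (dot3 k k) 0.
      by rewrite z invr0 normr0 mul0r.
    have zp : 0 < dot3 k k by rewrite lt_neqAle eq_sym z dot3_ge0.
    by rewrite gtr0_norm ?invr_gt0// mulrC ler_pdivrMr// mul1r.
  rewrite -[leRHS]mulr1; apply: ler_pM => //.
  apply: ler_pM => //; apply: (le_trans (fle k)).
  by rewrite ler_wpM2l// Gam_le.
Qed.

(** Both k x u and k x v are orthogonal to k, so a further cross product with k only multiplies
    their scalar product by |k|^2; [kap_kap] then reduces two factors [kap] to one. This is the
    idempotence of the projection. *)
Lemma transv_dot k u v :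
  \sum_(i < 3) Defs.coord (transv u k) i * Defs.coord (transv v k) i =
  \sum_(m < 3) \sum_(m' < 3) Defs.coord u m * Defs.coord v m' *
     (kap k * dot3 (cross3 k (e3 m)) (cross3 k (e3 m'))).
Proof.
rewrite !big_ord_recl !big_ord0 /Defs.coord /= /transv/=.
transitivity (kap k * kap k * dot3 k k * dot3 (cross3 k u) (cross3 k v)).
  by rewrite /dot3 /cross3/=; ring.
by rewrite kap_kap /dot3 /cross3 /e3 /=; ring.
Qed.

Lemma transv_coord u k j : Defs.coord (transv u k) j =
  kap k * dot3 k k * Defs.coord u j - kap k * dot3 k u * Defs.coord k j.
Proof. by move: j; apply: ord3_ind; rewrite /Defs.coord /transv /dot3/=; ring. Qed.

(** Cosine and sine products recombine into the cosine of a difference of positions. Of the two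
    factors [pic] one stays with the kernel; the other will cancel the (2 pi)^3 of Plancherel. *)
Lemma coef_sum k : \sum_(i < 3) (coefC i k ^+ 2 + coefS i k ^+ 2) =
  \sum_(l < P) \sum_(l' < P) M l * M l' * pic *
    \sum_(m < 3) \sum_(m' < 3) Defs.coord (S l) m * Defs.coord (S l') m' *
      (pic * gker m m' k * cos (dot3 k (xs l - xs l'))).
Proof.
pose t l i := Defs.coord (transv (S l) k) i.
have E i : coefC i k ^+ 2 + coefS i k ^+ 2 = \sum_(l < P) \sum_(l' < P)
    M l * M l' * pic ^+ 2 * phik k ^+ 2 * cos (dot3 k (xs l - xs l')) * (t l i * t l' i).
  rewrite !expr2 /coefC /coefS !big_distrlr -big_split/=; apply: eq_bigr => l _.
  rewrite -big_split/=; apply: eq_bigr => l' _.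
  have -> : dot3 k (xs l - xs l') = dot3 k (xs l) - dot3 k (xs l') by rewrite /dot3/=; ring.
  by rewrite cosB /beta -/(t l i) -/(t l' i); ring.
under eq_bigr do rewrite E.
rewrite exchange_big/=; apply: eq_bigr => l _.
rewrite exchange_big/=; apply: eq_bigr => l' _.
rewrite -mulr_sumr transv_dot !mulr_sumr; apply: eq_bigr => m _.
rewrite !mulr_sumr; apply: eq_bigr => m' _; rewrite /gker; ring.
Qed.

Lemma i3_gker_cos m m' y : i3 (fun k => pic * gker m m' k * cos (dot3 k y)).
Proof.
apply: (i3M_bounded (C := 1)); first exact/i3Z/i3_gker.
  by apply: m3_cos; exact: m3_dot3r.
by move=> k; exact: cos_max.
Qed.

Lemma pi3_gt0 : 0 < (2 * pi) ^+ 3 :> R.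
Proof. by rewrite exprn_gt0// mulr_gt0// pi_gt0. Qed.

Definition sqB0 x : R := B0 0 x ^+ 2 + B0 1 x ^+ 2 + B0 2 x ^+ 2.

Lemma i3_sqB0 : i3 sqB0.
Proof.
have [_ a _] := B0_energy 0; have [_ b _] := B0_energy 1; have [_ c _] := B0_energy 2.
by apply: i3D => //; exact: i3D.
Qed.

Lemma int3_sqB0 : int3 sqB0 = \sum_(l < P) \sum_(l' < P) M l * M l' *
    \sum_(m < 3) \sum_(m' < 3) Defs.coord (S l) m * Defs.coord (S l') m' *
      Gcos m m' (xs l - xs l').
Proof.
have [a0 a1 a2] := B0_energy 0; have [b0 b1 b2] := B0_energy 1.
have [c0 c1 c2] := B0_energy 2.
transitivity ((2 * pi) ^+ 3 * int3 (fun k => \sum_(i < 3) (coefC i k ^+ 2 + coefS i k ^+ 2))).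
  rewrite int3D//; last exact: i3D.
  rewrite int3D// a2 b2 c2 -!mulrDr -int3D// -int3D//; last exact: i3D.
  congr (_ * _); apply: int3_eq => k; rewrite sum_ord3.
  by [].
rewrite (int3_eq coef_sum).
have ic l l' m m' := i3Z (Defs.coord (S l) m * Defs.coord (S l') m')
  (i3_gker_cos m m' (xs l - xs l')).
rewrite int3_sum; last first.
  by move=> l; apply: i3_sum => l'; apply: i3Z; apply: i3_sum => m; exact: i3_sum.
rewrite mulr_sumr; apply: eq_bigr => l _.
rewrite int3_sum; last by move=> l'; apply: i3Z; apply: i3_sum => m; exact: i3_sum.
rewrite mulr_sumr; apply: eq_bigr => l' _.
rewrite int3Z; last by apply: i3_sum => m; exact: i3_sum.
rewrite mulrA; congr (_ * _).
  by rewrite mulrCA /pic mulfV ?mulr1// gt_eqF// pi3_gt0.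
rewrite int3_sum; last by move=> m; exact: i3_sum.
apply: eq_bigr => m _; rewrite int3_sum//; apply: eq_bigr => m' _.
by rewrite int3Z//; exact: i3_gker_cos.
Qed.

Lemma Re_rho y : complex.Re (rho phi y) = pic * ct phik y.
Proof.
rewrite /rho /cint3 /ct /phik /= !mul0r !subr0 ?addr0 ?mul1r.
rewrite -[_ ^- 3]/pic; congr (_ * _).
have -> : (fun k => phi (norm3 k) * cos (dot3 k y) - 0 * sin (dot3 k y)) =
  (fun k => phi (norm3 k) * cos (dot3 k y)) by apply/funext => k; rewrite mul0r subr0.
by rewrite subr0 addr0.
Qed.

Lemma pd_rho j y : pd j (fun y => complex.Re (rho phi y)) y =
  pic * - st (fun k => Defs.coord k j * phik k) y.
Proof.
have [C [_ [hf _]]] := decay_beta.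
have -> : (fun y => complex.Re (rho phi y)) = pic \*: ct phik.
  by apply/funext => z; exact: Re_rho.
have := is_deriveZ pic (is_derive_ct j y (decay_weak hf)).
by move=> [_].
Qed.

(** The transverse part differs from S by a multiple of k, which drops out of the antisymmetric
    combination since k x k = 0. The curl thus sees S itself. *)
Lemma st_curl l i j y :
  st (fun k => Defs.coord k i * beta l j k) y - st (fun k => Defs.coord k j * beta l i k) y =
  st (fun k => Defs.coord k i * phik k) y * Defs.coord (S l) j -
  st (fun k => Defs.coord k j * phik k) y * Defs.coord (S l) i.
Proof.
have [C [_ [hf hb]]] := decay_beta.
have ib i' j' := decay_st y (decay_coord j' (hb l i')).
have ip j' := decay_st y (decay_coord j' hf).
rewrite /st -int3B// mulrC [X in _ - X]mulrC -!int3Z// -int3B; try exact: i3Z.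
apply: int3_eq => k; rewrite /beta !transv_coord.
transitivity (phik k * sin (dot3 k y) *
  ((kap k * dot3 k k * Defs.coord k i) * Defs.coord (S l) j
   - (kap k * dot3 k k * Defs.coord k j) * Defs.coord (S l) i)); first by ring.
by rewrite !kap_dot3; ring.
Qed.

(** The coefficient (k x S) x k is orthogonal to k. *)
Lemma st_div l y : st (fun k => Defs.coord k 0 * beta l 0 k) y +
  st (fun k => Defs.coord k 1 * beta l 1 k) y + st (fun k => Defs.coord k 2 * beta l 2 k) y = 0.
Proof.
have [C [_ [hf hb]]] := decay_beta.
have ib i' j' := decay_st y (decay_coord j' (hb l i')).
rewrite /st -int3D// -int3D//; last exact: i3D.
rewrite -[RHS](int3_0 R); apply: int3_eq => k; rewrite /beta /Defs.coord /transv/=; ring.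
Qed.

Lemma fst_sum (A B : zmodType) (I : Type) (s : seq I) (F : I -> (A * B)%type) :
  (\sum_(i <- s) F i).1 = \sum_(i <- s) (F i).1.
Proof. by elim: s => [|i s IH]; rewrite ?big_nil// !big_cons/= IH. Qed.

Lemma snd_sum (A B : zmodType) (I : Type) (s : seq I) (F : I -> (A * B)%type) :
  (\sum_(i <- s) F i).2 = \sum_(i <- s) (F i).2.
Proof. by elim: s => [|i s IH]; rewrite ?big_nil// !big_cons/= IH. Qed.

Lemma curl_B0 x : ((dB0 2 1 x - dB0 1 2 x, dB0 0 2 x - dB0 2 0 x), dB0 1 0 x - dB0 0 1 x) =
  jclass M xs phi S x.
Proof.
have E i j : dB0 i j x - dB0 j i x = \sum_(l < P) M l *
   ((pic * - st (fun k => Defs.coord k j * phik k) (x - xs l)) * Defs.coord (S l) i -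
    (pic * - st (fun k => Defs.coord k i * phik k) (x - xs l)) * Defs.coord (S l) j).
  rewrite /dB0 -sumrB; apply: eq_bigr => l _.
  have := st_curl l j i (x - xs l).
  set a := st _ _; set b := st _ _; set c := st _ _; set d := st _ _ => h.
  transitivity (- (M l * pic * (a - b))); first by ring.
  by rewrite h; ring.
rewrite !E; apply/esym; rewrite [LHS]surjective_pairing [(jclass _ _ _ _ _).1]surjective_pairing.
rewrite /jclass !fst_sum !snd_sum.
by congr ((_, _), _); apply: eq_bigr => l _; rewrite /= !pd_rho.
Qed.

Lemma div_B0 x : dB0 0 0 x + dB0 1 1 x + dB0 2 2 x = 0.
Proof.
rewrite /dB0 -!big_split/= big1// => l _.
by rewrite -!mulrDr -!opprD st_div oppr0 mulr0.
Qed.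
End energy.

(** * Uniqueness of the field and the kernel at coinciding sites *)

Section uniqueness.
Variables (R : realType) (P : nat) (M : 'I_P -> R) (xs S : 'I_P -> v3 R).
Variables (phi : R -> R).
Hypothesis hphi : schwartz phi.

(** [div_curl_free_L2] applied to B - B0 gives equality almost everywhere, which is all that the
    energies see. *)
Lemma Bclass_energy (B : v3 R -> v3 R) : is_Bclass M xs phi S B ->
  int3 (fun x => dot3 (B x) (B x)) = int3 (sqB0 M xs S phi).
Proof.
have aux (a b c d : R) : a - b = c - d -> a - c = b - d by lra.
have aux' (a b c d e f : R) : a + b + c = 0 -> d + e + f = 0 ->
  a - d + (b - e) + (c - f) = 0 by lra.
move=> [dB cB iB divB curlB].
pose D i x := compB B i x - B0 M xs S phi i x.
pose dD i j x := pd j (compB B i) x - dB0 M xs S phi i j x.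
have cD i : continuous (D i).
  move=> x; apply: cvgB; last exact: (@continuous_B0 R P M xs S phi hphi i x).
  exact: differentiable_continuous (dB i x).
have cdD i j : continuous (dD i j).
  by move=> x; apply: cvgB; [exact: cB|exact: (@continuous_dB0 R P M xs S phi hphi i j x)].
have DD i j x : is_derive x (e3 j) (D i) (dD i j x).
  have h1 : is_derive x (e3 j) (compB B i) (pd j (compB B i) x).
    by apply: derivableP; exact: diff_derivable.
  exact: (is_deriveB h1 (is_derive_B0 M xs S hphi i j x)).
have curlD x : [/\ dD 1 0 x = dD 0 1 x, dD 2 0 x = dD 0 2 x & dD 2 1 x = dD 1 2 x].
  have := etrans (curlB x) (esym (curl_B0 M xs S hphi x)).
  rewrite /curl3 /dD => -[h1 h2 h3].
  by split; [exact: aux h3|apply/esym; exact: aux h2|exact: aux h1].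
have divD x : dD 0 0 x + dD 1 1 x + dD 2 2 x = 0.
  exact: aux' (divB x) (div_B0 M xs S hphi x).
have iD : i3 (fun x => D 0 x ^+ 2 + D 1 x ^+ 2 + D 2 x ^+ 2).
  apply: (i3_le (g := fun x => 2 * dot3 (B x) (B x) + 2 * sqB0 M xs S phi x)).
  - have mD i : m3 (fun x => D i x ^+ 2).
      under eq_fun do rewrite expr2.
      by apply: measurable_funM; apply: continuous_measurable_v3.
    apply: measurable_funD; last exact: (mD 2).
    by apply: measurable_funD; [exact: (mD 0)|exact: (mD 1)].
  - by apply: i3D; apply: i3Z => //; exact: i3_sqB0.
  - move=> x; rewrite ger0_norm ?addr_ge0 ?sqr_ge0// /D /sqB0 /dot3 /compB /Defs.coord/=.
    set a := (B x).1.1; set b := (B x).1.2; set c := (B x).2.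
    set a' := B0 _ _ _ _ 0 x; set b' := B0 _ _ _ _ 1 x; set c' := B0 _ _ _ _ 2 x.
    (* |B + B0|^2 >= 0 is the bound |B - B0|^2 <= 2 |B|^2 + 2 |B0|^2. *)
    have := sqr_ge0 (a + a'); have := sqr_ge0 (b + b'); have := sqr_ge0 (c + c').
    by rewrite !expr2; lra.
have int0 := div_curl_free_L2 (cD 0) (cD 1) (cD 2) (cdD 0) (cdD 1) (cdD 2)
  (DD 0) (DD 1) (DD 2) curlD divD iD.
have q0 x : 0 <= D 0 x ^+ 2 + D 1 x ^+ 2 + D 2 x ^+ 2 by rewrite !addr_ge0 ?sqr_ge0.
have ae0 : ae_eq (@leb3 R) setT (EFin \o (fun x => D 0 x ^+ 2 + D 1 x ^+ 2 + D 2 x ^+ 2)) (cst 0%E).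
  apply/ae_eq_integral_abs => //; first by apply/measurable_EFinP; exact: i3_m3.
  rewrite -[RHS]/((0 : R)%:E) -int0 -EFin_int3//.
  by apply: eq_integral => x _; rewrite /= ger0_norm.
rewrite /int3 /Rintegral; congr fine; apply: ae_eq_integral => //.
- exact: measurable_int iB.
- by apply: measurable_int; exact: (i3_sqB0 M xs S hphi).
- apply: filterS ae0 => x /= /(_ I) [] /eqP.
  rewrite paddr_eq0 ?addr_ge0 ?sqr_ge0// paddr_eq0 ?sqr_ge0// !sqrf_eq0 !subr_eq0.
  move=> /andP[/andP[/eqP e0 /eqP e1] /eqP e2] _.
  by rewrite /sqB0 -e0 -e1 -e2 /dot3 !expr2.
Qed.

Lemma int3_opp (f : v3 R -> R) : i3 f -> int3 (fun k => f (- k)) = int3 f.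
Proof.
move=> fi; have n1 : (-1 : R) != 0 by rewrite oppr_eq0 oner_eq0.
have := scales_Rintegral (@scales_aff3 R 0 ((-1, -1), -1) n1 n1 n1) fi.
rewrite /= normrN normr1 invr1 !mulr1 mul1r => E.
transitivity (int3 (fun k => f (aff3 0 ((-1, -1), -1) k))); last exact: E.
apply: int3_eq => k.
congr f; case: k => [[k1 k2] k3]; rewrite /aff3/=.
by congr ((_, _), _); rewrite ?mulN1r add0r.
Qed.

Lemma gkerN m m' k : gker phi m m' (- k) = gker phi m m' k.
Proof.
rewrite /gker phikN (_ : kap (- k) = kap k); last by rewrite /kap /dot3/= !mulrNN.
by congr (_ * _); rewrite /dot3 /cross3/=; ring.
Qed.

(** The kernel is even and the sine is odd. This removes the imaginary part of the photon
    integral. *)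
Lemma Gsin0 m m' y : int3 (fun k => pic R * gker phi m m' k * sin (dot3 k y)) = 0.
Proof.
have fi : i3 (fun k => pic R * gker phi m m' k * sin (dot3 k y)).
  apply: (i3M_bounded (C := 1)); first exact/i3Z/(i3_gker hphi).
    by apply: m3_sin; exact: m3_dot3r.
  by move=> k; exact: sin_max.
have := int3_opp fi.
have -> : (fun k => pic R * gker phi m m' (- k) * sin (dot3 (- k) y)) =
   (fun k => (-1) * (pic R * gker phi m m' k * sin (dot3 k y))).
  by apply/funext => k; rewrite gkerN dot3N sinN; ring.
by rewrite int3Z// => h; lra.
Qed.

Lemma Gcos0E m m' : Gcos phi m m' 0 = pic R * int3 (gker phi m m').
Proof.
rewrite /Gcos -int3Z; last exact: (i3_gker hphi).
apply: int3_eq => k; rewrite (_ : dot3 k 0 = 0) ?cos0 ?mulr1//.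
by rewrite /dot3/= !mulr0 !addr0.
Qed.

(** Because |k x e_1|^2 = |k|^2 - k_1^2. *)
Lemma A110E : A110 phi = pic R * int3 (gker phi 0 0).
Proof.
rewrite /A110; congr (_ * _); apply: int3_eq => k.
rewrite norm3_sqr real_normK ?num_real// /gker /phik /kap -mulrA; congr (_ * _).
by rewrite mulrC; congr (_ * _); rewrite /dot3 /cross3 /e3/=; ring.
Qed.

Lemma phik_dot k k' : dot3 k k = dot3 k' k' -> phik phi k = phik phi k'.
Proof. by rewrite /phik /norm3 => ->. Qed.

Lemma Gcos_diag m : Gcos phi m m 0 = A110 phi.
Proof.
rewrite A110E Gcos0E; congr (_ * _).
have h1 : int3 (gker phi 1 1) = int3 (gker phi 0 0).
  rewrite -(int3_swap01 (i3_gker hphi 0 0)); apply: int3_eq => k.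
  have dE : dot3 ((k.1.2, k.1.1), k.2) ((k.1.2, k.1.1), k.2) = dot3 k k.
    by rewrite /dot3/=; ring.
  by rewrite /gker (phik_dot dE) /kap dE /dot3 /cross3 /e3/=; congr (_ * _); ring.
have h2 : int3 (gker phi 2 2) = int3 (gker phi 1 1).
  rewrite -(int3_swap12 (i3_gker hphi 1 1)); apply: int3_eq => k.
  have dE : dot3 ((k.1.1, k.2), k.1.2) ((k.1.1, k.2), k.1.2) = dot3 k k.
    by rewrite /dot3/=; ring.
  by rewrite /gker (phik_dot dE) /kap dE /dot3 /cross3 /e3/=; congr (_ * _); ring.
by move: m; apply: ord3_ind => //; rewrite h2 h1.
Qed.

(* A reflection [x_i -> - x_i] that flips the sign of an odd integrand. *)
Lemma int3_flip (s : v3 R) (f : v3 R -> R) : i3 f ->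
  `|s.1.1| = 1 -> `|s.1.2| = 1 -> `|s.2| = 1 ->
  (forall k, f ((s.1.1 * k.1.1, s.1.2 * k.1.2), s.2 * k.2) = - f k) -> int3 f = 0.
Proof.
move=> fi s1 s2 s3 fN.
have nz (t : R) : `|t| = 1 -> t != 0 by move=> t1; rewrite -normr_eq0 t1 oner_eq0.
have := scales_Rintegral (@scales_aff3 R 0 s (nz _ s1) (nz _ s2) (nz _ s3)) fi.
rewrite s1 s2 s3 invr1 !mulr1 mul1r => E.
have : int3 (fun k => - 1 * f k) = int3 f.
  by rewrite -[RHS]E; apply: int3_eq => k; rewrite /aff3 !add0r fN mulN1r.
by rewrite int3Z// => h; lra.
Qed.

Lemma gkerC m m' : gker phi m m' = gker phi m' m.
Proof. by apply/funext => k; rewrite /gker [X in _ * X]dot3C. Qed.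

Lemma Gcos_offdiag m m' : m != m' -> Gcos phi m m' 0 = 0.
Proof.
have n1 : `|-1 : R| = 1 by rewrite normrN normr1.
have dE s k : `|s.1.1| = 1 -> `|s.1.2| = 1 -> `|s.2| = 1 ->
   dot3 ((s.1.1 * k.1.1, s.1.2 * k.1.2), s.2 * k.2) ((s.1.1 * k.1.1, s.1.2 * k.1.2), s.2 * k.2) = dot3 k k :> R.
  move=> s1 s2 s3; rewrite /dot3/= -!expr2 !exprMn.
  rewrite -[s.1.1 ^+ 2]real_normK ?num_real// -[s.1.2 ^+ 2]real_normK ?num_real//.
  by rewrite -[s.2 ^+ 2]real_normK ?num_real// s1 s2 s3 !expr1n !mul1r.
(* Off the diagonal the kernel is - k_m k_m' times a radial function, so flipping one of the two
   axes reverses its sign. *)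
have h01 : int3 (gker phi 0 1) = 0.
  apply: (@int3_flip ((-1, 1), 1)); rewrite ?normr1//; first exact: (i3_gker hphi).
  move=> k; have E := dE ((-1, 1), 1) k n1 (normr1 _) (normr1 _).
  by rewrite /gker (phik_dot E) /kap E /dot3 /cross3 /e3/=; ring.
have h02 : int3 (gker phi 0 2) = 0.
  apply: (@int3_flip ((-1, 1), 1)); rewrite ?normr1//; first exact: (i3_gker hphi).
  move=> k; have E := dE ((-1, 1), 1) k n1 (normr1 _) (normr1 _).
  by rewrite /gker (phik_dot E) /kap E /dot3 /cross3 /e3/=; ring.
have h12 : int3 (gker phi 1 2) = 0.
  apply: (@int3_flip ((1, -1), 1)); rewrite ?normr1//; first exact: (i3_gker hphi).
  move=> k; have E := dE ((1, -1), 1) k (normr1 _) n1 (normr1 _).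
  by rewrite /gker (phik_dot E) /kap E /dot3 /cross3 /e3/=; ring.
rewrite Gcos0E; move: m m'; apply: ord3_ind; apply: ord3_ind => // _.
- by rewrite h01 mulr0.
- by rewrite h02 mulr0.
- by rewrite gkerC h01 mulr0.
- by rewrite h12 mulr0.
- by rewrite gkerC h02 mulr0.
- by rewrite gkerC h12 mulr0.
Qed.
End uniqueness.

(** * Complex integrals and the pairing of two coupling functions *)

Local Open Scope complex_scope.

Section complex_integrals.
Variable R : realType.
Implicit Types (z w : R[i]) (r : R).

Lemma complex_ext z w :
  complex.Re z = complex.Re w -> complex.Im z = complex.Im w -> z = w.
Proof. by case: z => a b; case: w => c d /= -> ->. Qed.

Lemma Re_sum (I : Type) (s : seq I) (Q : pred I) (F : I -> R[i]) :
  complex.Re (\sum_(i <- s | Q i) F i) = \sum_(i <- s | Q i) complex.Re (F i).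
Proof. by apply: (big_morph (@complex.Re R)) => [[a b] [c d]|]. Qed.

Lemma Im_sum (I : Type) (s : seq I) (Q : pred I) (F : I -> R[i]) :
  complex.Im (\sum_(i <- s | Q i) F i) = \sum_(i <- s | Q i) complex.Im (F i).
Proof. by apply: (big_morph (@complex.Im R)) => [[a b] [c d]|]. Qed.

Lemma ReM z w : complex.Re (z * w) =
  complex.Re z * complex.Re w - complex.Im z * complex.Im w.
Proof. by case: z; case: w. Qed.

Lemma ImM z w : complex.Im (z * w) =
  complex.Re z * complex.Im w + complex.Im z * complex.Re w.
Proof. by case: z; case: w. Qed.

Lemma cint3E (f : v3 R -> R[i]) : cint3 f =
  Complex (int3 (fun k => complex.Re (f k))) (int3 (fun k => complex.Im (f k))).
Proof. by apply: complex_ext; rewrite /=; ring. Qed.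

Lemma cint3_sum (I : Type) (s : seq I) (z : I -> R[i]) (f g : I -> v3 R -> R) :
  (forall i, i3 (f i)) -> (forall i, i3 (g i)) ->
  cint3 (fun k => \sum_(i <- s) z i * Complex (f i k) (g i k)) =
  \sum_(i <- s) z i * Complex (int3 (f i)) (int3 (g i)).
Proof.
move=> fi gi; rewrite cint3E; apply: complex_ext => /=.
  under int3_eq do rewrite Re_sum; rewrite Re_sum int3_sum; last first.
    by move=> i; under eq_fun do rewrite ReM/=; apply: i3B; exact: i3Z.
  apply: eq_bigr => i _; rewrite ReM -!int3Z// -int3B; try exact: i3Z.
  by apply: int3_eq => k; rewrite ReM.
under int3_eq do rewrite Im_sum; rewrite Im_sum int3_sum; last first.
  by move=> i; under eq_fun do rewrite ImM/=; apply: i3D; exact: i3Z.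
apply: eq_bigr => i _; rewrite ImM -!int3Z// -int3D; try exact: i3Z.
by apply: int3_eq => k; rewrite ImM.
Qed.

(** The factors i and its conjugate multiply to 1 and the phases to exp(i k . (x - x')). The squared
    |k|^(1/2) is cancelled by the 1/|k| of the inverse Hamiltonian; the |k|^-2 that remains
    normalises the two cross products. *)
Lemma conj_Bmx_mul (phi : R -> R) m m' (x x' k : v3 R) :
  (1 / norm3 k)%:C * \sum_(j < 3) (Bmx phi m x k j)^* * Bmx phi m' x' k j =
  Complex (pic R * gker phi m m' k * cos (dot3 k (x - x')))
          (pic R * gker phi m m' k * sin (dot3 k (x - x'))).
Proof.
set A := phi (norm3 k) * Num.sqrt (norm3 k) / Num.sqrt ((2 * pi) ^+ 3).
have E j : (Bmx phi m x k j)^* * Bmx phi m' x' k j =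
  (A ^+ 2 * (norm3 k)^-1 ^+ 2)%:C * expi (dot3 k (x - x')) *
  (Defs.coord (cross3 k (e3 m)) j * Defs.coord (cross3 k (e3 m')) j)%:C.
  rewrite /Bmx -/A /expi !cosN !sinN.
  have -> : dot3 k (x - x') = dot3 k x - dot3 k x' by rewrite /dot3/=; ring.
  by rewrite cosB sinB; apply: complex_ext => /=; ring.
under eq_bigr do rewrite E.
rewrite -mulr_sumr.
have -> : \sum_(j < 3) (Defs.coord (cross3 k (e3 m)) j * Defs.coord (cross3 k (e3 m')) j)%:C =
    (dot3 (cross3 k (e3 m)) (cross3 k (e3 m')))%:C.
  by rewrite sum_ord3 -!rmorphD.
have -> : pic R * gker phi m m' k = (norm3 k)^-1 * (A ^+ 2 * (norm3 k)^-1 ^+ 2) *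
    dot3 (cross3 k (e3 m)) (cross3 k (e3 m')).
  rewrite /gker mulrA; congr (_ * _).
  have -> : A ^+ 2 = phi (norm3 k) ^+ 2 * norm3 k * pic R.
    rewrite /A 2!exprMn exprVn sqr_sqrtr ?sqrtr_ge0// sqr_sqrtr//.
    exact: ltW (pi3_gt0 R).
  rewrite /kap -norm3_sqr /phik -exprVn; set p := phi _.
  (* This cancellation needs |k| <> 0; at the origin both sides vanish because the inverses do. *)
  have [->|n0] := eqVneq (norm3 k) 0; first by rewrite invr0 expr0n/=; ring.
  transitivity (p ^+ 2 * ((norm3 k)^-1 * norm3 k) * pic R * (norm3 k)^-1 ^+ 2).
    by rewrite mulVf//; ring.
  by ring.
by apply: complex_ext => /=; ring.
Qed.
End complex_integrals.

(** * Contraction of the photon *)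

Section photon.
Variables (R : realType) (P : nat) (M : 'I_P -> R) (xs : 'I_P -> v3 R).
Variables (phi : R -> R).
Hypothesis hphi : schwartz phi.

Lemma photon_contraction l m (X : sstate R P) s :
  cint3 (fun k => \sum_(j < 3) (Bmx phi m (xs l) k j)^* *
    Hph_inv (Hint_up M xs phi X) k j s) =
  \sum_(l' < P) \sum_(m' < 3) (M l' / Num.sqrt 2)%:C * sigma_at l' m' X s *
     (Gcos phi m m' (xs l - xs l'))%:C.
Proof.
(* Site and component are merged into one index, which leaves a single sum of spin constants times
   integrable kernels for [cint3_sum]. *)
pose z (p : 'I_P * 'I_3) := (M p.1 / Num.sqrt 2)%:C * sigma_at p.1 p.2 X s.
pose f (p : 'I_P * 'I_3) k := pic R * gker phi m p.2 k * cos (dot3 k (xs l - xs p.1)).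
pose g (p : 'I_P * 'I_3) k := pic R * gker phi m p.2 k * sin (dot3 k (xs l - xs p.1)).
have E k : \sum_(j < 3) (Bmx phi m (xs l) k j)^* * Hph_inv (Hint_up M xs phi X) k j s =
  \sum_(p : 'I_P * 'I_3) z p * Complex (f p k) (g p k).
  rewrite /Hph_inv /Hint_up.
  transitivity (\sum_(j < 3) \sum_(p : 'I_P * 'I_3)
     z p * ((1 / norm3 k)%:C * ((Bmx phi m (xs l) k j)^* * Bmx phi p.2 (xs p.1) k j))).
    apply: eq_bigr => j _; rewrite pair_bigA !mulr_sumr/=.
    by apply: eq_bigr => p _; rewrite /z; ring.
  rewrite exchange_big/=; apply: eq_bigr => p _.
  by rewrite -mulr_sumr -mulr_sumr conj_Bmx_mul.
rewrite (_ : (fun k => _) = fun k => \sum_(p : 'I_P * 'I_3) z p * Complex (f p k) (g p k)); last exact/funext.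
rewrite cint3_sum; last 2 first.
- by move=> p; exact: i3_gker_cos.
- move=> p; apply: (i3M_bounded (C := 1)); first exact/i3Z/i3_gker.
    by apply: m3_sin; exact: m3_dot3r.
  by move=> k; exact: sin_max.
rewrite pair_bigA/=; apply: eq_bigr => p _.
by rewrite [X in Complex _ X](Gsin0 hphi).
Qed.
End photon.

(** * Spin expectations in product states *)

Section spin.
Variables (R : realType) (P : nat).
Implicit Types (X Y : sstate R P) (V U : 'I_P -> 'cV[R[i]]_2).

Lemma sigma_at_sum (I : Type) (r : seq I) l m (c : I -> R[i]) (X : I -> sstate R P) s :
  sigma_at l m (fun s => \sum_(i <- r) c i * X i s) s =
  \sum_(i <- r) c i * sigma_at l m (X i) s.
Proof.
rewrite /sigma_at; under eq_bigr do rewrite mulr_sumr.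
rewrite exchange_big/=; apply: eq_bigr => i _; rewrite mulr_sumr.
by apply: eq_bigr => t _; rewrite mulrCA.
Qed.

Lemma sigma_at_prodX l m V : sigma_at l m (prodX V) =
  prodX (fun mu => if mu == l then pauli m *m V l else V mu).
Proof.
apply/funext => s; rewrite /sigma_at /prodX [RHS](bigD1 l)//= eqxx !mxE mulr_suml.
apply: eq_bigr => t _; rewrite (bigD1 l)//= ffunE eqxx mulrA; congr (_ * _).
by apply: eq_bigr => mu /negbTE ml; rewrite ffunE ml.
Qed.

Definition cdot (v w : 'cV[R[i]]_2) : R[i] := \sum_(a < 2) v a 0 * (w a 0)^*.

(** Distributivity: a sum over spin configurations of a product over sites factors into one sum per
    site. *)
Lemma sdot_prodX U V : sdot (prodX U) (prodX V) = \prod_(l < P) cdot (U l) (V l).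
Proof.
rewrite /sdot /cdot bigA_distr_bigA/=; apply: eq_bigr => s _.
by rewrite /prodX rmorph_prod -big_split.
Qed.

Lemma sdot_sum (I : Type) (r : seq I) (c : I -> R[i]) (X : I -> sstate R P) Y :
  sdot (fun s => \sum_(i <- r) c i * X i s) Y = \sum_(i <- r) c i * sdot (X i) Y.
Proof.
rewrite /sdot; under eq_bigr do rewrite mulr_suml.
rewrite exchange_big/=; apply: eq_bigr => i _; rewrite mulr_sumr.
by apply: eq_bigr => t _; rewrite mulrA.
Qed.

Lemma sum_ord2 (W : nmodType) (F : 'I_2 -> W) : \sum_(i < 2) F i = F 0 + F 1.
Proof.
by rewrite !big_ord_recl big_ord0 addr0; congr (_ + F _); exact: val_inj.
Qed.

Lemma pauli_sqr m (v : 'cV[R[i]]_2) : pauli m *m (pauli m *m v) = v.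
Proof.
rewrite mulmxA (_ : pauli m *m pauli m = 1%:M) ?mul1mx//.
apply/matrixP => a b; rewrite !mxE sum_ord2 !mxE.
move: m a b; apply: ord3_ind => -[[|[|//]] ?] [[|[|//]] ?];
  by apply: complex_ext => /=; ring.
Qed.

(** [Sof] keeps only real parts; nothing is lost because the Pauli matrices are Hermitian. *)
Lemma cdot_pauli V l m :
  cdot (pauli m *m V l) (V l) = (Defs.coord (Sof V l) m)%:C.
Proof.
have E : Defs.coord (Sof V l) m = complex.Re (cdot (pauli m *m V l) (V l)).
  by move: m; apply: ord3_ind.
apply: complex_ext; rewrite E//= /cdot sum_ord2 !mxE !sum_ord2 !mxE.
case: (V l 0 0) (V l 1 0) => a b [c d].
by move: m {E}; apply: ord3_ind => /=; ring.
Qed.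

(** The identity |S| = |V|^2 behind the Hopf map, polynomial in the four real coordinates of the
    spinor. *)
Lemma Sof_unit V l : \sum_(a < 2) `|V l a 0| ^+ 2 = 1 ->
  \sum_(m < 3) Defs.coord (Sof V l) m ^+ 2 = 1.
Proof.
have nE (z : R[i]) : `|z| ^+ 2 = (complex.Re z ^+ 2 + complex.Im z ^+ 2)%:C.
  by case: z => a b; rewrite sqr_normc; apply: complex_ext => /=; ring.
rewrite sum_ord2 !nE -rmorphD => -[]; rewrite sum_ord3 /Sof/= /Defs.coord/=.
rewrite !sum_ord2 !mxE !sum_ord2 !mxE /=.
case: (V l 0 0) (V l 1 0) => a b [c d] /= h.
transitivity ((a ^+ 2 + b ^+ 2 + (c ^+ 2 + d ^+ 2)) ^+ 2); last by rewrite h expr1n.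
by ring.
Qed.

Lemma cdot_unit V l : \sum_(a < 2) `|V l a 0| ^+ 2 = 1 -> cdot (V l) (V l) = 1.
Proof.
by move=> <-; apply: eq_bigr => a _; rewrite sqr_normc.
Qed.

Variables (V : 'I_P -> 'cV[R[i]]_2).
Hypothesis hV : forall l : 'I_P, \sum_(a < 2) `|V l a 0| ^+ 2 = 1.

Lemma sdot_sigma_same l m :
  sdot (sigma_at l m (sigma_at l m (prodX V))) (prodX V) = 1.
Proof.
rewrite !sigma_at_prodX sdot_prodX big1// => mu _; rewrite eqxx pauli_sqr.
by have [->|_] := eqVneq mu l; exact: cdot_unit.
Qed.

Lemma sdot_sigma_distinct l l' m m' : l != l' ->
  sdot (sigma_at l m (sigma_at l' m' (prodX V))) (prodX V) =
  (Defs.coord (Sof V l) m * Defs.coord (Sof V l') m')%:C.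
Proof.
move=> ll'; rewrite !sigma_at_prodX sdot_prodX (bigD1 l)//= eqxx (negbTE ll').
rewrite (bigD1 l')/=; last by rewrite eq_sym.
rewrite eq_sym (negbTE ll') eqxx big1 ?mulr1.
  by rewrite !cdot_pauli rmorphM.
by move=> mu /andP[/negbTE -> /negbTE ->]; exact: cdot_unit.
Qed.
End spin.

(** * Comparison of the two double sums *)

Lemma inv_sqrt2_sqr (R : realType) : (Num.sqrt 2)^-1 ^+ 2 = 1 / 2 :> R.
Proof. by rewrite exprVn sqr_sqrtr// div1r. Qed.

Theorem theorem2p3 (R : realType) (P : nat) (hP : (0 < P)%N)
  (xs : 'I_P -> v3 R) (phi : R -> R) (hphi : schwartz phi)
  (V : 'I_P -> 'cV[R[i]]_2)
  (hV : forall l : 'I_P, \sum_(a < 2) `|V l a 0| ^+ 2 = 1)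
  (M : 'I_P -> R) (B : v3 R -> v3 R)
  (hB : is_Bclass M xs phi (Sof V) B) :
  sdot (AM M xs phi (prodX V)) (prodX V) =
  (- (1 / 2) * int3 (fun x => dot3 (B x) (B x))
     - A110 phi * \sum_(l < P) M l ^+ 2)%:C.
Proof.
rewrite (Bclass_energy hphi hB) (int3_sqB0 _ _ _ hphi).
pose G l l' m m' := Gcos phi m m' (xs l - xs l').
pose X := prodX V; pose S := Sof V.
pose T l m l' m' : R[i] := sdot (sigma_at l m (sigma_at l' m' X)) X.
(* The factor 1/2 is the product of the two 1/sqrt 2 of the Segal fields. *)
have E s : AM M xs phi X s = \sum_(p : ('I_P * 'I_3) * ('I_P * 'I_3))
    (- (1 / 2) * (M p.1.1 * M p.2.1 * G p.1.1 p.2.1 p.1.2 p.2.2))%:C *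
    sigma_at p.1.1 p.1.2 (sigma_at p.2.1 p.2.2 X) s.
  rewrite /AM /EHint_down pair_bigA -sumrN/=.
  rewrite -(pair_bigA _ (fun p q => (- (1 / 2) * (M p.1 * M q.1 * G p.1 q.1 p.2 q.2))%:C *
     sigma_at p.1 p.2 (sigma_at q.1 q.2 X) s))/=.
  apply: eq_bigr => p _.
  rewrite (_ : (fun s' => _) = fun s' => \sum_(q : 'I_P * 'I_3)
     ((M q.1 / Num.sqrt 2) * G p.1 q.1 p.2 q.2)%:C * sigma_at q.1 q.2 X s'); last first.
    apply/funext => s'; rewrite (photon_contraction M xs hphi) pair_bigA/=.
    by apply: eq_bigr => q _; rewrite rmorphM/=; ring.
  rewrite sigma_at_sum mulr_sumr -sumrN; apply: eq_bigr => q _.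
  rewrite mulrA -mulNr -rmorphM -rmorphN; congr (_%:C * _).
  by rewrite -inv_sqrt2_sqr; ring.
have {}E := funext E; rewrite -/X E.
rewrite sdot_sum -(pair_bigA _ (fun p q =>
   (- (1 / 2) * (M p.1 * M q.1 * G p.1 q.1 p.2 q.2))%:C * T p.1 p.2 q.1 q.2))/=.
(* The sum over components for a pair of sites; at l = l' each of the three components contributes
   [A110 phi]. *)
pose D l l' : R := if l == l' then 3 * A110 phi else
  \sum_(m < 3) \sum_(m' < 3) Defs.coord (S l) m * Defs.coord (S l') m' * G l l' m m'.
transitivity (\sum_(l < P) \sum_(l' < P) (- (1 / 2) * (M l * M l' * D l l'))%:C).
  rewrite -(pair_bigA _ (fun l m => \sum_(q : 'I_P * 'I_3)
   (- (1 / 2) * (M l * M q.1 * G l q.1 m q.2))%:C * T l m q.1 q.2))/=.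
  apply: eq_bigr => l _; under eq_bigr do rewrite -(pair_bigA _ (fun l' m' =>
    (- (1 / 2) * (M l * M l' * G l l' _ m'))%:C * T l _ l' m'))/=.
  rewrite exchange_big/=; apply: eq_bigr => l' _; rewrite /D.
  have [<-|ll'] := eqVneq l l'.
    transitivity (\sum_(m < 3) (- (1 / 2) * (M l * M l * A110 phi))%:C).
      apply: eq_bigr => m _; rewrite (bigD1 m)//= big1 => [|m' m'm].
        by rewrite addr0 /T /G subrr (Gcos_diag hphi) sdot_sigma_same ?mulr1.
      (* Products of distinct Pauli matrices at one site come with a kernel that vanishes at 0. *)
      by rewrite /G subrr (Gcos_offdiag hphi) 1?eq_sym// !mulr0 mul0r.
    by rewrite sum_ord3 -!rmorphD; congr (_%:C); ring.
  rewrite !mulr_sumr rmorph_sum; apply: eq_bigr => m _.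
  rewrite !mulr_sumr rmorph_sum; apply: eq_bigr => m' _.
  by rewrite /T sdot_sigma_distinct// -rmorphM; congr (_%:C); ring.
transitivity ((\sum_(l < P) \sum_(l' < P) (- (1 / 2) * (M l * M l' * D l l')))%:C).
  by rewrite rmorph_sum; apply: eq_bigr => l _; rewrite rmorph_sum.
congr (_%:C); rewrite !mulr_sumr -sumrB; apply: eq_bigr => l _.
(* Pairs with l' <> l agree term by term; at each site there remains -3/2 = -1/2 - 1, in units of
   A_11(0) M_l^2. *)
rewrite (bigD1 l)//= [X in _ = _ * X - _](bigD1 l)//= mulrDr addrAC.
congr (_ + _); last first.
  by rewrite mulr_sumr; apply: eq_bigr => l' /negbTE ll'; rewrite /D eq_sym ll'.
rewrite /D eqxx -/S.
have -> : \sum_(m < 3) \sum_(m' < 3)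
   Defs.coord (S l) m * Defs.coord (S l) m' * Gcos phi m m' (xs l - xs l) = A110 phi.
  rewrite -[RHS]mul1r -(Sof_unit (hV l)) mulr_suml; apply: eq_bigr => m _.
  rewrite (bigD1 m)//= big1 => [|m' m'm].
    by rewrite addr0 subrr (Gcos_diag hphi) expr2.
  by rewrite subrr (Gcos_offdiag hphi) 1?eq_sym// mulr0.
by field.
Qed.
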